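(* Let $X$ be a smooth projective complex curve of genus greater than $0$. (1) The spectrum of the algebra $\mathcal A=D_{GL_1}\otimes\overline D_{GL_1}$ acting on $L^2(\mathrm{Pic}^0(X))$ is discrete and in one-to-one correspondence with the set of $GL_1$-opers on $X$ with real monodromy (the correspondence sending a joint eigenvalue to the $GL_1$-oper given by its restriction to $D_{GL_1}$). (2) The $GL_1$-opers with real monodromy have the form $$\lambda(2\pi i\,\omega_\gamma)=\nabla_z-2\pi i\,\omega_\gamma,\qquad \gamma\in H^1(X,\mathbb Z).$$ The corresponding eigenfunction of $\mathcal A$ in $L^2(\mathrm{Pic}^0(X))$ is the Fourier harmonic $f_\gamma=e^{2\pi i\varphi_\gamma}$.
   Context: $\mathrm{Pic}^0(X)$ is the Jacobian of $X$. $D_{GL_1}$ (resp. $\overline D_{GL_1}$) is the algebra of global holomorphic (resp. anti-holomorphic) differential operators on $\mathrm{Pic}^0(X)$; $D_{GL_1}=\mathrm{Sym}\,H^1(X,\mathcal O_X)$ is generated by holomorphic translation-invariant vector fields, the tangent space of $\mathrm{Pic}^0(X)$ at the origin being $H^1(X,\mathcal O_X)\cong H^0(X,\Omega^{1,0})^*$. Thus $\mathcal A$ is generated by the $C^\infty$ translation vector fields and acts on $C^\infty(\mathrm{Pic}^0(X))\subset L^2(\mathrm{Pic}^0(X))$. A $GL_1$-oper on $X$ is a holomorphic connection on the trivial line bundle; it is written $\lambda(\mathbf a)=\nabla_z-\mathbf a$, $\mathbf a\in H^0(X,\Omega^{1,0})$, where $\nabla_z$ is the trivial holomorphic connection; together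 with the $(0,1)$ part it gives the flat connection $d-\mathbf a$. It has real monodromy if the monodromy representation $\pi_1(X)\to\mathbb C^\times$ of $d-\mathbf a$ takes values in $\mathbb R^\times$. The identification $\mathrm{Spec}\,D_{GL_1}=H^0(X,\Omega^{1,0})$ attaches to each character of $D_{GL_1}$ the $GL_1$-oper $\lambda(\mathbf a)$. For $\gamma\in H^1(X,\mathbb Z)$, $\varphi_\gamma=\omega_\gamma+\overline{\omega_\gamma}$, $\omega_\gamma\in H^0(X,\Omega^{1,0})$, denotes the unique harmonic real one-form representing the image of $\gamma$ in $H^1(X,\mathbb R)$. One identifies $\mathrm{Pic}^0(X)\cong H^0(X,\Omega^{1,0})^*/H_1(X,\mathbb Z)\cong H^1(X,\mathbb R)^*/H_1(X,\mathbb Z)$ via the real isomorphism $H^0(X,\Omega^{1,0})\to H^1(X,\mathbb R)$, $\omega\mapsto\omega+\overline\omega$, with $\beta\in H_1(X,\mathbb Z)$ embedded as the functional $c\mapsto\int_\beta c$. Viewing $\varphi_\gamma$ as a linear functional on $H^1(X,\mathbb R)^*$, the function $e^{2\pi i\varphi_\gamma}$ is well defined on $\mathrm{Pic}^0(X)$. *)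

(* Defs.v *)
From HB Require Import structures.
From mathcomp Require Import all_boot all_order all_algebra.
From mathcomp Require Import complex.
From mathcomp Require Import all_classical all_reals all_analysis.

Set Implicit Arguments.
Unset Strict Implicit.
Unset Printing Implicit Defensive.

Import Order.TTheory GRing.Theory Num.Theory.
Import numFieldNormedType.Exports.

Local Open Scope classical_set_scope.
Local Open Scope ring_scope.
Local Open Scope quotient_scope.

(* The complex numbers, as a [numClosedFieldType] so that they carry the
   topology and the complex derivative of a normed field over itself
   ([R[i]] itself is declared as a module over [R] only). *)
Definition Cplx (R : realType) : numClosedFieldType := R[i].

Definition re (R : realType) (z : Cplx R) : R := complex.Re z.
Definition im (R : realType) (z : Cplx R) : R := complex.Im z.
Definition cplx (R : realType) (x y : R) : Cplx R := Complex x y.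
Definition rcplx (R : realType) (x : R) : Cplx R := Complex x 0.
Definition cexp (R : realType) (z : Cplx R) : Cplx R :=
  rcplx (expR (re z)) * cplx (cos (im z)) (sin (im z)).
Definition abs2 (R : realType) (z : Cplx R) : R := re z ^+ 2 + im z ^+ 2.

Record riemann_surface (R : realType) := RiemannSurface {
  surface :> topologicalType;
  chart : Type;
  dom : chart -> set surface;
  coord : chart -> surface -> Cplx R;
  point : chart -> Cplx R -> surface;
  surface_hausdorff : hausdorff_space surface;
  dom_open : forall i, open (dom i);
  dom_cover : forall x, exists i, dom i x;
  coord_open : forall i, open (coord i @` dom i);
  coordK : forall i x, dom i x -> point i (coord i x) = x;
  coord_continuous : forall i x, dom i x -> {for x, continuous (coord i)};
  point_continuous : forall i z, (coord i @` dom i) z ->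
    {for z, continuous (point i)};
  transition_holomorphic : forall i j z,
    (coord i @` (dom i `&` dom j)) z ->
    derivable (coord j \o point i) z 1 }.

Definition two_pi_i (R : realType) : Cplx R := 2 * rcplx pi * 'i.
Arguments two_pi_i {R}.

Section Curve.
Variables (R : realType) (X : riemann_surface R).
Local Notation C := (Cplx R).

(* [F] gives homogeneous coordinates of a holomorphic injective immersion of
   the surface in P^N; near every point the line spanned by [F] is also spanned
   by a holomorphic vector [f], and immersivity means that [f] and [f'] are
   independent. *)
Definition projective_embedding (N : nat) (F : X -> 'rV[C]_N.+1) : Prop :=
  [/\ forall x, F x != 0,
      forall x y (c : C), F x = c *: F y -> x = y &
      forall (i : chart X) z, (coord i @` dom i) z ->
        exists f : 'I_N.+1 -> C -> C,
          [/\ forall k, \forall w \near z, derivable (f k) w 1,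
              \forall w \near z,
                exists2 c : C, c != 0 & F (point i w) = c *: (\row_k f k w) &
              forall a b : C,
                (forall k, a * f k z + b * 'D_1 (f k) z = 0) ->
                a = 0 /\ b = 0]].

Definition smooth_projective_curve : Prop :=
  [/\ compact [set: X], connected [set: X] &
      exists N (F : X -> 'rV[C]_N.+1), projective_embedding F].

(* [a] stands for the form which is [a i z dz] in the chart [i]; the value [0]
   outside the image of the chart makes equality of forms the equality of
   functions. *)
Definition one_form := chart X -> C -> C.

Definition holomorphic_form : set one_form := [set a : one_form |
  [/\ forall i z, ~ (coord i @` dom i) z -> a i z = 0,
      forall i z, (coord i @` dom i) z -> derivable (a i) z 1 &
      forall i j z, (coord i @` (dom i `&` dom j)) z ->
        a i z = a j (coord j (point i z)) *
                'D_1 (coord j \o point i) z]].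

Definition form_basis (g : nat) (e : 'I_g -> one_form) : Prop :=
  (forall k, holomorphic_form (e k)) /\
  (forall a, holomorphic_form a ->
     exists! c : 'rV[C]_g, a = fun i z => \sum_k c 0 k * e k i z).

(* Singular 1-simplices: continuous maps on [0, 1], extended by constants. *)
Definition clamp (t : R) : R := Num.max 0 (Num.min t 1).

Definition path1 : set (R -> X) := [set p : R -> X |
  continuous p /\ forall t, p t = p (clamp t)].

(* Continuous paths need not be rectifiable: the integral of a holomorphic form
   along [p] is the variation of a continuation [F] of primitives along [p]. *)
Definition primitive_along (a : one_form) (p : R -> X) (F : R -> C) : Prop :=
  forall t, 0 <= t <= 1 -> exists (i : chart X) (P : C -> C),
    [/\ dom i (p t),
        \forall z \near coord i (p t), is_derive (z : C) 1 P (a i z) &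
        \forall s \near t, 0 <= s <= 1 -> F s = P (coord i (p s))].

Definition path_int (a : one_form) (p : R -> X) : C :=
  xget 0 [set c | exists F, primitive_along a p F /\ c = F 1 - F 0].

Definition triangle : set (R * R) :=
  [set u | [/\ 0 <= u.1, 0 <= u.2 & u.1 + u.2 <= 1]].

Definition simplex2 : set (R * R -> X) := [set s : R * R -> X |
  {within triangle, continuous s}].

Definition face0 (s : R * R -> X) (t : R) : X := s (1 - clamp t, clamp t).
Definition face1 (s : R * R -> X) (t : R) : X := s (0, clamp t).
Definition face2 (s : R * R -> X) (t : R) : X := s (clamp t, 0).

(* A chain is a list of simplices with multiplicities; two lists are the same
   chain when they have the same coefficients. *)
Definition chain := seq (int * (R -> X)).

Definition coeff (c : chain) (p : R -> X) : int :=
  \sum_(y <- c | y.2 == p) y.1.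

Definition delta (T : Type) (x y : T) : int := if `[< x = y >] then 1 else 0.

Definition cycle1 : set chain := [set c : chain |
  (forall y, y \in c -> path1 y.2) /\
  (forall x : X, \sum_(y <- c) y.1 * (delta (y.2 1) x - delta (y.2 0) x) = 0)].

Definition chain_sub (c c' : chain) : chain :=
  c ++ [seq (- y.1, y.2) | y <- c'].

Definition chain_comb n (m : 'I_n -> int) (b : 'I_n -> chain) : chain :=
  flatten [seq [seq (m k * y.1, y.2) | y <- b k] | k <- enum 'I_n].

Definition boundary (c : chain) : Prop :=
  exists s : seq (int * (R * R -> X)),
    (forall y, y \in s -> simplex2 y.2) /\
    (forall p, coeff c p = \sum_(y <- s) y.1 *
       (delta (face0 y.2) p - delta (face1 y.2) p + delta (face2 y.2) p)).

Definition H1_free_of_rank (n : nat) : Prop :=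
  exists b : 'I_n -> chain, (forall k, cycle1 (b k)) /\
    (forall c, cycle1 c ->
       exists! m : {ffun 'I_n -> int}, boundary (chain_sub c (chain_comb m b))).

Definition chain_int (a : one_form) (c : chain) : C :=
  \sum_(y <- c) path_int a y.2 *~ y.1.

(* The genus in both of its classical descriptions, [h^0(Omega) = g] and
   [H_1 = Z^(2g)], which agree by Hodge theory. *)
Definition has_genus (g : nat) : Prop :=
  (exists e : 'I_g -> one_form, form_basis e) /\ H1_free_of_rank g.*2.

Definition cocycle1 : set ((R -> X) -> int) := [set c : (R -> X) -> int |
  forall s, simplex2 s -> c (face0 s) - c (face1 s) + c (face2 s) = 0].

Definition cohomologous (c c' : (R -> X) -> int) : Prop :=
  exists f : X -> int, forall p, path1 p -> c p - c' p = f (p 1) - f (p 0).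

Definition cohomology_class (c : (R -> X) -> int) : set ((R -> X) -> int) :=
  [set c' | cocycle1 c' /\ cohomologous c c'].

Record H1 := CohomologyClass {
  cocycles :> set ((R -> X) -> int);
  cocyclesP : exists2 c, cocycle1 c & cocycles = cohomology_class c }.

(* The real harmonic form [a + conj a] represents the image of [gamma] in
   real cohomology: its integral cochain differs from a cocycle of class
   [gamma] by a real coboundary. *)
Definition harmonic_representative (gamma : H1) (a : one_form) : Prop :=
  holomorphic_form a /\
  exists2 c, cocycles gamma c & exists f : X -> R, forall p, path1 p ->
    path_int a p + (path_int a p)^* =
    (c p)%:~R + rcplx (f (p 1) - f (p 0)).

Definition omega (gamma : H1) : one_form :=
  xget (fun _ _ => 0) (harmonic_representative gamma).

Definition scale_form (c : C) (a : one_form) : one_form := fun i z => c * a i z.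

(* A connection on the trivial line bundle, acting on functions read in the
   charts. *)
Definition connection := chart X -> (C -> C) -> C -> C.

Definition lambda (a : one_form) : connection :=
  fun i s z => 'D_1 s z - a i z * s z.

Definition gl1_oper : set connection := lambda @` holomorphic_form.

(* [s] is the value along the path [p] of a flat section of [L] (the [(0,1)]
   part of the flat connection says that the section is holomorphic). *)
Definition flat_along (L : connection) (p : R -> X) (s : R -> C) : Prop :=
  forall t, 0 <= t <= 1 -> exists (i : chart X) (S : C -> C),
    [/\ dom i (p t),
        \forall z \near coord i (p t), derivable S (z : C) 1 /\ L i S z = 0 &
        \forall u \near t, 0 <= u <= 1 -> s u = S (coord i (p u))].

Definition real_monodromy (L : connection) : Prop :=
  forall p, path1 p -> p 0 = p 1 ->
    exists s (r : R), [/\ flat_along L p s, s 0 = 1, r != 0 & s 1 = rcplx r].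

Section Jacobian.
Variables (g : nat) (e : 'I_g -> one_form).

(* For a basis [e] of the holomorphic forms, a vector [l : 'rV_g] stands for
   the linear functional with values [l 0 k] on [e k]; [form_eval l a] is its
   value on the holomorphic form [a]. *)
Definition form_coord (a : one_form) : 'rV[C]_g :=
  xget 0 [set c : 'rV[C]_g | a = fun i z => \sum_k c 0 k * e k i z].

Definition form_eval (l : 'rV[C]_g) (a : one_form) : C :=
  \sum_k l 0 k * form_coord a 0 k.

Definition period : set 'rV[C]_g := [set l |
  exists2 c, cycle1 c & forall k, l 0 k = chain_int (e k) c].

Definition periods : {pred 'rV[C]_g} := fun l => `[< period l >].

Lemma periods_closed : zmod_closed periods.
Proof.
split.
  by apply/asboolP; exists [::]; [split=> // x; rewrite big_nil|
    move=> k; rewrite mxE /chain_int big_nil].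
move=> l l' /asboolP[c [c1 c2] lc] /asboolP[c' [c1' c2'] lc'].
apply/asboolP; exists (chain_sub c c').
  split=> [y|x].
    rewrite mem_cat => /orP[/c1 //|/mapP[y' /c1' ? ->] //].
  rewrite big_cat/= c2 add0r big_map/=.
  under eq_bigr do rewrite mulNr.
  by rewrite sumrN c2' oppr0.
move=> k; rewrite !mxE lc lc' /chain_int big_cat/= big_map/=.
under [X in _ = _ + X]eq_bigr do rewrite mulrNz.
by rewrite sumrN.
Qed.

HB.instance Definition _ :=
  GRing.isZmodClosed.Build 'rV[C]_g periods periods_closed.

(* Pic^0 as the quotient of the dual of the holomorphic forms by the image of
   the first integral homology. *)
Definition pic0 : Type := ring_quotient.Quotient.quot periods.

HB.instance Definition _ := GRing.Zmodule.on pic0.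
HB.instance Definition _ := EqQuotient.on pic0.
HB.instance Definition _ := isPointed.Build pic0 0.

Definition pic0_proj (l : 'rV[C]_g) : pic0 := \pi_pic0 l.

Definition pic0_open : set (set pic0) := [set A | open (pic0_proj @^-1` A)].

Local Notation pic0_borel := (g_sigma_algebraType pic0_open).

Definition dir_derive (v : 'rV[C]_g) (f : 'rV[C]_g -> C) : 'rV[C]_g -> C :=
  fun l => cplx (derive1 (fun t : R => re (f (l + rcplx t *: v))) 0)
                (derive1 (fun t : R => im (f (l + rcplx t *: v))) 0).

Definition smooth_vec (f : 'rV[C]_g -> C) : Prop :=
  forall s : seq 'rV[C]_g, let h := foldr dir_derive f s in
    continuous h /\
    forall v l, derivable (fun t : R => re (h (l + rcplx t *: v))) 0 1 /\
                derivable (fun t : R => im (h (l + rcplx t *: v))) 0 1.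

Definition smooth : set (pic0 -> C) :=
  [set f : pic0 -> C | smooth_vec (f \o pic0_proj)].

Definition operator := (pic0 -> C) -> pic0 -> C.

(* The translation-invariant vector field on the quotient defined by [v]. *)
Definition vector_field (v : 'rV[C]_g) : operator :=
  fun f x => dir_derive v (f \o pic0_proj) (repr x).

Definition hol_field (v : 'rV[C]_g) : operator := fun f x =>
  2^-1 * (vector_field v f x - 'i * vector_field ('i *: v) f x).

Definition antihol_field (v : 'rV[C]_g) : operator := fun f x =>
  2^-1 * (vector_field v f x + 'i * vector_field ('i *: v) f x).

Inductive generated_algebra (G : set operator) : operator -> Prop :=
| gen_mem P of G P : generated_algebra G P
| gen_scalar (c : C) : generated_algebra G (fun f x => c * f x)
| gen_add P Q of generated_algebra G P & generated_algebra G Q :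
    generated_algebra G (fun f x => P f x + Q f x)
| gen_comp P Q of generated_algebra G P & generated_algebra G Q :
    generated_algebra G (P \o Q).

Definition D_GL1 : set operator := generated_algebra (range hol_field).
Definition Dbar_GL1 : set operator := generated_algebra (range antihol_field).

(* The tensor product of the two algebras, through its faithful action by
   commuting operators on smooth functions. *)
Definition A_GL1 : set operator := generated_algebra (D_GL1 `|` Dbar_GL1).

(* Elements of the algebra are operators on smooth functions, hence the last
   clause: a character does not see the values on other functions. *)
Definition character (D : set operator) (chi : operator -> C) : Prop :=
  [/\ forall c : C, chi (fun f x => c * f x) = c,
      forall P Q, D P -> D Q -> chi (fun f x => P f x + Q f x) = chi P + chi Q,
      forall P Q, D P -> D Q -> chi (P \o Q) = chi P * chi Q &
      forall P Q, D P -> D Q ->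
        (forall f, smooth f -> P f = Q f) -> chi P = chi Q].

(* The point of [Spec D_GL1] attached to the connection [L]: the character of
   [Sym] of the dual of the holomorphic forms given by evaluation at [a], when
   [L] is the [GL_1]-oper [lambda a]. *)
Definition restricts_to (chi : operator -> C) (L : connection) : Prop :=
  exists a, [/\ holomorphic_form a, L = lambda a, character D_GL1 chi &
                forall v, chi (hol_field v) = form_eval v a].

Definition same_character (chi chi' : operator -> C) : Prop :=
  forall P, A_GL1 P -> chi P = chi' P.

Definition eigenfunction (chi : operator -> C) (f : pic0 -> C) : Prop :=
  [/\ smooth f, exists x, f x != 0 &
      forall P, A_GL1 P -> P f = fun x => chi P * f x].

Section Spectrum.
Variable mu : {measure set pic0_borel -> \bar R}.

Definition haar : Prop :=
  [/\ (0 < mu [set: pic0])%E, (mu [set: pic0] < +oo)%E &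
      forall (A : set pic0_borel) (x : pic0), measurable A ->
        mu [set (y : pic0) + x | y in A] = mu A].

Definition norm2 (f : pic0 -> C) : \bar R :=
  (\int[mu]_x (abs2 (f x))%:E)%E.

Definition L2 : set (pic0 -> C) := [set f : pic0 -> C |
  [/\ measurable_fun [set: pic0_borel] (@re R \o f : pic0_borel -> R),
      measurable_fun [set: pic0_borel] (@im R \o f : pic0_borel -> R) &
      (norm2 f < +oo)%E]].

(* The joint spectrum on L^2 of the commuting normal operators of the algebra
   (with domain the smooth functions): the characters having normalized
   approximate joint eigenfunctions. *)
Definition spectrum : set (operator -> C) := [set chi : operator -> C |
  character A_GL1 chi /\
  forall n (P : 'I_n -> operator) (eps : R), 0 < eps ->
    (forall k, A_GL1 (P k)) ->
    exists f, [/\ smooth f, norm2 f = 1%E &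
      forall k, (norm2 (fun x => P k f x - chi (P k) * f x)%R < eps%:E)%E]].

(* Every point of the spectrum is a joint eigenvalue and is isolated, and the
   joint eigenfunctions span a dense subspace. *)
Definition discrete_spectrum : Prop :=
  [/\ forall chi, spectrum chi -> exists f, eigenfunction chi f,
      forall chi, spectrum chi ->
        exists n (P : 'I_n -> operator) (eps : R),
          [/\ 0 < eps, forall k, A_GL1 (P k) &
              forall chi', spectrum chi' ->
                (forall k, `|chi' (P k) - chi (P k)| < rcplx eps) ->
                same_character chi' chi] &
      forall f (eps : R), L2 f -> 0 < eps ->
        exists n (h : 'I_n -> pic0 -> C),
          (forall k, exists2 chi, spectrum chi & eigenfunction chi (h k)) /\
          (norm2 (fun x => f x - \sum_k h k x)%R < eps%:E)%E].
End Spectrum.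

(* The value at [l] of the harmonic form of [gamma], seen as a functional on
   the dual of the first real cohomology: [l] acts on [a + conj a] by
   [l a + conj (l a)]. *)
Definition phi (gamma : H1) (l : 'rV[C]_g) : C :=
  form_eval l (omega gamma) + (form_eval l (omega gamma))^*.

Definition fourier_harmonic (gamma : H1) (x : pic0) : C :=
  cexp (two_pi_i * phi gamma (repr x)).

End Jacobian.
End Curve.

Notation pic0_borel e := (g_sigma_algebraType (@pic0_open _ _ _ e)).

(* Main.v *)
(** Integrating a holomorphic form [a] along paths defines real periods [c |->
    2 re (int_c a)]. A form all of whose real periods vanish is zero, by the
    maximum principle for the real part of its primitive, so counting
    dimensions every real class on [H_1] has a unique harmonic representative.
    A flat section of [d - a] is [exp (int a)] along paths; it is real on all
    loops iff [a / (2 pi i)] has integral real periods, that is [a = 2 pi i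
    omega_gamma].

    On [Pic^0], let [lam] be a lattice vector, [V] its vector field and [f] a
    normalized function with [V f] close to [c f] in [L^2]. Along the closed
    orbit of [V] this forces [(exp (- c) - 1) f] to be small, by Riemann sums,
    Fatou's lemma and translation invariance; hence [exp c = 1] for every
    point of the spectrum, whose values on the lattice vector fields are
    therefore in [2 pi i Z] and determine a class [gamma]. The derivatives of
    an eigenfunction are then those of the Fourier harmonic of [gamma], so it
    is a multiple of it. For density, the sets whose indicator is an
    [L^2]-limit of trigonometric polynomials form a sigma-algebra; it contains
    the boxes [cos (2 pi (t_k - q_k)) > c], hence the open sets. *)

From Pilot Require Import Defs.
From mathcomp Require Import all_boot all_order all_algebra.
From mathcomp Require Import complex ring lra.
From mathcomp Require Import all_classical all_reals all_analysis.
From mathcomp Require Import measurable_realfun.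
Import Pilot.Defs.
Set Implicit Arguments.
Unset Strict Implicit.
Unset Printing Implicit Defensive.
Import Order.TTheory GRing.Theory Num.Theory.
Import numFieldNormedType.Exports.
Local Open Scope classical_set_scope.
Local Open Scope ring_scope.

(** * Complex differentiation *)

(** The definitions fix weak data: forms are complex differentiable with no continuity of the
    derivative, and paths are merely continuous. Local primitives therefore come from Goursat's
    subdivision argument, integrals from continuing primitives along a path, and their vanishing on
    boundaries from subdividing a square. Compactness of a segment or a rectangle enters each time
    through one bisection principle. The genus supplies both [h^0 = g] and [H_1 = Z^(2g)], so the
    real period map is a square matrix and its injectivity already gives existence of harmonic
    forms. A point of the spectrum only has approximate eigenfunctions, known through [L^2] bounds,
    so its values cannot be found by solving a differential equation; a closed orbit turns the
    defect [V f - c f] into a multiple of [f]. The Riemann sums converge at a rate depending on the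
    point, and Fatou's lemma converts this into a norm bound. Haar measure is known only through its
    total mass and its invariance. Density is therefore proved on sets, whose indicators arise by
    iterating the polynomial [3 h^2 - 2 h^3], a map that preserves trigonometric polynomials. *)

Section ComplexNumbers.
Variable R : realType.
Local Notation C := (Cplx R).
Implicit Types (z w : C) (x y : R).

Lemma reD z w : re (z + w) = re z + re w. Proof. by case: z; case: w. Qed.
Lemma imD z w : im (z + w) = im z + im w. Proof. by case: z; case: w. Qed.
Lemma reN z : re (- z) = - re z. Proof. by case: z. Qed.
Lemma imN z : im (- z) = - im z. Proof. by case: z. Qed.
Lemma reM z w : re (z * w) = re z * re w - im z * im w.
Proof. by case: z; case: w. Qed.
Lemma imM z w : im (z * w) = re z * im w + im z * re w.
Proof. by case: z; case: w. Qed.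
Lemma re0 : re (0 : C) = 0. Proof. by []. Qed.
Lemma im0 : im (0 : C) = 0. Proof. by []. Qed.
Lemma re1 : re (1 : C) = 1. Proof. by []. Qed.
Lemma im1 : im (1 : C) = 0. Proof. by []. Qed.
Lemma reI : re ('i : C) = 0. Proof. by []. Qed.
Lemma imI : im ('i : C) = 1. Proof. by []. Qed.
Lemma re_rcplx x : re (rcplx x) = x. Proof. by []. Qed.
Lemma im_rcplx x : im (rcplx x) = 0. Proof. by []. Qed.
Lemma re_cplx x y : re (cplx x y) = x. Proof. by []. Qed.
Lemma im_cplx x y : im (cplx x y) = y. Proof. by []. Qed.
Lemma re_conj z : re z^* = re z. Proof. by case: z. Qed.
Lemma im_conj z : im z^* = - im z. Proof. by case: z. Qed.

Definition cE := (reD, imD, reN, imN, reM, imM, re0, im0, re1, im1, reI, imI,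
  re_rcplx, im_rcplx, re_cplx, im_cplx, re_conj, im_conj).

Lemma cplx_ext z w : re z = re w -> im z = im w -> z = w.
Proof. by case: z => a b; case: w => c d; rewrite /re /im /= => -> ->. Qed.

Lemma rcplxD x y : rcplx (x + y) = rcplx x + rcplx y.
Proof. by apply: cplx_ext; rewrite !cE ?addr0. Qed.
Lemma rcplxM x y : rcplx (x * y) = rcplx x * rcplx y.
Proof. by apply: cplx_ext; rewrite !cE; ring. Qed.
Lemma rcplxN x : rcplx (- x) = - rcplx x.
Proof. by apply: cplx_ext; rewrite !cE ?oppr0. Qed.
Lemma rcplx0 : rcplx 0 = 0 :> C. Proof. by []. Qed.
Lemma rcplx1 : rcplx 1 = 1 :> C. Proof. by []. Qed.
Lemma rcplx_int (n : int) : rcplx n%:~R = n%:~R :> C.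
Proof.
have nat_ m : rcplx m%:R = m%:R :> C.
  by elim: m => [|m IH]; rewrite ?rcplx0 // -[m.+1]addn1 !natrD rcplxD IH.
by case: n => n; rewrite ?NegzE ?mulrNz ?rcplxN -!pmulrn nat_.
Qed.

Lemma rcplx_eq0 x : (rcplx x == 0 :> C) = (x == 0).
Proof.
apply/eqP/eqP => [h|->] //; by rewrite -[LHS](re_rcplx x) h re0.
Qed.

Lemma lt_cplx z w : (z < w) = (im w == im z) && (re z < re w).
Proof. by case: z; case: w. Qed.

(** The norm of [Cplx R] takes values in the partially ordered [Cplx R]. Estimates run instead in
    the real-valued [l^1] norm, which is submultiplicative and bounds both parts with constant 1. *)
Definition n1 z : R := `|re z| + `|im z|.

Lemma n1_ge0 z : 0 <= n1 z. Proof. by rewrite addr_ge0. Qed.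
Lemma n10 : n1 0 = 0. Proof. by rewrite /n1 !cE !normr0 addr0. Qed.
Lemma n1N z : n1 (- z) = n1 z. Proof. by rewrite /n1 !cE !normrN. Qed.
Lemma n1B z w : n1 (z - w) = n1 (w - z). Proof. by rewrite -n1N opprB. Qed.
Lemma n1D z w : n1 (z + w) <= n1 z + n1 w.
Proof.
rewrite /n1 !cE addrACA; apply: lerD; exact: ler_normD.
Qed.
Lemma n1_eq0 z : n1 z = 0 -> z = 0.
Proof.
move/eqP; rewrite /n1 paddr_eq0 // !normr_eq0 => /andP[/eqP h1 /eqP h2].
exact: cplx_ext.
Qed.
Lemma n1M z w : n1 (z * w) <= n1 z * n1 w.
Proof.
rewrite /n1 !cE; apply: le_trans (lerD (ler_normB _ _) (ler_normD _ _)) _.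
by rewrite !normrM le_eqVlt; apply/orP; left; apply/eqP; ring.
Qed.
Lemma n1_rcplxM x z : n1 (rcplx x * z) = `|x| * n1 z.
Proof. by rewrite /n1 !cE !mul0r subr0 addr0 !normrM mulrDr. Qed.
Lemma re_le_n1 z : `|re z| <= n1 z. Proof. by rewrite lerDl. Qed.
Lemma im_le_n1 z : `|im z| <= n1 z. Proof. by rewrite lerDr. Qed.
Lemma n1_small z : (forall eps, 0 < eps -> n1 z <= eps) -> z = 0.
Proof.
move=> h; apply: n1_eq0; apply/eqP; rewrite eq_le n1_ge0 andbT.
by apply/ler_addgt0Pl => e /h; rewrite addr0.
Qed.

Lemma abs2_ge0 z : 0 <= abs2 z. Proof. by rewrite addr_ge0 ?sqr_ge0. Qed.
Lemma abs2M z w : abs2 (z * w) = abs2 z * abs2 w.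
Proof. by rewrite /abs2 !cE; ring. Qed.

Lemma normC_abs2 z : `|z| = rcplx (Num.sqrt (abs2 z)).
Proof. by case: z. Qed.

Lemma normC_le z : re `|z| <= n1 z.
Proof.
rewrite normC_abs2 re_rcplx -[leRHS]ger0_norm ?n1_ge0 // -sqrtr_sqr.
rewrite ler_sqrt ?sqr_ge0 // /abs2 /n1 sqrrD !real_normK ?num_real //.
by rewrite -addrA lerD2l lerDr mulrn_wge0 // mulr_ge0.
Qed.

Lemma n1_le_normC z : n1 z <= 2 * re `|z|.
Proof.
have h a b : `|a| <= Num.sqrt (a ^+ 2 + b ^+ 2) :> R.
  by rewrite -sqrtr_sqr ler_sqrt ?addr_ge0 ?sqr_ge0 // lerDl sqr_ge0.
rewrite normC_abs2 re_rcplx mulr2n mulrDl mul1r; apply: lerD; rewrite /abs2 //.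
by rewrite addrC.
Qed.

(** The two norms are equivalent by [normC_le] and [n1_le_normC], so topological statements about
    [C] can be traded for estimates in [n1]. *)
Lemma near_n1P z (P : C -> Prop) :
  (\forall w \near z, P w) <->
  exists2 r : R, 0 < r & forall w, n1 (w - z) < r -> P w.
Proof.
split.
  move=> /nbhs_ballP[e /= e0 h].
  have e0' : 0 < re e by move: e0; rewrite lt_cplx !cE => /andP[].
  exists (re e) => // w hw; apply: h; rewrite -ball_normE /=.
  rewrite lt_cplx; apply/andP; split.
    rewrite normC_abs2 im_rcplx.
    by move: e0; rewrite lt_cplx !cE => /andP[/eqP ->].
  by apply: le_lt_trans (normC_le _) _; rewrite n1B.
(* Half the radius pays for the factor 2 in [n1_le_normC]. *)
case=> r r0 h; apply/nbhs_ballP; exists (rcplx (r / 2)) => /=.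
  by rewrite lt_cplx !cE eqxx/= divr_gt0.
move=> w; rewrite -ball_normE /= lt_cplx => /andP[_].
rewrite re_rcplx => hw; apply: h; rewrite n1B.
by apply: le_lt_trans (n1_le_normC _) _; rewrite mulrC -ltr_pdivlMr.
Qed.

Lemma cvg_n1P (T : Type) (F : set_system T) {FF : Filter F} (f : T -> C) (l : C) :
  f @ F --> l <-> forall eps : R, 0 < eps -> \forall t \near F, n1 (f t - l) < eps.
Proof.
split=> [h e e0|h A].
  by apply: (h [set z | n1 (z - l) < e]); apply/near_n1P; exists e.
by move=> /near_n1P[r r0 hr]; apply: filterS (h r r0) => t /hr.
Qed.

(** The quotient-free form of complex differentiability: it makes sense at [w = z] too, and it
    composes by plain inequalities, without division. *)
Definition cder (f : C -> C) z a := forall eps : R, 0 < eps ->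
  exists2 d : R, 0 < d & forall w, n1 (w - z) < d ->
    n1 (f w - f z - a * (w - z)) <= eps * n1 (w - z).

(** From [z^-1 = z^* / abs2 z]; the constant 2 is that of [n1 z ^+ 2 <= 2 * abs2 z]. *)
Lemma n1V z : z != 0 -> n1 z^-1 <= 2 / n1 z.
Proof.
move=> z0; have nz : 0 < n1 z.
  by rewrite lt_neqAle n1_ge0 andbT eq_sym; apply: contra_neq z0 => /n1_eq0.
have d0 : 0 < abs2 z.
  rewrite lt_neqAle abs2_ge0 andbT eq_sym; apply: contra_neq z0.
  move/eqP; rewrite /abs2 paddr_eq0 ?sqr_ge0 // !sqrf_eq0.
  by move=> /andP[/eqP h1 /eqP h2]; exact: cplx_ext.
have -> : z^-1 = rcplx (abs2 z)^-1 * z^*.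
  apply: (mulfI z0); rewrite mulfV //; apply: cplx_ext; rewrite !cE.
    by rewrite /abs2; field; rewrite -/(abs2 z) gt_eqF.
  by ring.
rewrite n1_rcplxM ger0_norm; last by rewrite invr_ge0 ltW.
have -> : n1 z^* = n1 z by rewrite /n1 !cE normrN.
rewrite mulrC ler_pdivrMr // mulrAC ler_pdivlMr // -expr2 /n1 sqrrD /abs2.
rewrite -(real_normK (num_real (re z))) -(real_normK (num_real (im z))).
have := sqr_ge0 (`|re z| - `|im z|); nra.
Qed.

Lemma cderP f z a : cder f z a <-> is_derive z 1 f a.
Proof.
split=> [h|].
  have cv : (fun h => h^-1 *: ((f \o shift z) (h *: 1) - f z)) @ 0^' --> a.
    apply/cvg_n1P => e e0.
    (* The factor 2 of [n1V] and the passage from [<=] to [<] cost a factor 4. *)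
    have e20 : 0 < e / 4 by rewrite divr_gt0.
    have [d d0 hd] := h _ e20.
    rewrite near_withinE; apply/near_n1P; exists d => // w; rewrite subr0 => wd w0.
    have := hd (w + z); rewrite addrK => /(_ wd) H.
    rewrite /= scaler1 -[_ *: _]/(w^-1 * _).
    have -> : w^-1 * (f (w + z) - f z) - a = w^-1 * (f (w + z) - f z - a * w).
      by field.
    apply: le_lt_trans (n1M _ _) _.
    have nw : 0 < n1 w.
      by rewrite lt_neqAle n1_ge0 andbT eq_sym; apply: contra_neq w0 => /n1_eq0.
    apply: (@le_lt_trans _ _ (2 / n1 w * (e / 4 * n1 w))).
      by apply: ler_pM; rewrite ?n1_ge0 // n1V.
    have -> : 2 / n1 w * (e / 4 * n1 w) = e / 2 by field; rewrite gt_eqF.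
    by rewrite ltr_pdivrMr // ltr_pMr // (ltr_nat _ 1 2).
  have dv : derivable f z 1 by apply/cvg_ex; exists a.
  by apply: (DeriveDef dv); exact: (cvg_lim (@norm_hausdorff _ _) cv).
move=> df e e0.
have df1 : derivable f z 1 by exact: ex_derive.
have cv : (fun h => h^-1 *: ((f \o shift z) (h *: 1) - f z)) @ 0^' --> a.
  by rewrite -(@derive_val _ _ _ _ _ _ _ df); exact: df1.
move: cv => /cvg_n1P /(_ e e0); rewrite near_withinE => /near_n1P[d d0 hd].
exists d => // w wd; have [->|wz] := eqVneq w z.
  by rewrite !subrr mulr0 subr0 n10 mulr0.
have wz0 : w - z != 0 by rewrite subr_eq0.
have := hd (w - z); rewrite subr0 => /(_ wd wz0).
rewrite /= scaler1 subrK -[_ *: _]/((w - z)^-1 * _) => H.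
have -> : f w - f z - a * (w - z) = ((w - z)^-1 * (f w - f z) - a) * (w - z).
  by field.
by apply: le_trans (n1M _ _) _; rewrite ler_wpM2r ?n1_ge0 // ltW.
Qed.

Lemma derivableP_cder f z : derivable f z 1 <-> exists a, cder f z a.
Proof.
split=> [d|[a /cderP da]]; last exact: ex_derive.
by exists ('D_1 f z); apply/cderP; apply: DeriveDef.
Qed.

Lemma cder_derive f z a : cder f z a -> 'D_1 f z = a.
Proof. by move=> /cderP ?; rewrite derive_val. Qed.

End ComplexNumbers.

(** * Calculus in one real variable, and the bisection principle *)

Section RealCalculus.
Variable R : realType.
Local Notation C := (Cplx R).

Lemma real_derP (f : R -> R) (t a : R) :
  is_derive t 1 f a <-> (forall eps : R, 0 < eps -> exists2 d : R, 0 < d &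
    forall s, `|s - t| < d -> `|f s - f t - a * (s - t)| <= eps * `|s - t|).
Proof.
split=> [df e e0|h].
  have cv : (fun h => h^-1 *: ((f \o shift t) (h *: 1) - f t)) @ 0^' --> a.
    rewrite -(@derive_val _ _ _ _ _ _ _ df).
    have : derivable f t 1 by exact: ex_derive.
    exact.
  move: cv => /cvgrPdist_lt /(_ e e0); rewrite near_withinE => /nbhs_ballP[d /= d0 hd].
  exists d => // s sd; have [->|st] := eqVneq s t.
    by rewrite !subrr mulr0 subr0 normr0 mulr0.
  have st0 : s - t != 0 by rewrite subr_eq0.
  have := hd (s - t); rewrite -ball_normE /= sub0r normrN => /(_ sd st0).
  rewrite /= scaler1 subrK -[_ *: _]/((s - t)^-1 * _) => H.
  have -> : f s - f t - a * (s - t) = - (a - (s - t)^-1 * (f s - f t)) * (s - t).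
    by field.
  by rewrite normrM normrN ler_wpM2r // ltW.
have cv : (fun h => h^-1 *: ((f \o shift t) (h *: 1) - f t)) @ 0^' --> a.
  apply/cvgrPdist_lt => e e0.
  have e20 : 0 < e / 2 by rewrite divr_gt0.
  have [d d0 hd] := h _ e20.
  rewrite near_withinE; apply/nbhs_ballP; exists d => //= w.
  rewrite -ball_normE /= sub0r normrN => wd w0.
  have := hd (w + t); rewrite addrK => /(_ wd) H.
  rewrite scaler1 -[_ *: _]/(w^-1 * _).
  have -> : a - w^-1 * (f (w + t) - f t) = - (w^-1 * (f (w + t) - f t - a * w)).
    by field.
  rewrite normrN normrM normfV -ltr_pdivlMl ?invr_gt0 ?normr_gt0 // invrK.
  apply: le_lt_trans H _; rewrite mulrC ltr_pM2l ?normr_gt0 //.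
  by rewrite ltr_pdivrMr // ltr_pMr // (ltr_nat _ 1 2).
have dv : derivable f t 1 by apply/cvg_ex; exists a.
by apply: (DeriveDef dv); exact: (cvg_lim (@norm_hausdorff _ _) cv).
Qed.

Definition rder (u : R -> C) (t : R) (v : C) := forall eps : R, 0 < eps ->
  exists2 d : R, 0 < d & forall s, `|s - t| < d ->
    n1 (u s - u t - rcplx (s - t) * v) <= eps * `|s - t|.

Lemma rderP (u : R -> C) t v : rder u t v <->
  is_derive t 1 (@re R \o u) (re v) /\ is_derive t 1 (@im R \o u) (im v).
Proof.
split=> [h|[/real_derP h1 /real_derP h2] e e0].
  split; apply/real_derP => e e0; have [d d0 hd] := h e e0; exists d => // s /hd.
    apply: le_trans; apply: le_trans _ (re_le_n1 _); rewrite !cE /= mul0r subr0.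
    by rewrite mulrC.
  apply: le_trans; apply: le_trans _ (im_le_n1 _); rewrite !cE /= mul0r addr0.
  by rewrite mulrC.
have e20 : 0 < e / 2 by rewrite divr_gt0.
have [d d0 hd] := h1 _ e20; have [d' d'0 hd'] := h2 _ e20.
exists (Num.min d d'); first by rewrite lt_min d0.
move=> s; rewrite lt_min => /andP[/hd {}hd /hd' {}hd'].
rewrite /n1 !cE /= !mul0r subr0 addr0 ![(s - t) * _]mulrC.
apply: le_trans (lerD hd hd') _; rewrite le_eqVlt; apply/orP; left.
by apply/eqP; field.
Qed.

Lemma rderD u u' t v v' : rder u t v -> rder u' t v' ->
  rder (fun s => u s + u' s) t (v + v').
Proof.
move=> h1 h2 e e0; have e20 : 0 < e / 2 by rewrite divr_gt0.
have [d d0 hd] := h1 _ e20; have [d' d'0 hd'] := h2 _ e20.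
exists (Num.min d d'); first by rewrite lt_min d0.
move=> s; rewrite lt_min => /andP[/hd {}hd /hd' {}hd'].
have -> : u s + u' s - (u t + u' t) - rcplx (s - t) * (v + v') =
  (u s - u t - rcplx (s - t) * v) + (u' s - u' t - rcplx (s - t) * v') by ring.
apply: le_trans (n1D _ _) (le_trans (lerD hd hd') _).
by rewrite -mulrDl -splitr.
Qed.

Lemma rderZ c u t v : rder u t v -> rder (fun s => c * u s) t (c * v).
Proof.
move=> h e e0.
have c1 : 0 < n1 c + 1 by rewrite ltr_wpDl ?n1_ge0.
have [|d d0 hd] := h (e / (n1 c + 1)); first by rewrite divr_gt0.
exists d => // s /hd {}hd.
have -> : c * u s - c * u t - rcplx (s - t) * (c * v) =
  c * (u s - u t - rcplx (s - t) * v) by ring.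
apply: le_trans (n1M _ _) _.
apply: le_trans (ler_wpM2l (n1_ge0 _) hd) _.
rewrite mulrA ler_wpM2r // mulrCA ler_piMr ?ltW //.
by rewrite ltr_pdivrMr // mul1r ltrDl.
Qed.

Lemma rder_cst c t : rder (fun=> c) t 0.
Proof. by move=> e e0; exists 1 => // s _; rewrite mulr0 !subrr n10 mulr_ge0 // ltW. Qed.

Lemma rder_id (c : C) t : rder (fun s => rcplx s * c) t c.
Proof.
move=> e e0; exists 1 => // s _.
have -> : rcplx s * c - rcplx t * c - rcplx (s - t) * c = 0.
  by rewrite rcplxD rcplxN; ring.
by rewrite n10 mulr_ge0 // ltW.
Qed.

Lemma rderB u u' t v v' : rder u t v -> rder u' t v' ->
  rder (fun s => u s - u' s) t (v - v').
Proof.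
move=> h1 h2; have := rderD h1 (rderZ (-1) h2).
by rewrite mulN1r; congr rder; apply/funext => s; rewrite mulN1r.
Qed.

Lemma rder_ext u u' t v : u =1 u' -> rder u t v -> rder u' t v.
Proof. by move=> /funext ->. Qed.

Lemma rder_lipschitz u t v : rder u t v -> exists d : R, [/\ 0 < d &
  forall s, `|s - t| < d -> n1 (u s - u t) <= (n1 v + 1) * `|s - t|].
Proof.
move=> /(_ 1 ltr01)[d d0 hd]; exists d; split=> // s /hd {}hd.
have -> : u s - u t = (u s - u t - rcplx (s - t) * v) + rcplx (s - t) * v by ring.
apply: le_trans (n1D _ _) (le_trans (lerD hd (lexx _)) _).
by rewrite n1_rcplxM mulrDl mul1r addrC [n1 v * _]mulrC.
Qed.

Lemma rder_comp (g : R -> C) (P : C -> C) t v a :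
  rder g t v -> cder P (g t) a -> rder (P \o g) t (a * v).
Proof.
move=> hg hP e e0.
have nv : 0 < n1 v + 1 by rewrite ltr_wpDl ?n1_ge0.
have na : 0 < n1 a + 1 by rewrite ltr_wpDl ?n1_ge0.
have [|d1 d10 h1] := hP (e / 2 / (n1 v + 1)); first by rewrite !divr_gt0.
have [|d2 d20 h2] := hg (e / 2 / (n1 a + 1)); first by rewrite !divr_gt0.
have [d3 [d30 h3]] := rder_lipschitz hg.
exists (Num.min d2 (Num.min d3 (d1 / (n1 v + 1)))).
  by rewrite !lt_min d20 d30 divr_gt0.
move=> s; rewrite !lt_min => /and3P[/h2 {}h2 /h3 {}h3].
rewrite ltr_pdivlMr // mulrC => s1.
have {}h1 := h1 _ (le_lt_trans h3 s1).
have -> : (P \o g) s - (P \o g) t - rcplx (s - t) * (a * v) =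
  (P (g s) - P (g t) - a * (g s - g t)) + a * (g s - g t - rcplx (s - t) * v).
  by rewrite /=; ring.
apply: le_trans (n1D _ _) _; rewrite [e]splitr mulrDl; apply: lerD.
  apply: le_trans h1 _; rewrite -mulrA; apply: ler_wpM2l.
    by rewrite divr_ge0 // ltW.
  by rewrite mulrC ler_pdivrMr // mulrC.
apply: le_trans (n1M _ _) _; apply: le_trans (ler_wpM2l (n1_ge0 _) h2) _.
rewrite mulrA ler_wpM2r // mulrCA ler_piMr ?divr_ge0 // ltW //.
by rewrite ltr_pdivrMr // mul1r ltrDl.
Qed.

Lemma real_MVT (f df : R -> R) (a b : R) : a <= b ->
  (forall t, a <= t <= b -> is_derive t 1 f (df t)) ->
  exists2 c, a <= c <= b & f b - f a = df c * (b - a).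
Proof.
move=> ab h; have [x||c cab E] := @MVT_segment R f df a b ab.
- by rewrite in_itv/= => /andP[ax xb]; apply: h; rewrite !ltW.
- apply: derivable_within_continuous => x; rewrite in_itv/= => /h ?.
  exact: ex_derive.
by exists c => //; move: cab; rewrite in_itv.
Qed.

(** The mean value theorem fails for complex values; applied to the real and imaginary parts it
    gives two intermediate points, whence the factor 2. *)
Lemma rder_bound (u v : R -> C) (B a b : R) : a <= b ->
  (forall t, a <= t <= b -> rder u t (v t)) ->
  (forall t, a <= t <= b -> n1 (v t) <= B) ->
  n1 (u b - u a) <= 2 * B * (b - a).
Proof.
move=> ab h hB.
have ba : 0 <= b - a by rewrite subr_ge0.
have [|c cab E] := @real_MVT (@re R \o u) (@re R \o v) a b ab.
  by move=> t /h /rderP[].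
have [|c' cab' E'] := @real_MVT (@im R \o u) (@im R \o v) a b ab.
  by move=> t /h /rderP[].
rewrite /= in E E'.
rewrite /n1 !cE E E' !normrM (ger0_norm ba).
rewrite -mulrDl ler_wpM2r // mulr2n mulrDl mul1r; apply: lerD.
  exact: le_trans (re_le_n1 _) (hB _ cab).
exact: le_trans (im_le_n1 _) (hB _ cab').
Qed.

Lemma rder0_const (u : R -> C) (a b : R) : a <= b ->
  (forall t, a <= t <= b -> rder u t 0) -> u b = u a.
Proof.
move=> ab h; apply/eqP; rewrite -subr_eq0; apply/eqP/n1_eq0/eqP.
rewrite eq_le n1_ge0 andbT.
have := @rder_bound u (fun=> 0) 0 a b ab h; rewrite mulr0 mul0r; apply.
by move=> t _; rewrite n10.
Qed.

Lemma real_antiderivative (f : R -> R) (a : R) : continuous f ->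
  exists F, forall t, a < t -> is_derive t 1 F (f t).
Proof.
move=> cf.
exists (fun x => \int[lebesgue_measure]_(t in [set` `[a, x]]) f t) => t at_.
have [] := @continuous_FTC1_closed R f a t (t + 1) _ _ at_ (cf t).
- by rewrite ltrDl.
- apply: continuous_compact_integrable; first exact: segment_compact.
  exact: continuous_subspaceT.
by move=> d e; rewrite derive1E in e; exact: (DeriveDef d e).
Qed.

Definition clampi (a b t : R) : R := Num.max a (Num.min t b).

Lemma clampi_in a b t : a <= b -> a <= clampi a b t <= b.
Proof. by move=> ab; rewrite /clampi le_max lexx /= ge_max ab ge_min lexx orbT. Qed.

Lemma clampi_id a b t : a <= t <= b -> clampi a b t = t.
Proof. by move=> /andP[h1 h2]; rewrite /clampi (min_idPl h2) (max_idPr h1). Qed.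

Lemma clampi_lipschitz a b s t : `|clampi a b s - clampi a b t| <= `|s - t|.
Proof.
have : `|s - t| <= `|s - t| by [].
rewrite !ler_norml => /andP[? ?].
rewrite /clampi; apply/andP; case: (leP s b) => ?; case: (leP t b) => ?;
  case: (leP a _) => ?; try case: (leP a _) => ?; split; lra.
Qed.

Lemma continuous_real_dist (f : R -> R) (t : R) : {for t, continuous f} <->
  forall eps : R, 0 < eps -> exists2 d : R, 0 < d & forall s, `|s - t| < d -> `|f s - f t| < eps.
Proof.
split=> [/cvgrPdist_lt h e /h /nbhs_ballP[d /= d0 hd]|h].
  exists d => // s; rewrite distrC => sd; rewrite distrC; apply: hd.
  by rewrite -ball_normE.
apply/cvgrPdist_lt => e /h[d d0 hd]; apply/nbhs_ballP; exists d => //= s.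
by rewrite /= distrC => /hd; rewrite distrC.
Qed.

(** Composition with [clampi] extends [u] to a continuous function on the line, to which the
    fundamental theorem of calculus applies. *)
Lemma antiderivative (u : R -> C) (a b : R) : a <= b ->
  (forall t, a <= t <= b -> forall eps : R, 0 < eps ->
     exists2 d : R, 0 < d & forall s, a <= s <= b -> `|s - t| < d -> n1 (u s - u t) < eps) ->
  exists U, forall t, a <= t <= b -> rder U t (u t).
Proof.
move=> ab h.
have c (p : C -> R) : (forall z w, p (z - w) = p z - p w) ->
    (forall z, `|p z| <= n1 z) -> continuous (fun t => p (u (clampi a b t))).
  move=> pB pn t; apply/continuous_real_dist => e e0.
  have [d d0 hd] := h _ (clampi_in t ab) _ e0; exists d => // s sd.
  rewrite -pB; apply: le_lt_trans (pn _) _; apply: hd; first exact: clampi_in.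
  exact: le_lt_trans (clampi_lipschitz _ _ _ _) sd.
(* Starting the integral at [a - 1] makes [a] an interior point, so the derivative there is
   two-sided. *)
have [F1 hF1] := @real_antiderivative _ (a - 1) (c _ (fun z w => etrans (reD z (- w)) (congr1 _ (reN w))) (@re_le_n1 R)).
have [F2 hF2] := @real_antiderivative _ (a - 1) (c _ (fun z w => etrans (imD z (- w)) (congr1 _ (imN w))) (@im_le_n1 R)).
exists (fun t => cplx (F1 t) (F2 t)) => t tab; apply/rderP.
have at1 : a - 1 < t.
  by case/andP: tab => h1 _; apply: lt_le_trans h1; rewrite ltrBlDr ltrDl.
by have := hF1 t at1; have := hF2 t at1; rewrite (clampi_id tab).
Qed.

(* Bisection: [P a c t] speaks of the rectangle [[a, a + t w] x [c, c + t h]]. *)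
Lemma cousin (w h : R) (P : R -> R -> R -> Prop) : 0 <= w -> 0 <= h ->
  (forall a c t, 0 < t -> P a c (t / 2) -> P (a + t / 2 * w) c (t / 2) ->
     P a (c + t / 2 * h) (t / 2) -> P (a + t / 2 * w) (c + t / 2 * h) (t / 2) -> P a c t) ->
  (forall x y : R, exists2 d : R, 0 < d & forall a c t : R, 0 < t < d ->
     a <= x <= a + t * w -> c <= y <= c + t * h -> P a c t) ->
  forall a c t, 0 < t -> P a c t.
Proof.
move=> w0 h0 her loc a c t t0; apply: contrapT => nP.
pose sub (q q' : R * R) (s : R) := 
  (q'.1 = q.1 \/ q'.1 = q.1 + s / 2 * w) /\ (q'.2 = q.2 \/ q'.2 = q.2 + s / 2 * h).
(* If [P] held on all four quarters it would hold on the rectangle: a bad rectangle has a bad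
   quarter. *)
have step q s : 0 < s -> ~ P q.1 q.2 s -> exists q', sub q q' s /\ ~ P q'.1 q'.2 (s / 2).
  move=> s0 nq; apply: contrapT => /forallNP H; apply: nq.
  have H' x y : sub q (x, y) s -> P x y (s / 2).
    by move=> sq; apply: contrapT => nn; apply: (H (x, y)).
  apply: her => //; apply: H'; split=> /=; by [left|right].
pose T n := t / 2 ^+ n.
have T0 n : 0 < T n by rewrite divr_gt0 // exprn_gt0.
have TS n : T n.+1 = T n / 2 by rewrite /T exprSr invfM mulrA.
(* The stage number is part of the state, so the size is a function of the state and one use of
   [choice] yields the whole descending sequence. *)
pose St := {x : nat * (R * R) | ~ P x.2.1 x.2.2 (T x.1)}.
have T00 : T 0%N = t by rewrite /T expr0 divr1.
have nP0 : ~ P a c (T 0%N) by rewrite T00.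
have next (x : St) : exists y : St, (sval y).1 = (sval x).1.+1 /\
    sub (sval x).2 (sval y).2 (T (sval x).1).
  case: x => -[n q] /= nq; have [q' [sq nq']] := step q (T n) (T0 n) nq.
  rewrite -TS in nq'.
  by exists (exist (fun x => ~ P x.2.1 x.2.2 (T x.1)) (n.+1, q') nq').
have [f hf] := choice next.
pose x0 : St := exist (fun x => ~ P x.2.1 x.2.2 (T x.1)) (0%N, (a, c)) nP0.
pose q n := (sval (iter n f x0)).2.
have qn n : (sval (iter n f x0)).1 = n.
  by elim: n => //= n IH; rewrite (hf _).1 IH.
have qP n : ~ P (q n).1 (q n).2 (T n).
  by have := svalP (iter n f x0); rewrite qn.
have qsub n : sub (q n) (q n.+1) (T n) by have := (hf (iter n f x0)).2; rewrite qn.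
(* Each coordinate of the corners converges, as a nested sequence of intervals. *)
have lim (k : R) (s : nat -> R) : 0 <= k ->
    (forall n, s n.+1 = s n \/ s n.+1 = s n + T n / 2 * k) ->
    exists x, forall n, s n <= x <= s n + T n * k.
  move=> k0 hs.
  have up n : s n <= s n.+1.
    by case: (hs n) => -> //; rewrite lerDl !mulr_ge0 // ltW.
  have dn n : s n.+1 + T n.+1 * k <= s n + T n * k.
    rewrite TS; have := mulr_ge0 (ltW (T0 n)) k0.
    by case: (hs n) => ->; lra.
  have mono := @homo_leq _ s <=%R (fun _ => lexx _) le_trans up.
  have anti : {homo (fun n => s n + T n * k) : m n / (m <= n)%N >-> n <= m}.
    move=> n i /subnK <-; elim: (i - n)%N => [|j IH]; first by rewrite add0n.
    exact: le_trans (dn _) IH.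
  have b m n : s m <= s n + T n * k.
    apply: le_trans (mono _ _ (leq_maxl m n)) _.
    apply: le_trans _ (anti _ _ (leq_maxr m n)).
    by rewrite lerDl mulr_ge0 // ltW.
  have ub : has_sup (range s).
    split; first by exists (s 0%N); exists 0%N.
    by exists (s 0%N + T 0%N * k) => _ [m _ <-].
  exists (sup (range s)) => n; apply/andP; split.
    by apply: ub_le_sup; [exact: ub.2|exists n].
  by apply: ge_sup; [exact: ub.1|move=> _ [m _ <-]].
have [x hx] := lim w (fun n => (q n).1) w0 (fun n => (qsub n).1).
have [y hy] := lim h (fun n => (q n).2) h0 (fun n => (qsub n).2).
have [d d0 hd] := loc x y.
have [n Tn] : exists n, T n < d.
  have hn := @upper_nthrootP R (t / d) _ (leqnn _).
  exists (Num.Def.archi_bound (t / d)); rewrite /T ltr_pdivrMr ?exprn_gt0 // mulrC -ltr_pdivrMr //.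
by apply: (qP n); apply: hd (hx n) (hy n); rewrite T0.
Qed.

End RealCalculus.

(** * Rules for the complex derivative *)

Section ComplexDerivative.
Variable R : realType.
Local Notation C := (Cplx R).
Implicit Types (f g : C -> C) (z w a b c : C).

Lemma rder_bound_sym (u v : R -> C) (B a b : R) :
  (forall t, Num.min a b <= t <= Num.max a b -> rder u t (v t)) ->
  (forall t, Num.min a b <= t <= Num.max a b -> n1 (v t) <= B) ->
  n1 (u b - u a) <= 2 * B * `|b - a|.
Proof.
case: (leP a b) => ab h hB.
  by rewrite ger0_norm ?subr_ge0 //; exact: (rder_bound ab h).
by rewrite ltr0_norm ?subr_lt0 // opprB n1B; exact: (rder_bound (ltW ab) h).
Qed.

Lemma cder_lipschitz f z a : cder f z a -> exists d : R, [/\ 0 < d &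
  forall w, n1 (w - z) < d -> n1 (f w - f z) <= (n1 a + 1) * n1 (w - z)].
Proof.
move=> /(_ 1 ltr01)[d d0 hd]; exists d; split=> // w /hd {}hd.
have -> : f w - f z = (f w - f z - a * (w - z)) + a * (w - z) by ring.
apply: le_trans (n1D _ _) (le_trans (lerD hd (n1M _ _)) _).
by rewrite -mulrDl addrC.
Qed.

Lemma cder_cont f z a : cder f z a -> forall eps : R, 0 < eps ->
  exists2 d : R, 0 < d & forall w, n1 (w - z) < d -> n1 (f w - f z) < eps.
Proof.
move=> /cder_lipschitz[d [d0 hd]] e e0.
have na : 0 < n1 a + 1 by rewrite ltr_wpDl ?n1_ge0.
exists (Num.min d (e / (n1 a + 1))); first by rewrite lt_min d0 divr_gt0.
move=> w; rewrite lt_min ltr_pdivlMr // mulrC => /andP[/hd {}hd].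
exact: le_lt_trans.
Qed.

Lemma cder_continuous f z a : cder f z a -> {for z, continuous f}.
Proof.
move=> /cder_cont h.
apply: (cvg_n1P (F := nbhs z) f (f z)).2 => e /h[d d0 hd]; apply/near_n1P.
by exists d.
Qed.

Lemma cder_ext_near f g z a : (\forall w \near z, f w = g w) -> cder f z a -> cder g z a.
Proof.
move=> /near_n1P[r r0 hr] h e /h[d d0 hd].
exists (Num.min d r); first by rewrite lt_min d0.
move=> w; rewrite lt_min => /andP[/hd {}hd wr].
by rewrite -(hr w) // -(hr z) // subrr n10.
Qed.

Lemma cder_ext f g z a : f =1 g -> cder f z a -> cder g z a.
Proof. by move=> /funext ->. Qed.

Lemma cder_cst c z : cder (fun=> c) z 0.
Proof. by move=> e e0; exists 1 => // w _; rewrite mul0r !subrr n10 mulr_ge0 ?n1_ge0 // ltW. Qed.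

Lemma cder_id z : cder id z 1.
Proof. by move=> e e0; exists 1 => // w _; rewrite mul1r subrr n10 mulr_ge0 ?n1_ge0 // ltW. Qed.

Lemma cderD f g z a b : cder f z a -> cder g z b -> cder (fun w => f w + g w) z (a + b).
Proof.
move=> h1 h2 e e0; have e20 : 0 < e / 2 by rewrite divr_gt0.
have [d d0 hd] := h1 _ e20; have [d' d'0 hd'] := h2 _ e20.
exists (Num.min d d'); first by rewrite lt_min d0.
move=> s; rewrite lt_min => /andP[/hd {}hd /hd' {}hd'].
have -> : f s + g s - (f z + g z) - (a + b) * (s - z) =
  (f s - f z - a * (s - z)) + (g s - g z - b * (s - z)) by ring.
apply: le_trans (n1D _ _) (le_trans (lerD hd hd') _).
by rewrite -mulrDl -splitr.
Qed.

Lemma cder_comp f g z a b : cder f z a -> cder g (f z) b -> cder (g \o f) z (b * a).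
Proof.
move=> hg hP e e0.
have nv : 0 < n1 a + 1 by rewrite ltr_wpDl ?n1_ge0.
have na : 0 < n1 b + 1 by rewrite ltr_wpDl ?n1_ge0.
have [|d1 d10 h1] := hP (e / 2 / (n1 a + 1)); first by rewrite !divr_gt0.
have [|d2 d20 h2] := hg (e / 2 / (n1 b + 1)); first by rewrite !divr_gt0.
have [d3 [d30 h3]] := cder_lipschitz hg.
exists (Num.min d2 (Num.min d3 (d1 / (n1 a + 1)))).
  by rewrite !lt_min d20 d30 divr_gt0.
move=> s; rewrite !lt_min => /and3P[/h2 {}h2 /h3 {}h3].
rewrite ltr_pdivlMr // mulrC => s1.
have {}h1 := h1 _ (le_lt_trans h3 s1).
have -> : (g \o f) s - (g \o f) z - (b * a) * (s - z) =
  (g (f s) - g (f z) - b * (f s - f z)) + b * (f s - f z - a * (s - z)).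
  by rewrite /=; ring.
apply: le_trans (n1D _ _) _; rewrite [e]splitr mulrDl; apply: lerD.
  apply: le_trans h1 _; rewrite -mulrA; apply: ler_wpM2l.
    by rewrite divr_ge0 // ltW.
  by rewrite mulrC ler_pdivrMr // mulrC.
apply: le_trans (n1M _ _) _; apply: le_trans (ler_wpM2l (n1_ge0 _) h2) _.
rewrite mulrA ler_wpM2r ?n1_ge0 // mulrCA ler_piMr ?divr_ge0 // ltW //.
by rewrite ltr_pdivrMr // mul1r ltrDl.
Qed.

Lemma cder_sqr z : cder (fun w => w * w) z (2 * z).
Proof.
move=> e e0; exists e => // w we.
have -> : w * w - z * z - 2 * z * (w - z) = (w - z) * (w - z) by ring.
by apply: le_trans (n1M _ _) _; rewrite ler_wpM2r ?n1_ge0 // ltW.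
Qed.

Lemma cderZ c f z a : cder f z a -> cder (fun w => c * f w) z (c * a).
Proof.
move=> hf; apply: (cder_comp (g := fun w => c * w) hf).
move=> e e0; exists 1 => // w _.
have -> : c * w - c * f z - c * (w - f z) = 0 by ring.
by rewrite n10 mulr_ge0 ?n1_ge0 // ltW.
Qed.

Lemma cderN f z a : cder f z a -> cder (fun w => - f w) z (- a).
Proof.
move=> h; have := cderZ (-1) h; rewrite mulN1r.
by apply: cder_ext => w; rewrite mulN1r.
Qed.

Lemma cderB f g z a b : cder f z a -> cder g z b -> cder (fun w => f w - g w) z (a - b).
Proof. by move=> h1 h2; exact: cderD h1 (cderN h2). Qed.

(* By polarization from the square. *)
Lemma cderM f g z a b : cder f z a -> cder g z b ->
  cder (fun w => f w * g w) z (a * g z + f z * b).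
Proof.
move=> hf hg.
have sq h c : cder h z c -> cder (fun w => h w * h w) z (2 * h z * c).
  by move=> hh; apply: (cder_comp (g := fun w => w * w) hh); exact: cder_sqr.
have half (u v : C) : u = 2 * v -> 2^-1 * u = v by move=> ->; rewrite mulKf ?pnatr_eq0.
have := cderZ 2^-1 (cderB (cderB (sq _ _ (cderD hf hg)) (sq _ _ hf)) (sq _ _ hg)).
rewrite (half _ (a * g z + f z * b)); last by ring.
by apply: cder_ext => w; apply: half; ring.
Qed.

End ComplexDerivative.

(** * Goursat's theorem on a square *)

Section Goursat.
Variables (R : realType) (f : Cplx R -> Cplx R) (z0 : Cplx R) (rho : R).
Hypothesis rho0 : 0 < rho.
Local Notation C := (Cplx R).
Local Notation inb x := (- rho <= x <= rho).
Let F x y := f (z0 + cplx x y).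
Hypothesis holo : forall x y, inb x -> inb y -> exists a, cder f (z0 + cplx x y) a.

Let zetaE (x y x' y' : R) :
  z0 + cplx x y - (z0 + cplx x' y') = cplx (x - x') (y - y').
Proof. by apply: cplx_ext; rewrite !cE; ring. Qed.

Let n1_cplx (x y : R) : n1 (cplx x y) = `|x| + `|y|. Proof. by []. Qed.

(** One-variable antiderivatives on each line stand for integrals along sides: [H y x2 - H y x1] is
    the integral of [f dz] over a horizontal side and, because [dz = 'i dy] on verticals,
    [G x y2 - G x y1] that over a vertical one. *)
Lemma horizontal_primitives : exists H, forall y x, inb y -> inb x -> rder (H y) x (F x y).
Proof.
suff /choice[H hH] : forall y, exists U, inb y -> forall x, inb x -> rder U x (F x y).
  by exists H => y x hy hx; apply: hH.
move=> y; have [hy|hy] := pselect (inb y); last by exists (fun=> 0).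
have [|t ht e e0|U hU] := @antiderivative R (fun x => F x y) (- rho) rho; [lra| |by exists U].
have [a /cder_cont /(_ e e0)[d d0 hd]] := holo ht hy; exists d => // s _ sd.
by apply: hd; rewrite zetaE n1_cplx subrr normr0 addr0.
Qed.

Lemma vertical_primitives : exists G, forall x y, inb x -> inb y ->
  rder (G x) y ('i * F x y).
Proof.
suff /choice[G hG] : forall x, exists U, inb x -> forall y, inb y -> rder U y (F x y).
  by exists (fun x y => 'i * G x y) => x y hx hy; apply: rderZ; apply: hG.
move=> x; have [hx|hx] := pselect (inb x); last by exists (fun=> 0).
have [|t ht e e0|U hU] := @antiderivative R (fun y => F x y) (- rho) rho; [lra| |by exists U].
have [a /cder_cont /(_ e e0)[d d0 hd]] := holo hx ht; exists d => // s _ sd.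
by apply: hd; rewrite zetaE n1_cplx subrr normr0 add0r.
Qed.

Variables H G : R -> R -> C.
Hypothesis hH : forall y x, inb y -> inb x -> rder (H y) x (F x y).
Hypothesis hG : forall x y, inb x -> inb y -> rder (G x) y ('i * F x y).

Let rder_hor (x y : R) : rder (fun t => cplx t y) x 1.
Proof.
have := rderD (rder_id 1 x) (rder_cst (cplx 0 y) x); rewrite addr0.
by apply: rder_ext => t; apply: cplx_ext; rewrite !cE; ring.
Qed.

Let rder_ver (x y : R) : rder (fun t => cplx x t) y 'i.
Proof.
have := rderD (rder_id 'i y) (rder_cst (cplx x 0) y); rewrite addr0.
by apply: rder_ext => t; apply: cplx_ext; rewrite !cE; ring.
Qed.

(** The integral of [f dz] around the rectangle, counterclockwise. *)
Let loop x1 x2 y1 y2 := (H y1 x2 - H y1 x1) + (G x2 y2 - G x2 y1)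
  - (H y2 x2 - H y2 x1) - (G x1 y2 - G x1 y1).

(* Up to the quadratic polynomial [Q], which integrates to zero along the
   boundary, [f] is small of second order near [(x, y)]. *)
Lemma loop_local x y (eps : R) : inb x -> inb y -> 0 < eps ->
  exists2 d : R, 0 < d & forall x1 x2 y1 y2, inb x1 -> inb x2 -> inb y1 -> inb y2 ->
    x1 <= x <= x2 -> y1 <= y <= y2 -> (x2 - x1) + (y2 - y1) < d ->
    n1 (loop x1 x2 y1 y2) <= 4 * eps * ((x2 - x1) + (y2 - y1)) ^+ 2.
Proof.
move=> hx hy e0; have [a /(_ _ e0)[d d0 hd]] := holo hx hy.
exists d => // x1 x2 y1 y2 hx1 hx2 hy1 hy2 hx12 hy12 small.
set D := (x2 - x1) + (y2 - y1) in small *.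
pose zt s t := cplx (s - x) (t - y).
pose q := fun w : C => F x y * w + a / 2 * (w * w).
pose Q s t := q (zt s t).
have qd w : cder q w (F x y + a * w).
  have := cderD (cderZ (F x y) (cder_id w)) (cderZ (a / 2) (cder_sqr w)).
  by rewrite mulr1; have -> : a / 2 * (2 * w) = a * w by field.
have err s t : x1 <= s <= x2 -> y1 <= t <= y2 ->
    n1 (F s t - (F x y + a * zt s t)) <= eps * D.
  move=> hs ht.
  have zD : n1 (zt s t) <= D.
    rewrite n1_cplx /D; apply: lerD; rewrite ler_norml; lra.
  have := hd (z0 + cplx s t); rewrite zetaE -/(zt s t) => /(_ (le_lt_trans zD small)).
  by rewrite opprD addrA => h; apply: le_trans h _; rewrite ler_wpM2l // ltW.
have hor t : inb t -> y1 <= t <= y2 ->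
    n1 ((H t x2 - Q x2 t) - (H t x1 - Q x1 t)) <= 2 * (eps * D) * (x2 - x1).
  move=> it ht; apply: (rder_bound (u := fun s => H t s - Q s t)
    (v := fun s => F s t - (F x y + a * zt s t))).
  - lra.
  - move=> s hs; apply: rderB; first by apply: hH => //; lra.
    rewrite -[X in rder _ _ X]mulr1; apply: (rder_comp (g := fun s => zt s t)); last exact: qd.
    have := rderD (rder_hor s t) (rder_cst (- cplx x y) s); rewrite addr0.
    by apply: rder_ext => r; apply: cplx_ext; rewrite !cE.
  - by move=> s hs; apply: err.
have ver s : inb s -> x1 <= s <= x2 ->
    n1 ((G s y2 - Q s y2) - (G s y1 - Q s y1)) <= 2 * (eps * D) * (y2 - y1).
  move=> it ht.
  apply: (rder_bound (u := fun t => G s t - Q s t)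
    (v := fun t => 'i * F s t - (F x y + a * zt s t) * 'i)).
  - lra.
  - move=> t hs; apply: rderB; first by apply: hG => //; lra.
    apply: (rder_comp (g := fun t => zt s t)); last exact: qd.
    have := rderD (rder_ver s t) (rder_cst (- cplx x y) t); rewrite addr0.
    by apply: rder_ext => r; apply: cplx_ext; rewrite !cE.
  - move=> t hs; rewrite [_ * 'i]mulrC -mulrBr.
    apply: le_trans (n1M _ _) _; rewrite {1}/n1 !cE normr0 normr1 add0r mul1r.
    exact: err.
have -> : loop x1 x2 y1 y2 =
  ((H y1 x2 - Q x2 y1) - (H y1 x1 - Q x1 y1)) + ((G x2 y2 - Q x2 y2) - (G x2 y1 - Q x2 y1))
  - ((H y2 x2 - Q x2 y2) - (H y2 x1 - Q x1 y2)) - ((G x1 y2 - Q x1 y2) - (G x1 y1 - Q x1 y1)).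
  by rewrite /loop; ring.
have n4 (p1 p2 p3 p4 : C) : n1 (p1 + p2 - p3 - p4) <= n1 p1 + n1 p2 + n1 p3 + n1 p4.
  apply: le_trans (n1D _ _) _; rewrite n1N lerD2r.
  by apply: le_trans (n1D _ _) _; rewrite n1N lerD2r; exact: n1D.
apply: le_trans (n4 _ _ _ _) _.
have h1 : n1 _ <= _ := hor y1 hy1 _; have h2 : n1 _ <= _ := ver x2 hx2 _.
have h3 : n1 _ <= _ := hor y2 hy2 _; have h4 : n1 _ <= _ := ver x1 hx1 _.
apply: le_trans (lerD (lerD (lerD (h1 _) (h2 _)) (h3 _)) (h4 _)) _; [lra..|].
(* Each side contributes at most [2 * (eps * D)] times its length and the perimeter is [2 * D]:
   hence the factor 4. *)
by rewrite le_eqVlt; apply/orP; left; apply/eqP; rewrite /D; ring.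
Qed.

(** The integral around a rectangle is the sum over its four quarters, and the bound [e * t ^+ 2] is
    the sum of four such bounds for [t / 2]. Bisection thus reduces the claim to [loop_local]. *)
Lemma loop_eq0_ordered x1 x2 y1 y2 : inb x1 -> inb x2 -> inb y1 -> inb y2 ->
  x1 <= x2 -> y1 <= y2 -> loop x1 x2 y1 y2 = 0.
Proof.
move=> hx1 hx2 hy1 hy2 hx hy; apply: n1_small => e e0.
set w := x2 - x1; set h := y2 - y1.
have w0 : 0 <= w by rewrite subr_ge0.
have h0 : 0 <= h by rewrite subr_ge0.
pose P a c t := 0 < t -> inb a -> inb (a + t * w) -> inb c -> inb (c + t * h) ->
  n1 (loop a (a + t * w) c (c + t * h)) <= e * t ^+ 2.
suff : P x1 y1 1.
  by rewrite /P !mul1r expr1n mulr1 /w /h ![_ + (_ - _)]addrC !subrK => ->.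
apply: (@cousin R w h P w0 h0 _ _ x1 y1 1 ltr01) => {hx1 hx2 hy1 hy2 hx hy}.
  move=> a c t t0 h1 h2 h3 h4 _ ha ha' hc hc'.
  have t20 : 0 < t / 2 by rewrite divr_gt0.
  have tw : 0 <= t / 2 * w by rewrite mulr_ge0 // ltW.
  have th : 0 <= t / 2 * h by rewrite mulr_ge0 // ltW.
  have E (b k : R) : b + t * k = b + t / 2 * k + t / 2 * k by field.
  rewrite E in ha'; rewrite E in hc'; rewrite !E.
  have -> : loop a (a + t / 2 * w + t / 2 * w) c (c + t / 2 * h + t / 2 * h) =
    loop a (a + t / 2 * w) c (c + t / 2 * h) +
    loop (a + t / 2 * w) (a + t / 2 * w + t / 2 * w) c (c + t / 2 * h) +
    loop a (a + t / 2 * w) (c + t / 2 * h) (c + t / 2 * h + t / 2 * h) +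
    loop (a + t / 2 * w) (a + t / 2 * w + t / 2 * w) (c + t / 2 * h) (c + t / 2 * h + t / 2 * h).
    by rewrite /loop; ring.
  apply: le_trans (n1D _ _) _; apply: le_trans (lerD (n1D _ _) (lexx _)) _.
  apply: le_trans (lerD (lerD (n1D _ _) (lexx _)) (lexx _)) _.
  have -> : e * t ^+ 2 = e * (t / 2) ^+ 2 + e * (t / 2) ^+ 2 + e * (t / 2) ^+ 2 + e * (t / 2) ^+ 2.
    by field.
  apply: lerD; first apply: lerD; first apply: lerD.
  - by apply: h1 => //; lra.
  - by apply: h2 => //; lra.
  - by apply: h3 => //; lra.
  - by apply: h4 => //; lra.
(* A rectangle with its corners in the square contains no point outside it, so any radius works at
   such points. *)
move=> x y; have [[hx hy]|nin] := pselect (inb x /\ inb y); last first.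
  by exists 1 => // a c t _ hx hy t0 ha ha' hc hc'; exfalso; apply: nin; split; lra.
(* [K] absorbs the constant of [loop_local] for rectangles of shape [w] by [h]; the summand 1 keeps
   it positive when both vanish. *)
pose K := 4 * (w + h) ^+ 2 + 1.
have K0 : 0 < K by rewrite ltr_wpDl // mulr_ge0 // sqr_ge0.
have eK : 0 < e / K by rewrite divr_gt0.
have [d d0 hd] := loop_local hx hy eK.
have k0 : 0 < w + h + 1 by lra.
exists (d / (w + h + 1)); first by rewrite divr_gt0.
move=> a c t /andP[t0 td] hxa hyc _ ha ha' hc hc'.
have E : a + t * w - a + (c + t * h - c) = t * (w + h) by ring.
have := hd a (a + t * w) c (c + t * h) ha ha' hc hc' hxa hyc.
rewrite E => /(_ _) h'; apply: le_trans (h' _) _.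
  move: td; rewrite ltr_pdivlMr //; apply: le_lt_trans.
  by rewrite ler_pM2l // lerDl.
have -> : 4 * (e / K) * (t * (w + h)) ^+ 2 = (e * t ^+ 2) * (4 * (w + h) ^+ 2 / K).
  by field; rewrite gt_eqF.
apply: ler_piMr; first by rewrite mulr_ge0 ?sqr_ge0 // ltW.
by rewrite ler_pdivrMr // mul1r lerDl.
Qed.

Lemma loop_eq0 x1 x2 y1 y2 : inb x1 -> inb x2 -> inb y1 -> inb y2 ->
  loop x1 x2 y1 y2 = 0.
Proof.
move=> hx1 hx2 hy1 hy2.
have sx a b c d : loop a b c d = - loop b a c d by rewrite /loop; ring.
have sy a b c d : loop a b c d = - loop a b d c by rewrite /loop; ring.
have [hx|/ltW hx] := leP x1 x2; have [hy|/ltW hy] := leP y1 y2.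
- exact: loop_eq0_ordered.
- by rewrite sy loop_eq0_ordered ?oppr0.
- by rewrite sx loop_eq0_ordered ?oppr0.
- by rewrite sx sy loop_eq0_ordered ?oppr0.
Qed.

(** The primitive integrates from the centre, horizontally and then vertically. The vanishing of
    loops lets the increment be computed from [(x, y)] itself, and continuity of [f] at that point
    gives the derivative. *)
Lemma goursat_box : exists P, forall x y, - rho < x < rho -> - rho < y < rho ->
  cder P (z0 + cplx x y) (F x y).
Proof.
pose p x y := H 0 x - H 0 0 + (G x y - G x 0).
have b0 : inb 0 by rewrite oppr_le0 (ltW rho0).
(* The loop used is that of the rectangle between the abscissas [x], [x'] and the ordinates [0],
   [y]. *)
have pB x y x' y' : inb x -> inb y -> inb x' -> inb y' ->
    p x' y' - p x y = (H y x' - H y x) + (G x' y' - G x' y).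
  move=> hx hy hx' hy'; have := loop_eq0 hx hx' b0 hy; rewrite /loop /p.
  move=> E; rewrite -[RHS]addr0 -[in RHS]E; ring.
exists (fun z => p (re (z - z0)) (im (z - z0))) => x y hx hy e e0.
have zx : re (z0 + cplx x y - z0) = x by rewrite !cE; ring.
have zy : im (z0 + cplx x y - z0) = y by rewrite !cE; ring.
have hx' : inb x by lra. 
have hy' : inb y by lra.
have e20 : 0 < e / 2 by rewrite divr_gt0.
have [a /cder_cont /(_ _ e20)[d d0 hd]] := holo hx' hy'.
pose m := Num.min (Num.min (x + rho) (rho - x)) (Num.min (y + rho) (rho - y)).
exists (Num.min d m).
  by rewrite !lt_min d0 /=; apply/andP; split; apply/andP; split; lra.
move=> w0; rewrite !lt_min => /andP[wd /andP[/andP[m1 m2] /andP[m3 m4]]].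
have [x' [y' E0]] : exists x' y', w0 = z0 + cplx x' y'.
  by exists (re (w0 - z0)), (im (w0 - z0)); apply: cplx_ext; rewrite !cE; ring.
rewrite {w0}E0 zx zy zetaE in wd m1 m2 m3 m4 *.
have [hx1 hy1] : inb x' /\ inb y'.
  have := le_lt_trans (re_le_n1 _) m1; have := le_lt_trans (re_le_n1 _) m2.
  have := le_lt_trans (im_le_n1 _) m3; have := le_lt_trans (im_le_n1 _) m4.
  rewrite !cE !ltr_norml => /andP[? ?] /andP[? ?] /andP[? ?] /andP[? ?].
  by split; lra.
have -> : re (z0 + cplx x' y' - z0) = x' by rewrite !cE; ring.
have -> : im (z0 + cplx x' y' - z0) = y' by rewrite !cE; ring.
rewrite pB //.
have near s t : Num.min x x' <= s <= Num.max x x' -> Num.min y y' <= t <= Num.max y y' ->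
    [/\ n1 (F s t - F x y) <= e / 2, inb s & inb t].
  rewrite !ge_min !le_max => hs ht.
  have hsx : `|s - x| <= `|x' - x|.
    rewrite ler_norml; have := ler_norm (x' - x); have := ler_norm (- (x' - x)).
    rewrite normrN; case/andP: hs => /orP[?|?] /orP[?|?]; lra.
  have hty : `|t - y| <= `|y' - y|.
    rewrite ler_norml; have := ler_norm (y' - y); have := ler_norm (- (y' - y)).
    rewrite normrN; case/andP: ht => /orP[?|?] /orP[?|?]; lra.
  split.
  - apply/ltW/hd; rewrite zetaE; apply: le_lt_trans wd.
    by rewrite !n1_cplx lerD.
  - by case/andP: hs => /orP[?|?] /orP[?|?]; lra.
  - by case/andP: ht => /orP[?|?] /orP[?|?]; lra.
have xx t : Num.min t t <= t <= Num.max t t by rewrite minxx maxxx !lexx.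
have x'x : Num.min x x' <= x' <= Num.max x x' by rewrite ge_min le_max !lexx !orbT.
have yx : Num.min y y' <= y <= Num.max y y' by rewrite ge_min le_max !lexx.
have hor : n1 ((H y x' - rcplx x' * F x y) - (H y x - rcplx x * F x y)) <= 2 * (e / 2) * `|x' - x|.
  apply: (rder_bound_sym (u := fun t => H y t - rcplx t * F x y)
    (v := fun t => F t y - F x y)) => t ht; have [n hs hs'] := near _ _ ht yx => //.
  by apply: rderB; [exact: hH|exact: rder_id].
have ver : n1 ((G x' y' - rcplx y' * ('i * F x y)) - (G x' y - rcplx y * ('i * F x y)))
    <= 2 * (e / 2) * `|y' - y|.
  apply: (rder_bound_sym (u := fun t => G x' t - rcplx t * ('i * F x y))
    (v := fun t => 'i * F x' t - 'i * F x y)) => t ht; have [n hs hs'] := near _ _ x'x ht => //.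
    by apply: rderB; [exact: hG|exact: rder_id].
  rewrite -mulrBr; apply: le_trans (n1M _ _) _.
  by rewrite {1}/n1 !cE normr0 normr1 add0r mul1r.
have E : cplx (x' - x) (y' - y) = rcplx x' - rcplx x + (rcplx y' - rcplx y) * 'i.
  by apply: cplx_ext; rewrite !cE; ring.
have -> : H y x' - H y x + (G x' y' - G x' y) - f (z0 + cplx x y) * cplx (x' - x) (y' - y) =
  ((H y x' - rcplx x' * F x y) - (H y x - rcplx x * F x y)) +
  ((G x' y' - rcplx y' * ('i * F x y)) - (G x' y - rcplx y * ('i * F x y))).
  by rewrite E /F; ring.
apply: le_trans (n1D _ _) (le_trans (lerD hor ver) _).
by rewrite -mulrDr n1_cplx le_eqVlt; apply/orP; left; apply/eqP; field.
Qed.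

End Goursat.

(** In the [n1] norm a square of half-side [r / 3] lies in the ball of radius [r] and contains the
    ball of radius [r / 3]. *)
Lemma goursat (R : realType) (f : Cplx R -> Cplx R) (z0 : Cplx R) (r : R) : 0 < r ->
  (forall w, n1 (w - z0) < r -> exists a, cder f w a) ->
  exists P, forall w, n1 (w - z0) < r / 3 -> cder P w (f w).
Proof.
move=> r0 h; have rho0 : 0 < r / 3 by rewrite divr_gt0.
have holo x y : - (r / 3) <= x <= r / 3 -> - (r / 3) <= y <= r / 3 ->
    exists a, cder f (z0 + cplx x y) a.
  move=> hx hy; apply: h; rewrite addrC addKr /n1 !cE.
  have : `|x| <= r / 3 by rewrite ler_norml.
  have : `|y| <= r / 3 by rewrite ler_norml.
  lra.
have [H hH] := horizontal_primitives holo.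
have [G hG] := vertical_primitives holo.
have [P hP] := goursat_box rho0 holo hH hG; exists P => w hw.
have {1 2}-> : w = z0 + cplx (re (w - z0)) (im (w - z0)).
  by apply: cplx_ext; rewrite !cE; ring.
by apply: hP; rewrite -ltr_norml; apply: le_lt_trans hw; [exact: re_le_n1|exact: im_le_n1].
Qed.

(** * Taylor expansion, maximum principle and exponential *)

Section Holomorphic.
Variable R : realType.
Local Notation C := (Cplx R).
Implicit Types (f g P : C -> C) (z w : C).

Lemma cderDc f z a c : cder f z a -> cder (fun w => f w + c) z a.
Proof. by move=> h; have := cderD h (cder_cst c z); rewrite addr0. Qed.

Lemma cderV f z c : f z != 0 -> cder f z c -> exists b, cder (fun w => (f w)^-1) z b.
Proof.
move=> fz0 hf; apply/derivableP_cder; apply: (derivableV fz0).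
by apply/derivableP_cder; exists c.
Qed.

Lemma rder_segment z w t : rder (fun t => z + rcplx t * w) t w.
Proof.
have := rderD (rder_cst z t) (rder_id w t); rewrite add0r.
exact.
Qed.

Lemma segment_ball z w (r t : R) : 0 <= t <= 1 -> n1 (w - z) < r ->
  n1 (z + rcplx t * (w - z) - z) < r.
Proof.
move=> /andP[t0 t1]; rewrite addrAC subrr add0r n1_rcplxM ger0_norm //; apply: le_lt_trans.
by rewrite ler_piMl ?n1_ge0.
Qed.

Lemma segment1 z w : z + rcplx 1 * (w - z) = w.
Proof. by rewrite rcplx1 mul1r addrC subrK. Qed.

Lemma cder0_constant f z (r : R) : (forall w, n1 (w - z) < r -> cder f w 0) ->
  forall w, n1 (w - z) < r -> f w = f z.
Proof.
move=> h w wr.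
have := @rder0_const R (fun t => f (z + rcplx t * (w - z))) 0 1 ler01.
rewrite segment1 rcplx0 mul0r addr0; apply=> t ht.
rewrite -(mul0r (w - z)).
by apply: (rder_comp (rder_segment _ _ _)); apply: h; apply: segment_ball.
Qed.

(** The first-order expansion of [a] at [z], integrated along the segment from [z] to [w], gives the
    second-order expansion of its primitive. *)
Lemma cder_taylor P (a : C -> C) z b (r : R) : 0 < r ->
  (forall w, n1 (w - z) < r -> cder P w (a w)) -> cder a z b ->
  forall eps : R, 0 < eps -> exists2 d : R, 0 < d & forall w, n1 (w - z) < d ->
    n1 (P w - P z - a z * (w - z) - b / 2 * (w - z) ^+ 2) <= eps * n1 (w - z) ^+ 2.
Proof.
move=> r0 hP ha e e0; have [|d d0 hd] := ha (e / 2); first by rewrite divr_gt0.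
exists (Num.min d r); first by rewrite lt_min d0.
move=> w; rewrite lt_min => /andP[wd wr].
pose q := fun u : C => a z * (u - z) + b / 2 * ((u - z) * (u - z)).
have hq u : cder q u (a z + b * (u - z)).
  have hu := cderB (cder_id u) (cder_cst z u); rewrite subr0 in hu.
  have := cderD (cderZ (a z) hu) (cderZ (b / 2) (cderM hu hu)).
  rewrite mulr1; have -> // : b / 2 * (1 * (u - z) + (u - z) * 1) = b * (u - z).
  by field.
pose g t := z + rcplx t * (w - z).
have g0 : g 0 = z by rewrite /g rcplx0 mul0r addr0.
have g1 : g 1 = w by rewrite /g segment1.
have := @rder_bound R (fun t => P (g t) - q (g t))
  (fun t => a (g t) * (w - z) - (a z + b * (g t - z)) * (w - z))
  (e / 2 * n1 (w - z) * n1 (w - z)) 0 1 ler01.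
rewrite g0 g1 subr0 mulr1 => H; apply: le_trans (le_trans (H _ _) _); last first.
- by rewrite le_eqVlt; apply/orP; left; apply/eqP; field.
- move=> t ht; have gb := segment_ball ht wd; rewrite -/(g t) in gb.
  have -> : a (g t) * (w - z) - (a z + b * (g t - z)) * (w - z) =
    (a (g t) - a z - b * (g t - z)) * (w - z) by ring.
  apply: le_trans (n1M _ _) _; apply: ler_wpM2r; first exact: n1_ge0.
  apply: le_trans (hd _ gb) _; apply: ler_wpM2l; first by rewrite divr_ge0 // ltW.
  case/andP: ht => t0 t1; rewrite /g addrAC subrr add0r n1_rcplxM ger0_norm //.
  by rewrite ler_piMl ?n1_ge0.
- move=> t ht; apply: rderB.
    by apply: (rder_comp (g := g)); [exact: rder_segment|apply/hP/segment_ball].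
  by apply: (rder_comp (g := g)); [exact: rder_segment|exact: hq].
rewrite le_eqVlt; apply/orP; left; apply/eqP; congr n1.
by rewrite /q; ring.
Qed.

(** The singularity at [z] is removable: filled in by [a z], the quotient has derivative [b / 2]
    there by [cder_taylor]. Goursat's theorem thus applies on a full neighbourhood of [z]. *)
Lemma difference_quotient_derivable P (a : C -> C) z (r : R) : 0 < r ->
  (forall w, n1 (w - z) < r -> cder P w (a w)) ->
  (forall w, n1 (w - z) < r -> exists b, cder a w b) ->
  forall w, n1 (w - z) < r -> exists c,
    cder (fun w => if w == z then a z else (P w - P z) / (w - z)) w c.
Proof.
move=> r0 hP ha w wr; have [->|wz] := eqVneq w z.
  have [|b hb] := ha z; first by rewrite subrr n10.
  exists (b / 2) => e e0.
  have [|d d0 hd] := cder_taylor r0 hP hb (eps := e / 2); first by rewrite divr_gt0.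
  exists d => // u ud; rewrite eqxx; have [->|uz] := eqVneq u z.
    by rewrite !subrr mulr0 subrr n10 mulr0.
  have uz0 : u - z != 0 by rewrite subr_eq0.
  have nu : 0 < n1 (u - z).
    by rewrite lt_neqAle n1_ge0 andbT eq_sym; apply: contra_neq uz0 => /n1_eq0.
  have -> : (P u - P z) / (u - z) - a z - b / 2 * (u - z) =
    (P u - P z - a z * (u - z) - b / 2 * (u - z) ^+ 2) * (u - z)^-1 by field.
  apply: le_trans (n1M _ _) _.
  apply: le_trans (ler_pM (n1_ge0 _) (n1_ge0 _) (hd _ ud) (n1V uz0)) _.
  by rewrite le_eqVlt; apply/orP; left; apply/eqP; field; rewrite gt_eqF.
have wz0 : w - z != 0 by rewrite subr_eq0.
have [b hb] := cderV (f := fun u => u - z) wz0 (cderB (cder_id w) (cder_cst z w)).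
have := cderM (cderB (hP w wr) (cder_cst (P z) w)) hb.
set c := (X in cder _ _ X); move=> h; exists c; apply: cder_ext_near h.
have nu : 0 < n1 (w - z).
  by rewrite lt_neqAle n1_ge0 andbT eq_sym; apply: contra_neq wz0 => /n1_eq0.
apply/near_n1P; exists (n1 (w - z)) => // u uw.
by case: eqVneq => // uz; move: uw; rewrite uz n1B ltxx.
Qed.

(* Integrating the difference quotient along a circle through [w] around [z]
   gives a closed path whose imaginary part has derivative
   [re (P (gamma t) - P z) <= 0]. *)
Lemma maximum_principle P (a : C -> C) z (r : R) : 0 < r ->
  (forall w, n1 (w - z) < r -> cder P w (a w)) ->
  (forall w, n1 (w - z) < r -> exists b, cder a w b) ->
  (forall w, n1 (w - z) < r -> re (P w) <= re (P z)) ->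
  forall w, n1 (w - z) < r / 6 -> re (P w) = re (P z).
Proof.
move=> r0 hP ha hmax w wr; have [-> //|wz] := eqVneq w z.
have [K hK] := goursat r0 (difference_quotient_derivable r0 hP ha).
pose h := w - z; pose c t : C := cplx (cos t) (sin t).
pose g t := z + h * c t.
(* Since [n1 (c t) <= 2], starting within [r / 6] keeps the circle in the ball of radius [r / 3] on
   which [goursat] provides [K]. *)
have gball t : n1 (g t - z) < r / 3.
  rewrite /g addrAC subrr add0r; apply: le_lt_trans (n1M _ _) _.
  apply: (@le_lt_trans _ _ (n1 h * 2)).
    apply: ler_wpM2l; first exact: n1_ge0.
    rewrite /n1 !cE mulr2n; apply: lerD; first exact: cos_max.
    by rewrite ler_norml sin_geN1 sin_le1.
  by move: wr; rewrite -/h; lra.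
have gball' t : n1 (g t - z) < r by apply: lt_trans (gball t) _; lra.
have dg t : rder g t (h * ('i * c t)).
  have dc : rder c t ('i * c t).
    apply/rderP; split; rewrite !cE ?mul0r ?mul1r ?add0r ?sub0r.
      exact: is_derive_cos.
    exact: is_derive_sin.
  by have := rderD (rder_cst z t) (rderZ h dc); rewrite add0r.
have c0 t : c t != 0.
  apply/eqP => /(congr1 (@abs2 R)); rewrite /abs2 !cE cos2Dsin2 expr0n /= addr0.
  by move/eqP; rewrite oner_eq0.
have h0 : h != 0 by rewrite subr_eq0.
pose u t := K (g t).
have du t : rder u t ('i * (P (g t) - P z)).
  have := rder_comp (dg t) (hK _ (gball t)).
  have -> // : (if g t == z then a z else (P (g t) - P z) / (g t - z)) *
    (h * ('i * c t)) = 'i * (P (g t) - P z).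
  have gz : g t - z = h * c t by rewrite /g addrAC subrr add0r.
  rewrite -subr_eq0 gz mulf_eq0 (negbTE h0) (negbTE (c0 t)) /=.
  by field; rewrite h0 c0.
pose v t := im (u t).
have dv (t : R) : is_derive t 1 v (re (P (g t)) - re (P z)).
  by have /rderP[_] := du t; rewrite !cE mul0r mul1r add0r.
have mono s t : s <= t -> v t <= v s.
  move=> st; have [c1 _ E] := real_MVT st (fun x _ => dv x).
  rewrite -subr_le0 E mulr_le0_ge0 ?subr_ge0 // subr_le0.
  exact: hmax.
(* Equal values at both ends of [[- pi, pi]] force the nonincreasing [v] to be constant; its
   derivative at 0, where the circle passes through [w], is the difference to be killed. *)
have vpi : v (- pi) = v pi by rewrite /v /u /g /c cosN sinN sinpi oppr0.
have v0 s : `|s| < pi -> v s = v 0.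
  rewrite ltr_norml => /andP[s1 s2].
  have const t : - pi <= t <= pi -> v t = v pi.
    by case/andP=> t1 t2; apply/eqP; rewrite eq_le -{1}vpi !mono.
  have p0 : 0 <= pi :> R by rewrite ltW ?pi_gt0.
  by rewrite !const ?oppr_le0 ?p0 ?(ltW s1) ?(ltW s2).
have g0 : g 0 = w by rewrite /g /c cos0 sin0 mulr1 /h addrC subrK.
have /real_derP D := dv 0; rewrite g0 in D.
apply/eqP; rewrite -subr_eq0 -normr_eq0 eq_le normr_ge0 andbT.
apply/ler_addgt0Pl => e e0; rewrite addr0.
have [d d0 hd] := D e e0.
pose s := Num.min d pi / 2.
have s0 : 0 < s by rewrite divr_gt0 // lt_min d0 pi_gt0.
have sd : s < Num.min d pi.
  by rewrite /s ltr_pdivrMr // ltr_pMr ?(ltr_nat _ 1 2) // lt_min d0 pi_gt0.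
move: sd; rewrite lt_min => /andP[sd sp].
have := hd s; rewrite subr0 gtr0_norm // => /(_ sd).
have -> : v s = v 0 by apply: v0; rewrite gtr0_norm.
rewrite subrr sub0r normrN normrM (gtr0_norm s0).
by rewrite ler_pM2r.
Qed.

(** The derivative along a direction [v] is [c * v], and its real part vanishes; [v = 1] and
    [v = 'i] recover both parts of [c]. *)
Lemma constant_re_der0 P z c (r : R) : 0 < r ->
  (forall w, n1 (w - z) < r -> re (P w) = re (P z)) -> cder P z c -> c = 0.
Proof.
move=> r0 hP hc.
have dir (v : C) : re (c * v) = 0.
  have hz : z + rcplx 0 * v = z by rewrite rcplx0 mul0r addr0.
  have := rder_segment z v 0; rewrite -hz in hc.
  move=> /rder_comp /(_ hc) /rderP[/real_derP D _].
  apply/eqP; rewrite -normr_eq0 eq_le normr_ge0 andbT.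
  apply/ler_addgt0Pl => e e0; rewrite addr0.
  have [d d0 hd] := D e e0.
  have nv : 0 < n1 v + 1 by rewrite ltr_wpDl ?n1_ge0.
  pose s := Num.min d (r / (n1 v + 1)) / 2.
  have m0 : 0 < Num.min d (r / (n1 v + 1)) by rewrite lt_min d0 divr_gt0.
  have s0 : 0 < s by rewrite divr_gt0.
  have : s < Num.min d (r / (n1 v + 1)).
    by rewrite /s ltr_pdivrMr // ltr_pMr // (ltr_nat _ 1 2).
  rewrite lt_min ltr_pdivlMr // => /andP[sd sp].
  have := hd s; rewrite subr0 gtr0_norm // => /(_ sd) /=.
  rewrite hz hP; last first.
    rewrite addrAC subrr add0r n1_rcplxM gtr0_norm //; apply: le_lt_trans sp.
    by rewrite ler_wpM2l ?ltW // ltrDl.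
  rewrite subrr sub0r normrN normrM (gtr0_norm s0).
  by rewrite ler_pM2r.
have := dir 1; have := dir 'i; rewrite !cE mulr0 mulr1 sub0r mulr0 subr0 mulr1.
by move=> /eqP; rewrite oppr_eq0 => /eqP h1 h2; apply: cplx_ext.
Qed.

Lemma cexpD z w : cexp (z + w) = cexp z * cexp w.
Proof.
by apply: cplx_ext; rewrite /cexp !cE expRD cosD sinD; ring.
Qed.

Lemma cexp0 : cexp (0 : C) = 1.
Proof. by apply: cplx_ext; rewrite /cexp !cE expR0 cos0 sin0; ring. Qed.

Lemma cexpNM z : cexp (- z) * cexp z = 1.
Proof. by rewrite -cexpD addNr cexp0. Qed.

Lemma cexp_neq0 z : cexp z != 0.
Proof.
by apply/eqP => h; have := cexpNM z; rewrite h mulr0 => /eqP; rewrite eq_sym oner_eq0.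
Qed.

Lemma cexp_der0 : cder (@cexp R) 0 1.
Proof.
(* The error will be at most [k * |x| + (3 + 3 + 2) * k * |y|], where [k <= 1] serves to bound
   [expR x] by 3. *)
move=> e e0; have [k [k0 k1 ke]] : exists k : R, [/\ 0 < k, k <= 1 & 8 * k <= e].
  exists (Num.min (e / 8) 1); split; first by rewrite lt_min ltr01 divr_gt0.
    by rewrite ge_min lexx orbT.
  by rewrite mulrC -ler_pdivlMr // ge_min lexx.
have /real_derP/(_ k k0)[d1 d10 h1] := is_derive_expR (0 : R).
have /real_derP/(_ k k0)[d2 d20 h2] := is_derive_cos (0 : R).
have /real_derP/(_ k k0)[d3 d30 h3] := is_derive_sin (0 : R).
exists (Num.min (Num.min d1 d2) (Num.min d3 k)).
  by rewrite !lt_min d10 d20 d30.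
move=> w; rewrite subr0 !lt_min => /andP[/andP[w1 w2] /andP[w3 wk]].
rewrite cexp0 mul1r; set x := re w; set y := im w.
have xw : `|x| <= n1 w := re_le_n1 w; have yw : `|y| <= n1 w := im_le_n1 w.
have := h1 x; rewrite subr0 expR0 mul1r => /(_ (le_lt_trans xw w1)) {}h1.
have := h2 y; rewrite subr0 cos0 sin0 oppr0 mul0r subr0 => /(_ (le_lt_trans yw w2)) {}h2.
have := h3 y; rewrite !subr0 sin0 cos0 mul1r subr0 => /(_ (le_lt_trans yw w3)) {}h3.
have xk : `|x| <= k by apply: ltW; exact: le_lt_trans xw wk.
have E1 : `|expR x - 1| <= 2 * `|x|.
  have -> : expR x - 1 = (expR x - 1 - x) + x by ring.
  apply: le_trans (ler_normD _ _) _.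
  have := ler_wpM2r (normr_ge0 x) k1; lra.
have E2 : `|expR x| <= 3.
  have -> : expR x = (expR x - 1) + 1 by ring.
  apply: le_trans (ler_normD _ _) _; rewrite normr1; lra.
have E3 : `|expR x * (cos y - 1)| <= 3 * (k * `|y|).
  by rewrite normrM; apply: ler_pM.
have E4 : `|expR x * (sin y - y)| <= 3 * (k * `|y|).
  by rewrite normrM; apply: ler_pM.
have E5 : `|(expR x - 1) * y| <= 2 * k * `|y|.
  rewrite normrM; apply: ler_wpM2r => //; apply: le_trans E1 _.
  by rewrite ler_pM2l.
have -> : n1 (cexp w - 1 - w) = `|(expR x - 1 - x) + expR x * (cos y - 1)| +
    `|expR x * (sin y - y) + (expR x - 1) * y|.
  by rewrite /n1 /cexp !cE -/x -/y; congr (_ + _); congr (`|_|); ring.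
apply: le_trans (lerD (ler_normD _ _) (ler_normD _ _)) _.
apply: (@le_trans _ _ (8 * k * n1 w)); last by rewrite ler_wpM2r ?n1_ge0.
have := mulr_ge0 (ltW k0) (normr_ge0 x); have := mulr_ge0 (ltW k0) (normr_ge0 y).
rewrite /n1 -/x -/y; lra.
Qed.

(** The addition formula carries the derivative from 0 to [z]. *)
Lemma cder_cexp z : cder (@cexp R) z (cexp z).
Proof.
have h : cder (fun w => w - z) z 1.
  by have := cderB (cder_id z) (cder_cst z z); rewrite subr0.
have := cder_comp (g := @cexp R) h; rewrite subrr => /(_ _ cexp_der0).
rewrite mulr1 => /(cderZ (cexp z)); rewrite mulr1.
by apply: cder_ext => w /=; rewrite -cexpD addrC subrK.
Qed.

Lemma rder_cexp (u : R -> C) t v : rder u t v ->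
  rder (fun s => cexp (u s)) t (cexp (u t) * v).
Proof. by move=> h; apply: (rder_comp h); exact: cder_cexp. Qed.

End Holomorphic.

(** * Integration of holomorphic forms along paths *)

Section Intervals.
Variable R : realType.

Lemma near_realP (t : R) (P : R -> Prop) :
  (\forall s \near t, P s) <-> exists2 d : R, 0 < d & forall s, `|s - t| < d -> P s.
Proof.
split=> [/nbhs_ballP[d /= d0 h]|[d d0 h]].
  by exists d => // s sd; apply: h; rewrite -ball_normE /= distrC.
by apply/nbhs_ballP; exists d => //= s; rewrite -ball_normE /= distrC => /h.
Qed.

(** This is [cousin] for rectangles of height 0, whose four quarters are just two halves. It plays
    the role of compactness of [[A, B]]: additive and local implies global. *)
Lemma cousin1 (A B : R) (Q : R -> R -> Prop) : A <= B ->
  (forall a b c, a <= b <= c -> Q a b -> Q b c -> Q a c) ->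
  (forall x, A <= x <= B -> exists2 d : R, 0 < d & forall a b : R,
     A <= a -> b <= B -> a <= x <= b -> b - a < d -> Q a b) ->
  Q A B.
Proof.
move=> AB add loc.
(* [cousin] ranges over all intervals, hence the guards. *)
pose P a (c : R) t := A <= a -> a + t <= B -> Q a (a + t).
have PQ a c t : 0 < t -> P a c t.
  apply: (@cousin R 1 0 P ler01 (lexx 0)) => {a c t} [a c t t0 h1 h2 _ _ Aa tB|x ?].
    have t20 : 0 <= t / 2 by rewrite divr_ge0 // ltW.
    have E : a + t = a + t / 2 + t / 2 by rewrite -addrA -splitr.
    rewrite mulr1 in h2.
    have hm : a <= a + t / 2 <= a + t by rewrite E !lerDl t20.
    apply: (add _ _ _ hm); first by apply: h1 => //; case/andP: hm => _ /le_trans; apply.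
    by rewrite E; apply: h2; rewrite -?E // (le_trans Aa) // lerDl.
  have [hx|hx] := boolP (A <= x <= B).
    have [d d0 hd] := loc x hx; exists d => // a ? t /andP[t0 td].
    by rewrite mulr1 => ax _ Aa tB; apply: hd => //; rewrite addrC addrA addNr add0r.
  exists 1 => // a ? t _; rewrite mulr1 => /andP[ax xa] _ Aa tB.
  by case/negP: hx; rewrite (le_trans Aa ax) (le_trans xa tB).
(* [cousin] needs a positive length, so a one-point interval is read off the local hypothesis. *)
move: AB; rewrite le_eqVlt => /orP[/eqP AB|AB].
  have [|d d0] := loc A; first by rewrite lexx AB lexx.
  by move=> h; apply: h => //; rewrite -AB ?lexx ?subrr.
have -> : B = A + (B - A) by rewrite addrC subrK.
apply: (PQ A 0) => //; first by rewrite subr_gt0.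
by rewrite addrC subrK.
Qed.

Lemma locally_constant (A B : R) (T : Type) (u : R -> T) : A <= B ->
  (forall t, A <= t <= B -> exists2 d : R, 0 < d &
     forall s, A <= s <= B -> `|s - t| < d -> u s = u t) -> u A = u B.
Proof.
move=> AB loc; apply: (cousin1 (Q := fun a b => u a = u b) AB).
  by move=> a b c _ -> ->.
move=> x /loc[d d0 hd]; exists d => // a b Aa bB /andP[ax xb] ab.
rewrite (hd a) ?(hd b) ?Aa ?bB ?andbT //.
- exact: le_trans (le_trans Aa ax) xb.
- by rewrite ger0_norm ?subr_ge0 //; apply: le_lt_trans ab; rewrite lerD2l lerN2.
- exact: le_trans ax (le_trans xb bB).
- by rewrite distrC ger0_norm ?subr_ge0 //; apply: le_lt_trans ab; rewrite lerD2r.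
Qed.

End Intervals.

Section Primitives.
Variables (R : realType) (X : riemann_surface R).
Local Notation C := (Cplx R).
Implicit Types (a b : one_form X) (x y : X) (Phi Psi : X -> C) (p : R -> X).

(** A primitive is a function on the surface near [x], read in a chart of its own choice; charts are
    compared once and for all in [primitive_unique]. *)
Definition primitive_at a x Phi := exists (i : chart X) (P : C -> C),
  [/\ dom i x, \forall z \near coord i x, cder P z (a i z) &
      \forall y \near x, Phi y = P (coord i y)].

Lemma near_comp (T U : topologicalType) (f : T -> U) t (P : U -> Prop) :
  {for t, continuous f} -> (\forall y \near f t, P y) -> \forall s \near t, P (f s).
Proof. by move=> h /h. Qed.

Lemma dom_nbhs i x : dom i x -> nbhs x (dom i).
Proof. by move=> ix; apply: open_nbhs_nbhs; split=> //; exact: dom_open. Qed.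

Lemma coord_image_nbhs i x : dom i x -> nbhs (coord i x) (coord i @` dom i).
Proof.
move=> ix; apply: open_nbhs_nbhs; split; first exact: coord_open.
by exists x.
Qed.

Lemma chart_primitive a i x : holomorphic_form a -> dom i x ->
  exists P, \forall z \near coord i x, cder P z (a i z).
Proof.
move=> [_ ha _] ix.
have /near_n1P[r r0 hr] := coord_image_nbhs ix.
have [w wr|P hP] := @goursat R (a i) (coord i x) r r0.
  by apply/derivableP_cder; apply: ha; exact: hr.
by exists P; apply/near_n1P; exists (r / 3) => //; rewrite divr_gt0.
Qed.

(** The same [Phi] serves at every point near [x], as a path crossing the neighbourhood requires. *)
Lemma primitive_exists a x : holomorphic_form a -> exists Phi,
  \forall y \near x, primitive_at a y Phi.
Proof.
move=> ha; have [i ix] := dom_cover x.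
have [P hP] := chart_primitive ha ix; exists (P \o coord i).
have hP2 := nbhs_interior hP.
have hx : \forall y \near x, (fun z => cder P z (a i z))^° (coord i y).
  exact: near_comp (coord_continuous ix) hP2.
near=> y; exists i, P; split.
- by near: y; exact: dom_nbhs.
- by near: y.
- by near=> u.
Unshelve. all: by end_near. Qed.

Lemma transition_near i j x : dom i x -> dom j x ->
  \forall z \near coord i x, (coord i @` (dom i `&` dom j)) z.
Proof.
move=> ix jx; have cp : {for coord i x, continuous (point (r := X) i)}.
  by apply: point_continuous; exists x.
have : nbhs (point i (coord i x)) (dom i `&` dom j).
  by rewrite coordK //; apply: filterI; exact: dom_nbhs.
move=> /cp hij; near=> z.
have [y iy yz] : (coord i @` dom i) z by near: z; exact: coord_image_nbhs.
exists (point i z); first by near: z.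
by rewrite -yz coordK.
Unshelve. all: by end_near. Qed.

(** In the chart [i] the difference of the two primitives is [P - Q \o T] with [T] the change of
    coordinates, and the transformation rule of [a] says exactly that its derivative is zero. *)
Lemma primitive_unique a x Phi Psi : holomorphic_form a ->
  primitive_at a x Phi -> primitive_at a x Psi ->
  \forall y \near x, Phi y - Psi y = Phi x - Psi x.
Proof.
move=> [_ _ tr] [i [P [ix hP eP]]] [j [Q [jx hQ eQ]]].
pose T := coord j \o point (r := X) i.
have Tx : T (coord i x) = coord j x by rewrite /T /= coordK.
have ij := transition_near ix jx.
have hT z : (coord i @` (dom i `&` dom j)) z -> cder T z ('D_1 T z).
  by move=> hz; apply/cderP; apply: DeriveDef => //; exact: transition_holomorphic.
have cT : {for coord i x, continuous T}.
  by apply: cder_continuous; apply: hT; exact: nbhs_singleton ij.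
have hQ' : \forall z \near coord i x, cder Q (T z) (a j (T z)).
  by rewrite -Tx in hQ; exact: near_comp cT hQ.
have : \forall z \near coord i x, cder (fun z => P z - Q (T z)) z 0.
  apply: filterS3 ij hP hQ' => z hz h1 h2.
  rewrite -(subrr (a i z)) {2}(tr i j z hz).
  by apply: cderB => //; exact: (cder_comp (hT _ hz)).
move=> /near_n1P[r r0 hr]; have K := cder0_constant hr.
have near_r : \forall y \near x, n1 (coord i y - coord i x) < r.
  have : nbhs (coord i x) [set w | n1 (w - coord i x) < r] by apply/near_n1P; exists r.
  exact: near_comp (coord_continuous ix).
near=> y.
have Ey : Phi y - Psi y = P (coord i y) - Q (T (coord i y)).
  congr (_ - _); first by near: y.
  rewrite /T /= coordK; last by near: y; exact: dom_nbhs.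
  by near: y.
rewrite Ey K; last by near: y.
by rewrite (nbhs_singleton eP) (nbhs_singleton eQ) Tx.
Unshelve. all: by end_near. Qed.

(** Freedom of chart: [Phi] differs by a constant from a Goursat primitive in the prescribed chart,
    and [P] absorbs the constant. *)
Lemma primitive_at_chart a x Phi i : holomorphic_form a -> primitive_at a x Phi ->
  dom i x -> exists P, (\forall z \near coord i x, cder P z (a i z)) /\
    \forall y \near x, Phi y = P (coord i y).
Proof.
move=> ha hPhi ix; have [P hP] := chart_primitive ha ix.
have hPi : primitive_at a x (P \o coord i) by exists i, P; split=> //; near=> y.
have hc := primitive_unique ha hPhi hPi; pose c := Phi x - P (coord i x).
exists (fun z => P z + c); split.
  by apply: filterS hP => z; exact: cderDc.
by apply: filterS hc => y hy; rewrite /c -[Phi x - _]hy /= addrC subrK.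
Unshelve. all: by end_near. Qed.

Lemma primitive_at_lin a b (c : C) x Phi Psi : holomorphic_form a ->
  holomorphic_form b -> primitive_at a x Phi -> primitive_at b x Psi ->
  primitive_at (fun i z => a i z + c * b i z) x (fun y => Phi y + c * Psi y).
Proof.
move=> ha hb hPhi hPsi; have [i ix] := dom_cover x.
have [P [hP eP]] := primitive_at_chart ha hPhi ix.
have [Q [hQ eQ]] := primitive_at_chart hb hPsi ix.
exists i, (fun z => P z + c * Q z); split=> //.
  by apply: filterS2 hP hQ => z h1 h2; apply: cderD => //; exact: cderZ.
by apply: filterS2 eP eQ => y -> ->.
Qed.

(** Compared with [primitive_along], the interval is arbitrary and the germs carry no chart, so that
    continuations can be glued, restricted and reparametrized. *)
Definition along a p (A B : R) (F : R -> C) := forall t, A <= t <= B ->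
  exists2 Phi, primitive_at a (p t) Phi &
    \forall s \near t, A <= s <= B -> F s = Phi (p s).

Lemma along_of_primitive a p A B Phi :
  (forall t, A <= t <= B -> primitive_at a (p t) Phi) -> along a p A B (Phi \o p).
Proof. by move=> h t /h ht; exists Phi => //; near=> s. Unshelve. all: by end_near. Qed.

(** One primitive covers a short piece of the path, and continuations over adjacent pieces glue
    after adding a constant to the second. *)
Lemma along_exists a p A B : holomorphic_form a -> continuous p -> A <= B ->
  exists F, along a p A B F.
Proof.
move=> ha cp AB; apply: (cousin1 (Q := fun A B => exists F, along a p A B F) AB).
  move=> u v w /andP[uv vw] [F hF] [G hG].
  exists (fun s => if s <= v then F s else G s - G v + F v) => t /andP[ut tw].
  have [tv|vt|tv] := ltgtP t v.
  - have [|Phi h e] := hF t; first by rewrite ut ltW.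
    exists Phi => //; near=> s => /andP[us _].
    have sv : s < v by near: s; exact: lt_nbhsl.
    rewrite ltW //; have : u <= s <= v -> F s = Phi (p s) by near: s.
    by apply; rewrite us ltW.
  - have [|Phi h e] := hG t; first by rewrite tw ltW.
    exists (fun y => Phi y + (F v - G v)).
      have [i [P [ix hP eP]]] := h; exists i, (fun z => P z + (F v - G v)); split=> //.
        by apply: filterS hP => z; exact: cderDc.
      by apply: filterS eP => y ->.
    near=> s => /andP[_ sw].
    have sv : v < s by near: s; exact: lt_nbhsr.
    rewrite leNgt sv /=; have -> : G s = Phi (p s).
    by apply: (_ : v <= s <= w -> G s = Phi (p s)); [near: s|rewrite sw ltW].
    by rewrite addrA addrAC.
  - have [|Phi h e] := hF t; first by rewrite ut tv lexx.
    have [|Psi h' e'] := hG t; first by rewrite tw tv lexx.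
    exists Phi => //.
    (* At the junction the germs [Phi] and [Psi] differ by a constant, so [Phi] also continues the
       shifted [G] to the right of [v]. *)
    have hd := near_comp (cp t) (primitive_unique ha h' h).
    have FV : F v = Phi (p v).
      by have := nbhs_singleton e; rewrite tv lexx uv; apply.
    have GV : G v = Psi (p v).
      by have := nbhs_singleton e'; rewrite tv lexx vw; apply.
    near=> s => /andP[us sw]; case: leP => sv.
      by apply: (_ : u <= s <= v -> F s = Phi (p s)); [near: s|rewrite us].
    have -> : G s = Psi (p s).
      by apply: (_ : v <= s <= w -> G s = Psi (p s)); [near: s|rewrite sw ltW].
    have : Psi (p s) - Phi (p s) = Psi (p t) - Phi (p t) by near: s.
    rewrite tv FV GV => /eqP; rewrite subr_eq => /eqP ->; ring.
move=> x hx; have [Phi hPhi] := primitive_exists (p x) ha.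
have /near_realP[d d0 hd] := near_comp (cp x) hPhi.
exists d => // u v Au vB /andP[ux xv] uv.
exists (Phi \o p); apply: along_of_primitive => t /andP[ut tv]; apply: hd.
rewrite ltr_norml; lra.
Unshelve. all: by end_near. Qed.

Lemma along_unique a p A B F G : holomorphic_form a -> continuous p -> A <= B ->
  along a p A B F -> along a p A B G -> F B - F A = G B - G A.
Proof.
move=> ha cp AB hF hG.
suff : F A - G A = F B - G B.
  by move=> /eqP; rewrite subr_eq => /eqP ->; ring.
apply: (locally_constant (u := fun t => F t - G t) AB) => t ht.
have [Phi h e] := hF t ht; have [Psi h' e'] := hG t ht.
have hd := near_comp (cp t) (primitive_unique ha h h').
have : \forall s \near t, A <= s <= B -> F s - G s = F t - G t.
  near=> s => hs.
  have -> : F s = Phi (p s) by move: hs; near: s.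
  have -> : G s = Psi (p s) by move: hs; near: s.
  rewrite (nbhs_singleton e ht) (nbhs_singleton e' ht); near: s; exact: hd.
by move=> /near_realP[d d0 hd']; exists d => // s hs sd; apply: hd'.
Unshelve. all: by end_near. Qed.

Lemma along_reparam a p (f : R -> R) A B F : continuous f ->
  (forall t, 0 <= t <= 1 -> A <= f t <= B) -> along a p A B F ->
  along a (p \o f) 0 1 (F \o f).
Proof.
move=> cf hf hF t ht; have [Phi h e] := hF _ (hf t ht); exists Phi => //.
have he := near_comp (cf t) e; near=> s => hs /=.
by have := hf s hs; near: s.
Unshelve. all: by end_near. Qed.

Lemma along_lin a b c p A B F G : holomorphic_form a -> holomorphic_form b ->
  along a p A B F -> along b p A B G ->
  along (fun i z => a i z + c * b i z) p A B (fun t => F t + c * G t).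
Proof.
move=> ha hb hF hG t ht; have [Phi h e] := hF t ht; have [Psi h' e'] := hG t ht.
exists (fun y => Phi y + c * Psi y); first exact: primitive_at_lin.
by apply: filterS2 e e' => s h1 h2 hs; rewrite h1 // h2.
Qed.

Lemma primitive_alongP a p F : continuous p -> primitive_along a p F <-> along a p 0 1 F.
Proof.
move=> cp; split=> h t ht.
  have [i [P [ix hP eP]]] := h t ht; exists (P \o coord i) => //.
  exists i, P; split=> //; last by near=> y.
  by apply: filterS hP => z /cderP.
have [Phi [i [P [ix hP eP]]] e] := h t ht; exists i, P; split=> //.
  by apply: filterS hP => z /cderP.
have eP' := near_comp (cp t) eP.
by apply: filterS2 e eP' => s e1 e2 hs; rewrite e1.
Unshelve. all: by end_near. Qed.

(** [path_int] picks an arbitrary continuation; [along_unique] makes the choice immaterial. *)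
Lemma path_int_along a p F : holomorphic_form a -> continuous p ->
  along a p 0 1 F -> path_int a p = F 1 - F 0.
Proof.
move=> ha cp hF; rewrite /path_int; case: xgetP => [c -> [G [/(primitive_alongP _ _ cp) hG ->]]|].
  exact: (along_unique ha cp ler01).
by move=> /(_ (F 1 - F 0)) []; exists F; split=> //; apply/primitive_alongP.
Qed.

End Primitives.

(** * Operations on paths and the cocycle property of integrals *)

Section Paths.
Variables (R : realType) (X : riemann_surface R).
Local Notation C := (Cplx R).
Implicit Types (a b : one_form X) (p q : R -> X).

Lemma clampE (t : R) : clamp t = clampi 0 1 t. Proof. by []. Qed.

Lemma clamp_in (t : R) : 0 <= clamp t <= 1.
Proof. by rewrite clampE clampi_in. Qed.

Lemma clamp_id (t : R) : 0 <= t <= 1 -> clamp t = t.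
Proof. by move=> ht; rewrite clampE clampi_id. Qed.

Lemma clamp0 : clamp (0 : R) = 0. Proof. by rewrite clamp_id // lexx ler01. Qed.
Lemma clamp1 : clamp (1 : R) = 1. Proof. by rewrite clamp_id // lexx ler01. Qed.

Lemma clamp_le0 (t : R) : t <= 0 -> clamp t = 0.
Proof.
by move=> t0; rewrite /clamp; apply/max_idPl; rewrite ge_min t0.
Qed.

Lemma clamp_ge1 (t : R) : 1 <= t -> clamp t = 1.
Proof. by move=> t1; rewrite /clamp (min_idPr t1) (max_idPr _) ?ler01. Qed.

Lemma clampK (t : R) : clamp (clamp t) = clamp t.
Proof. by rewrite clamp_id ?clamp_in. Qed.

Lemma clamp_continuous : continuous (@clamp R).
Proof.
move=> t; apply/continuous_real_dist => e e0; exists e => // s.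
exact: le_lt_trans (clampi_lipschitz _ _ _ _).
Qed.

Lemma lin_continuous (u v : R) : continuous (fun t : R => u + t * v).
Proof.
move=> t; apply: cvgD; first exact: cvg_cst.
by apply: cvgM; [exact: cvg_id|exact: cvg_cst].
Qed.

Lemma continuous_comp2 (T U V : topologicalType) (f : T -> U) (g : U -> V) :
  continuous f -> continuous g -> continuous (g \o f).
Proof. by move=> cf cg t; apply: continuous_comp; [exact: cf|exact: cg]. Qed.

Lemma continuous_pairing (T U V : topologicalType) (f : T -> U) (g : T -> V) :
  continuous f -> continuous g -> continuous (fun t => (f t, g t)).
Proof.
move=> cf cg t W hW.
exact: (@cvg_pair _ _ _ _ _ _ (nbhs_filter t) (nbhs_filter _) (nbhs_filter _) f g (cf t) (cg t) W hW).
Qed.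

(** The piece of [p] from [u] to [v], run backwards when [v < u]; clamping makes it a [path1].
    Integrals over reversed and concatenated paths reduce to such pieces. *)
Definition segment p (u v t : R) : X := p (u + clamp t * (v - u)).

Lemma segment_path1 p u v : continuous p -> path1 (segment p u v).
Proof.
move=> cp; split; last by move=> t; rewrite /segment clampK.
apply: (@continuous_comp2 _ _ _ (fun t => u + clamp t * (v - u)) p) => //.
apply: (@continuous_comp2 _ _ _ (@clamp R) (fun t => u + t * (v - u))).
  exact: clamp_continuous.
exact: lin_continuous.
Qed.

Lemma segment0 p u v : segment p u v 0 = p u.
Proof. by rewrite /segment clamp0 mul0r addr0. Qed.

Lemma segment1E p u v : segment p u v 1 = p v.
Proof. by rewrite /segment clamp1 mul1r addrC subrK. Qed.

Lemma segment01 p : path1 p -> segment p 0 1 = p.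
Proof.
by move=> [_ hp]; apply/funext => t; rewrite /segment add0r subr0 mulr1 -hp.
Qed.

Lemma path_int_segment a p m M F u v : holomorphic_form a -> continuous p ->
  along a p m M F -> m <= u <= M -> m <= v <= M ->
  path_int a (segment p u v) = F v - F u.
Proof.
move=> ha cp hF hu hv; pose f t := u + clamp t * (v - u).
have cf : continuous f.
  apply: (@continuous_comp2 _ _ _ (@clamp R) (fun t => u + t * (v - u))).
    exact: clamp_continuous.
  exact: lin_continuous.
have := @path_int_along _ _ a (p \o f) (F \o f) ha.
rewrite /= /f clamp0 clamp1 mul0r mul1r addr0 [u + (v - u)]addrC subrK; apply.
  exact: continuous_comp2.
apply: (along_reparam cf _ hF) => t _; rewrite /f.
have /andP[t0 t1] := clamp_in t.
have [uv|vu] := leP u v.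
  nra.
nra.
Qed.

(** One continuation over an interval containing [u], [v] and [w] computes all three integrals,
    whatever the order of these points. *)
Lemma path_int_segmentD a p u v w : holomorphic_form a -> continuous p ->
  path_int a (segment p u v) + path_int a (segment p v w) =
  path_int a (segment p u w).
Proof.
move=> ha cp; pose m := Num.min u (Num.min v w); pose M := Num.max u (Num.max v w).
have hu : m <= u <= M by rewrite ge_min le_max !lexx.
have hv : m <= v <= M by rewrite !ge_min !le_max !lexx !orbT.
have hw : m <= w <= M by rewrite !ge_min !le_max !lexx !orbT.
have [|F hF] := @along_exists _ _ a p m M ha cp.
  by case/andP: hu; exact: le_trans.
by rewrite !(path_int_segment ha cp hF) //; ring.
Qed.

Lemma path_int_segment_germ a p u v Phi : holomorphic_form a -> continuous p ->
  (forall t, Num.min u v <= t <= Num.max u v -> primitive_at a (p t) Phi) ->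
  path_int a (segment p u v) = Phi (p v) - Phi (p u).
Proof.
move=> ha cp /along_of_primitive hF.
by rewrite (path_int_segment ha cp hF) // ge_min le_max !lexx ?orbT.
Qed.

Lemma path_int_germ a p Phi : holomorphic_form a -> path1 p ->
  (forall t, 0 <= t <= 1 -> primitive_at a (p t) Phi) ->
  path_int a p = Phi (p 1) - Phi (p 0).
Proof.
by move=> ha [cp _] h; rewrite (path_int_along ha cp (along_of_primitive h)).
Qed.

Lemma path1_le0 p t : path1 p -> t <= 0 -> p t = p 0.
Proof. by move=> [_ hp] t0; rewrite hp clamp_le0. Qed.

Lemma path1_ge1 p t : path1 p -> 1 <= t -> p t = p 1.
Proof. by move=> [_ hp] t1; rewrite hp clamp_ge1. Qed.

Lemma cst_path1 (x : X) : path1 (fun _ : R => x).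
Proof. by split=> // t; exact: cvg_cst. Qed.

Lemma segment_diag p u : segment p u u = fun=> p u.
Proof. by apply/funext => t; rewrite /segment subrr mulr0 addr0. Qed.

Lemma path_int_cst a (x : X) : holomorphic_form a -> path_int a (fun=> x) = 0.
Proof.
move=> ha; have cx : continuous (fun _ : R => x) by move=> t; exact: cvg_cst.
have := path_int_segmentD 0 0 0 ha cx; rewrite segment_diag => /eqP.
by rewrite -subr_eq0 addrK => /eqP.
Qed.

Definition cat_path p q (t : R) : X := if t <= 2^-1 then p (2 * t) else q (2 * t - 1).
Definition rev_path p : R -> X := segment p 1 0.

Lemma paste_continuous (T : topologicalType) (f g : R -> T) (v : R) :
  continuous f -> continuous g -> f v = g v ->
  continuous (fun t => if t <= v then f t else g t).
Proof.
move=> cf cg fg t W /= hW; case: (ltgtP t v) hW => [tv|vt|tv] hW.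
- have := cf t _ hW; apply: filterS2 (lt_nbhsl tv) => s sv hs /=.
  by rewrite ltW.
- have := cg t _ hW; apply: filterS2 (lt_nbhsr vt) => s sv hs /=.
  by rewrite leNgt sv.
- have h2 : nbhs (g t) W by rewrite tv -fg -tv.
  suff : \forall s \near t, W (if s <= v then f s else g s) by [].
  have n1 : \forall s \near t, W (f s) := near_comp (cf t) hW.
  have n2 : \forall s \near t, W (g s) := near_comp (cg t) h2.
  by apply: filterS2 n1 n2 => s ? ?; case: ifP.
Qed.

Lemma cat_path1 p q : path1 p -> path1 q -> p 1 = q 0 -> path1 (cat_path p q).
Proof.
move=> hp hq pq; have [cp ep] := hp; have [cq eq_] := hq; split.
  apply: paste_continuous; last by rewrite mulfV // subrr.
    apply: (@continuous_comp2 R R X (fun t => 2 * t) p) => // t.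
    by apply: cvgM; [exact: cvg_cst|exact: cvg_id].
  apply: (@continuous_comp2 R R X (fun t => 2 * t - 1) q) => // t.
  apply: cvgD; last exact: cvg_cst.
  by apply: cvgM; [exact: cvg_cst|exact: cvg_id].
have h2 : (0 : R) <= 2^-1 by rewrite invr_ge0.
have h3 : ((1 : R) <= 2^-1) = false by apply/negbTE; rewrite -ltNge invf_lt1 // ltr1n.
move=> t; rewrite /cat_path; have [t0|t0] := leP t 0.
  rewrite (clamp_le0 t0) h2 (le_trans t0 h2) mulr0.
  by apply: path1_le0 => //; rewrite pmulr_rle0.
have [t1|t1] := leP t 1; first by rewrite clamp_id // t1 ltW.
rewrite (clamp_ge1 (ltW t1)) h3 leNgt (lt_trans _ t1) ?invf_lt1 ?ltr1n //=.
by rewrite !path1_ge1 //; lra.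
Qed.

Lemma cat_path0 p q : cat_path p q 0 = p 0.
Proof. by rewrite /cat_path invr_ge0 ler0n mulr0. Qed.

Lemma cat_path_end p q : cat_path p q 1 = q 1.
Proof.
rewrite /cat_path leNgt invf_lt1 ?ltr1n //=; congr q; ring.
Qed.

Lemma path_int_cat a p q : holomorphic_form a -> path1 p -> path1 q ->
  p 1 = q 0 -> path_int a (cat_path p q) = path_int a p + path_int a q.
Proof.
move=> ha hp hq pq; have hc := cat_path1 hp hq pq; have [cc _] := hc.
rewrite -{1}(segment01 hc) -(path_int_segmentD 0 2^-1 1 ha cc).
have [_ ep] := hp; have [_ eq_] := hq.
congr (path_int a _ + path_int a _); apply/funext => t; rewrite /segment /cat_path.
  have /andP[t0 t1] := clamp_in t.
  rewrite add0r subr0 ler_pdivrMr // mulVf // t1 mulrCA mulfV // mulr1.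
  by rewrite -ep.
have /andP[t0 t1] := clamp_in t.
have E : clamp t * (1 - 2^-1) = clamp t / 2 by field.
rewrite E gerDl; have [tl|tg] := leP.
  (* At the junction the test [<=] selects [p], whose end is the start of [q]. *)
  have t00 : clamp t = 0 by lra.
  by rewrite eq_ t00 mul0r addr0 mulfV.
by rewrite [RHS]eq_; congr q; field.
Qed.

Lemma rev_path1 p : path1 p -> path1 (rev_path p).
Proof. by move=> [cp _]; exact: segment_path1. Qed.

Lemma rev_path0 p : rev_path p 0 = p 1. Proof. exact: segment0. Qed.
Lemma rev_path_end p : rev_path p 1 = p 0. Proof. exact: segment1E. Qed.

Lemma path_int_rev a p : holomorphic_form a -> path1 p ->
  path_int a (rev_path p) = - path_int a p.
Proof.
move=> ha hp; have [cp _] := hp; apply/eqP; rewrite -addr_eq0 -{2}(segment01 hp).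
by rewrite path_int_segmentD // segment_diag path_int_cst.
Qed.

Section Square.
Variables (a : one_form X) (sigma : R * R -> X).
Hypotheses (ha : holomorphic_form a) (cs : continuous sigma).
Let hor (c u v : R) := path_int a (segment (fun t => sigma (t, c)) u v).
Let ver (c u v : R) := path_int a (segment (fun t => sigma (c, t)) u v).

Let chor c : continuous (fun t => sigma (t, c)).
Proof.
apply: (@continuous_comp2 _ _ _ (fun t : R => (t, c)) sigma) => //.
by apply: continuous_pairing => t; [exact: cvg_id|exact: cvg_cst].
Qed.

Let cver c : continuous (fun t => sigma (c, t)).
Proof.
apply: (@continuous_comp2 _ _ _ (fun t : R => (c, t)) sigma) => //.
by apply: continuous_pairing => t; [exact: cvg_cst|exact: cvg_id].
Qed.

Let loop u v c d := hor c u v + ver v c d = hor d u v + ver u c d.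

Let loop_local x y : exists2 r : R, 0 < r & forall u v c d,
  u <= x <= v -> c <= y <= d -> v - u < r -> d - c < r -> loop u v c d.
Proof.
have [Phi hPhi] := primitive_exists (sigma (x, y)) ha.
have := near_comp (@cs (x, y)) hPhi => /nbhs_ballP[r /= r0 hr].
exists r => // u v c d hu hc uv cd.
have prim s t : u <= s <= v -> c <= t <= d -> primitive_at a (sigma (s, t)) Phi.
  move=> hs ht; apply: (hr (s, t)); split; rewrite /= -ball_normE /= ltr_norml; lra.
have uv' : u <= v by lra.
have cd' : c <= d by lra.
have Jh w : c <= w <= d -> hor w u v = Phi (sigma (v, w)) - Phi (sigma (u, w)).
  move=> hw; apply: path_int_segment_germ; [by []|by []|].
  by rewrite (min_idPl uv') (max_idPr uv') => t ht; exact: prim.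
have Jv w : u <= w <= v -> ver w c d = Phi (sigma (w, d)) - Phi (sigma (w, c)).
  move=> hw; apply: path_int_segment_germ; [by []|by []|].
  by rewrite (min_idPl cd') (max_idPr cd') => t ht; exact: prim.
by rewrite /loop !Jh ?Jv ?lexx ?uv' ?cd' //; ring.
Qed.

(** The relation adds up when squares are stacked, and the image of a small square lies in the
    domain of one primitive. The map [sigma] is only continuous, so this replaces Stokes'
    theorem. *)
Lemma path_int_square u v c d : u <= v -> c <= d -> loop u v c d.
Proof.
move=> uv cd; apply: (cousin1 (Q := fun u v => loop u v c d) uv) => [x y z _|x _].
  rewrite /loop /hor -!(path_int_segmentD x y z ha (@chor _)) -!/(hor _ _ _) => h1 h2.
  by rewrite -addrA h2 addrCA h1; ring.
(* The outer induction needs at [x] a width valid over the whole height [[c, d]]; the inner one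
   carries the existence of such a width, taking minima. *)
apply: (cousin1 (Q := fun c d => exists2 r : R, 0 < r & forall u' v', u <= u' -> v' <= v ->
  u' <= x <= v' -> v' - u' < r -> loop u' v' c d) cd) => [r s t _ [d1 d10 h1] [d2 d20 h2]|y _].
  exists (Num.min d1 d2); first by rewrite lt_min d10.
  move=> u' v' hu hv hx; rewrite lt_min => /andP[m1 m2].
  have {}h1 := h1 _ _ hu hv hx m1; have {}h2 := h2 _ _ hu hv hx m2; move: h1 h2.
  rewrite /loop /ver -!(path_int_segmentD r s t ha (@cver _)) -!/(ver _ _ _) => h1 h2.
  by rewrite addrA h1 addrAC h2; ring.
have [r r0 hr] := loop_local x y; exists r => // c' d' _ _ hy m.
by exists r => // u' v' _ _ hx m'; apply: hr.
Qed.

End Square.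

Lemma path_int_cocycle a s : holomorphic_form a -> simplex2 s ->
  path_int a (face0 s) - path_int a (face1 s) + path_int a (face2 s) = 0.
Proof.
move=> ha cs.
(* The square is collapsed onto the triangle, its top edge going to the vertex [(0, 1)]. As [tau]
   lands in the triangle, where [s] is continuous, [s \o tau] is continuous everywhere. *)
pose tau (u : R * R) : R * R := (clamp u.1 * (1 - clamp u.2), clamp u.2).
have tau_in u : triangle (tau u).
  rewrite /triangle /tau /=; have /andP[? ?] := clamp_in u.1.
  by have /andP[? ?] := clamp_in u.2; split; nra.
have c1 : continuous (fun u : R * R => clamp u.1).
  apply: (@continuous_comp2 _ _ _ fst (@clamp R)); last exact: clamp_continuous.
  by move=> u; exact: cvg_fst.
have c2 : continuous (fun u : R * R => clamp u.2).
  apply: (@continuous_comp2 _ _ _ snd (@clamp R)); last exact: clamp_continuous.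
  by move=> u; exact: cvg_snd.
have ctau : continuous tau.
  apply: continuous_pairing => //= u; apply: cvgM; first exact: c1.
  by apply: cvgB; [exact: cvg_cst|exact: c2].
have csigma : continuous (s \o tau).
  move=> u W hW.
  have /subspace_continuousP/(_ _ (tau_in u)) := cs.
  move=> /(_ W hW); rewrite /= nbhs_filterE /within /= => h.
  have h' : \forall v \near tau u, triangle v -> W (s v) by [].
  suff : \forall v \near u, W (s (tau v)) by [].
  by apply: filterS (near_comp (ctau u) h') => v; apply; exact: tau_in.
have := path_int_square ha csigma ler01 ler01.
have -> : segment (fun t => (s \o tau) (t, 0)) 0 1 = face2 s.
  apply/funext => t; rewrite /segment /= /tau /= !add0r !subr0 !mulr1 clampK clamp0.
  by rewrite subr0 mulr1.
have -> : segment (fun t => (s \o tau) (1, t)) 0 1 = face0 s.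
  by apply/funext => t; rewrite /segment /= /tau /= !add0r !subr0 !mulr1 clampK clamp1 mul1r.
have -> : segment (fun t => (s \o tau) (t, 1)) 0 1 = fun=> s (0, 1).
  by apply/funext => t; rewrite /segment /= /tau /= clamp1 subrr mulr0.
have -> : segment (fun t => (s \o tau) (0, t)) 0 1 = face1 s.
  by apply/funext => t; rewrite /segment /= /tau /= !add0r !subr0 !mulr1 clampK clamp0 mul0r.
by rewrite path_int_cst // add0r => <-; ring.
Qed.

End Paths.

Section FormSpace.
Variables (R : realType) (X : riemann_surface R).
Local Notation C := (Cplx R).
Implicit Types (a b : one_form X) (p q : R -> X).

Lemma holomorphic_form0 : holomorphic_form ((fun _ _ => 0) : one_form X).
Proof.
by split=> // i j z _; rewrite mul0r.
Qed.

Lemma holomorphic_form_lin a b (c : C) : holomorphic_form a -> holomorphic_form b ->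
  holomorphic_form (fun i z => a i z + c * b i z).
Proof.
move=> [za da ta] [zb db tb]; split=> [i z hz|i z hz|i j z hz].
- by rewrite za // zb // mulr0 addr0.
- have /derivableP_cder[u hu] := da i z hz; have /derivableP_cder[v hv] := db i z hz.
  by apply/derivableP_cder; exists (u + c * v); apply: cderD => //; exact: cderZ.
- by rewrite (ta i j z hz) (tb i j z hz) mulrA -mulrDl.
Qed.

Lemma path_int_lin a b (c : C) p : holomorphic_form a -> holomorphic_form b ->
  path1 p -> path_int (fun i z => a i z + c * b i z) p = path_int a p + c * path_int b p.
Proof.
move=> ha hb [cp _].
have [F hF] := along_exists ha cp ler01; have [G hG] := along_exists hb cp ler01.
rewrite (path_int_along ha cp hF) (path_int_along hb cp hG).
by rewrite (path_int_along (holomorphic_form_lin c ha hb) cp (along_lin c ha hb hF hG)); ring.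
Qed.

Lemma path_int0 p : path1 p -> path_int ((fun _ _ => 0) : one_form X) p = 0.
Proof.
move=> hp; have h0 := holomorphic_form0.
have := path_int_lin 1 h0 h0 hp; rewrite mul1r.
have -> : (fun (i : chart X) (z : C) => 0 + 0 : C) = (fun _ _ => 0).
  by apply/funext => i; apply/funext => z; rewrite addr0.
by rewrite mul1r => /eqP; rewrite -subr_eq0 opprD addrA subrr add0r oppr_eq0 => /eqP.
Qed.

Definition form_sum n (e : 'I_n -> one_form X) (c : 'I_n -> C) : one_form X :=
  fun i z => \sum_k c k * e k i z.

Section FormSum.
Variables (n : nat) (e : 'I_n -> one_form X).
Hypothesis he : forall k, holomorphic_form (e k).

Let seq_form (r : seq 'I_n) (c : 'I_n -> C) : one_form X :=
  fun i z => \sum_(k <- r) c k * e k i z.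

Let seq_formS k r c : seq_form (k :: r) c =
  (fun i z => seq_form r c i z + c k * e k i z).
Proof.
by apply/funext => i; apply/funext => z; rewrite /seq_form big_cons addrC.
Qed.

Let seq_form0 c : seq_form [::] c = fun _ _ => 0.
Proof. by apply/funext => i; apply/funext => z; rewrite /seq_form big_nil. Qed.

Let holomorphic_seq_form r c : holomorphic_form (seq_form r c).
Proof.
elim: r => [|k r IH]; first by rewrite seq_form0; exact: holomorphic_form0.
by rewrite seq_formS; exact: holomorphic_form_lin.
Qed.

Lemma holomorphic_form_sum c : holomorphic_form (form_sum e c).
Proof. exact: holomorphic_seq_form. Qed.

Lemma path_int_form_sum c p : path1 p ->
  path_int (form_sum e c) p = \sum_k c k * path_int (e k) p.
Proof.
move=> hp; rewrite -[form_sum e c]/(seq_form _ c).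
elim: (index_enum _) => [|k r IH]; first by rewrite seq_form0 path_int0 // big_nil.
by rewrite seq_formS path_int_lin // IH big_cons addrC.
Qed.

End FormSum.

Lemma holomorphic_scale a (c : C) : holomorphic_form a -> holomorphic_form (scale_form c a).
Proof.
move=> ha; have := holomorphic_form_lin c holomorphic_form0 ha.
by congr holomorphic_form; apply/funext => i; apply/funext => z; rewrite add0r.
Qed.

Lemma path_int_scale a (c : C) p : holomorphic_form a -> path1 p ->
  path_int (scale_form c a) p = c * path_int a p.
Proof.
move=> ha hp; have := path_int_lin c holomorphic_form0 ha hp.
rewrite path_int0 // add0r => <-; congr path_int.
by apply/funext => i; apply/funext => z; rewrite add0r.
Qed.

End FormSpace.

(** * Connectedness, and forms whose real periods vanish *)

Section Connectedness.
Variables (R : realType) (X : riemann_surface R).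
Local Notation C := (Cplx R).
Implicit Types (a : one_form X) (p q : R -> X).

Lemma connected_local (T : topologicalType) (B : set T) (x0 : T) :
  connected [set: T] -> (forall x, \forall y \near x, B y <-> B x) ->
  B x0 -> forall x, B x.
Proof.
move=> cT loc B0 x.
have op (D : set T) : (forall x, \forall y \near x, D y <-> D x) -> open D.
  move=> hD; rewrite openE => y Dy.
  by apply: filterS (hD y) => w [_]; apply.
suff -> : B = [set: T] by [].
apply: cT; first by exists x0.
  by exists B; [exact: op|rewrite setTI].
exists B; last by rewrite setTI.
rewrite -[B]setCK closedC; apply: op => y.
by apply: filterS (loc y) => w [h1 h2]; split=> nw b; apply: nw; [exact: h2|exact: h1].
Qed.

Lemma point_near i (x : X) (P : X -> Prop) : dom i x ->
  (\forall y \near x, P y) -> \forall w \near coord i x, P (point i w).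
Proof.
move=> ix hP; have cp : {for coord i x, continuous (point (r := X) i)}.
  by apply: point_continuous; exists x.
by apply: near_comp cp _; rewrite coordK.
Qed.

(** The path is a straight segment in a chart, short enough for its image to stay in [W]. *)
Lemma short_path (x : X) (W : set X) : nbhs x W -> \forall y \near x,
  exists p, [/\ path1 p, p 0 = x, p 1 = y & forall t, W (p t)].
Proof.
move=> hW; have [i ix] := dom_cover x.
have hW' := point_near ix hW.
have : \forall z \near coord i x, W (point i z) /\ (coord i @` dom i) z.
  exact: filterI hW' (coord_image_nbhs ix).
move=> /near_n1P[r r0 hr].
have near_r : \forall y \near x, n1 (coord i y - coord i x) < r.
  have : nbhs (coord i x) [set w | n1 (w - coord i x) < r] by apply/near_n1P; exists r.
  exact: near_comp (coord_continuous ix).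
near=> y; have iy : dom i y by near: y; exact: dom_nbhs.
have hy : n1 (coord i y - coord i x) < r by near: y.
pose g (t : R) := coord i x + rcplx (clamp t) * (coord i y - coord i x).
have gr t : n1 (g t - coord i x) < r by apply: segment_ball hy; exact: clamp_in.
exists (point i \o g); split.
- split; last by move=> t; rewrite /= /g clampK.
  move=> t; apply: continuous_comp; last by apply: point_continuous; exact: (hr _ (gr t)).2.
  apply: (@continuous_comp2 _ _ _ (@clamp R)
    (fun s => coord i x + rcplx s * (coord i y - coord i x))).
    exact: clamp_continuous.
  move=> s; apply: (cvg_n1P (F := nbhs s) _ _).2 => eps eps0.
  have k0 : 0 < n1 (coord i y - coord i x) + 1 by rewrite ltr_wpDl ?n1_ge0.
  apply/near_realP; exists (eps / (n1 (coord i y - coord i x) + 1)); first by rewrite divr_gt0.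
  move=> u hu.
  have -> : coord i x + rcplx u * (coord i y - coord i x) -
    (coord i x + rcplx s * (coord i y - coord i x)) = rcplx (u - s) * (coord i y - coord i x).
    by rewrite rcplxD rcplxN; ring.
  rewrite n1_rcplxM; move: hu; rewrite ltr_pdivlMr //; apply: le_lt_trans.
  by rewrite ler_wpM2l // lerDl.
- by rewrite /= /g clamp0 rcplx0 mul0r addr0 coordK.
- by rewrite /= /g clamp1 segment1 coordK.
- by move=> t; exact: (hr _ (gr t)).1.
Unshelve. all: by end_near. Qed.

Lemma path_connected (x y : X) : connected [set: X] ->
  exists p, [/\ path1 p, p 0 = x & p 1 = y].
Proof.
move=> cX; apply: (connected_local (B := fun y => exists p, [/\ path1 p, p 0 = x & p 1 = y])
   (x0 := x) cX); last first.
  by exists (fun=> x); split=> //; exact: cst_path1.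
move=> z; have zT : nbhs z [set: X] by exact: filterT.
apply: (filterS _ (short_path zT)) => w [q [hq q0 q1 _]].
split=> -[p [hp p0 p1]].
  exists (cat_path p (rev_path q)); split.
  - by apply: cat_path1 => //; [exact: rev_path1|rewrite p1 rev_path0 q1].
  - by rewrite cat_path0.
  - by rewrite cat_path_end rev_path_end.
exists (cat_path p q); split.
- by apply: cat_path1; rewrite // p1 q0.
- by rewrite cat_path0.
- by rewrite cat_path_end.
Qed.

(* The real part of a primitive is a single-valued harmonic function, which is
   constant by the maximum principle. *)
Lemma real_exact_form_eq0 a : compact [set: X] -> connected [set: X] ->
  holomorphic_form a ->
  (forall p, path1 p -> p 0 = p 1 -> re (path_int a p) = 0) -> a = fun _ _ => 0.
Proof.
move=> kX cX ha loops; apply/funext => i0; apply/funext => z0.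
have [[x0 ix0 zx0]|nz] := pselect ((coord i0 @` dom i0) z0); last by case: ha => h _ _; exact: h.
have /choice[P hP] : forall y : X, exists p, [/\ path1 p, p 0 = x0 & p 1 = y].
  by move=> y; exact: path_connected.
pose u (y : X) := re (path_int a (P y)).
(* [P y], then [p], then [P y'] backwards form a loop, so [u] does not depend on the chosen
   paths. *)
have uE p y y' : path1 p -> p 0 = y -> p 1 = y' -> u y' - u y = re (path_int a p).
  move=> hp p0 p1; have [hy y0 y1] := hP y; have [hy' y0' y1'] := hP y'.
  have c1 : path1 (cat_path (P y) p) by apply: cat_path1; rewrite // y1.
  have := loops (cat_path (cat_path (P y) p) (rev_path (P y'))).
  rewrite !path_int_cat ?path_int_rev ?rev_path0 ?cat_path_end ?y1 ?p0 ?p1 ?y1' //; last exact: rev_path1.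
  rewrite !cat_path0 rev_path_end y0 y0' !cE => H.
  have {H} E : re (path_int a (P y)) + re (path_int a p) - re (path_int a (P y')) = 0.
    by apply: H => //; apply: cat_path1 => //; [exact: rev_path1|rewrite cat_path_end p1 rev_path0].
  rewrite /u; lra.
(* Compared along short paths inside the domain of one germ, [u] is near [x] the real part of a
   primitive up to a constant. *)
have uPhi x : exists2 Phi, primitive_at a x Phi &
    \forall y \near x, u y - u x = re (Phi y) - re (Phi x).
  have [Phi hPhi] := primitive_exists x ha; exists Phi; first exact: nbhs_singleton hPhi.
  have := short_path hPhi; apply: filterS => y [q [hq q0 q1 hqW]].
  by rewrite (uE q x y hq q0 q1) (path_int_germ ha hq (Phi := Phi)) // !cE q0 q1.
have uchart i x : dom i x -> exists Q, exists2 r : R, 0 < r & forall w, n1 (w - coord i x) < r ->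
    [/\ (coord i @` dom i) w, cder Q w (a i w), (exists b, cder (a i) w b) &
        u (point i w) = re (Q w)].
  move=> ix; have [Phi hPhi hu] := uPhi x.
  have [Q [hQ eQ]] := primitive_at_chart ha hPhi ix.
  have hu' := point_near ix hu; have eQ' := point_near ix eQ.
  have : \forall w \near coord i x, (u (point i w) - u x = re (Phi (point i w)) - re (Phi x) /\
      Phi (point i w) = Q (coord i (point i w))) /\ cder Q w (a i w) /\ (coord i @` dom i) w.
    exact: filterI (filterI hu' eQ') (filterI hQ (coord_image_nbhs ix)).
  move=> /near_n1P[r r0 hr].
  exists (fun w => Q w + rcplx (u x - re (Phi x))), r => // w /hr[[h1 h2] [h3 h4]].
  split=> //; first exact: cderDc.
    by case: ha => _ d _; apply/derivableP_cder; exact: d.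
  case: h4 h1 h2 => y iy <-; rewrite coordK // => h1 h2; rewrite !cE -h2; lra.
have cu : continuous u.
  move=> x; have [i ix] := dom_cover x; have [Q [r r0 hQ]] := uchart i x ix.
  have h0 : n1 (coord i x - coord i x) < r by rewrite subrr n10.
  have [_ dQ _ eQ] := hQ _ h0; rewrite coordK // in eQ.
  apply/cvgrPdist_lt => eps eps0; have [d d0 hd] := cder_cont dQ eps0.
  have near_r : \forall y \near x, n1 (coord i y - coord i x) < Num.min d r.
    have : nbhs (coord i x) [set w | n1 (w - coord i x) < Num.min d r].
      by apply/near_n1P; exists (Num.min d r) => //; rewrite lt_min d0.
    exact: near_comp (coord_continuous ix).
  apply: filterS2 near_r (dom_nbhs ix) => y; rewrite lt_min => /andP[y1 /hQ[_ _ _ y2]] iy.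
  rewrite coordK // in y2; rewrite y2 eQ distrC.
  by apply: le_lt_trans (hd _ y1); apply: le_trans _ (re_le_n1 _); rewrite !cE.
have [|m _ hm] := compact_EVT_max _ kX (continuous_subspaceT cu); first by exists x0.
have {}hm y : u y <= u m by apply: hm; rewrite inE.
(* The set where [u] attains its maximum is open by the maximum principle, and closed by
   continuity. *)
have um : forall y, u y = u m.
  apply: (connected_local (B := fun y => u y = u m) (x0 := m) cX) => // x.
  have [ux|ux] := pselect (u x = u m); last first.
    have ltu : u x < u m by rewrite lt_neqAle hm andbT; apply/eqP.
    have : \forall y \near x, u y < u m by exact: near_comp (cu x) (lt_nbhsl ltu).
    by apply: filterS => y; rewrite lt_neqAle => /andP[/eqP ? _]; split.
  have [i ix] := dom_cover x; have [Q [r r0 hQ]] := uchart i x ix.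
  have h0 : n1 (coord i x - coord i x) < r by rewrite subrr n10.
  have [_ _ _ eQ] := hQ _ h0; rewrite coordK // in eQ.
  have cst := @maximum_principle R Q (a i) (coord i x) r r0 (fun w hw => let: And4 _ h _ _ := hQ w hw in h)
    (fun w hw => let: And4 _ _ h _ := hQ w hw in h).
  have near_r : \forall y \near x, n1 (coord i y - coord i x) < r / 6.
    have : nbhs (coord i x) [set w | n1 (w - coord i x) < r / 6].
      by apply/near_n1P; exists (r / 6) => //; rewrite divr_gt0.
    exact: near_comp (coord_continuous ix).
  apply: filterS2 near_r (dom_nbhs ix) => y hy iy; split=> // _.
  have yr : n1 (coord i y - coord i x) < r by apply: lt_trans hy _; lra.
  have [_ _ _ ey] := hQ _ yr; rewrite coordK // in ey.
  rewrite ey cst //; first by rewrite -eQ.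
  by move=> w /hQ[_ _ _ <-]; rewrite -eQ ux; exact: hm.
have [Q [r r0 hQ]] := uchart i0 x0 ix0; rewrite zx0 in hQ.
have h0 : n1 (z0 - z0) < r by rewrite subrr n10.
have [_ dQ _ eQ] := hQ _ h0.
apply: (constant_re_der0 r0 _ dQ) => w /hQ[_ _ _ <-].
by rewrite -eQ !um.
Qed.

End Connectedness.

Section ComplexExponential.
Variable R : realType.
Local Notation C := (Cplx R).

Lemma sin_intpi (n : int) : sin (n%:~R * pi) = 0 :> R.
Proof.
have nat_ m : sin (m%:R * pi) = 0 :> R.
  have := alternatingn (@sinDpi R) m 0.
  by rewrite add0r sin0 mulr0 -[pi *+ m]mulr_natl.
case: n => n; first by rewrite -pmulrn nat_.
by rewrite NegzE mulrNz -pmulrn mulNr sinN nat_ oppr0.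
Qed.

Lemma sin_eq0P (x : R) : sin x = 0 -> exists n : int, x = n%:~R * pi.
Proof.
move=> sx; have pi0 := pi_gt0 R; set n := Num.floor (x / pi).
exists n; apply/eqP; rewrite -subr_eq0; set y := _ - _.
have /andP[n1 n2] := floor_itv (x / pi); rewrite -/n in n1 n2.
have y0 : 0 <= y by rewrite subr_ge0 -ler_pdivlMr.
have ypi : y < pi.
  by rewrite ltrBlDr -[X in X + _]mul1r -mulrDl addrC -ltr_pdivrMr //; move: n2; rewrite intrD.
have sy : sin y = 0 by rewrite sinB sx sin_intpi mul0r mulr0 subrr.
apply/eqP/le_anti; rewrite y0 andbT leNgt; apply/negP => y1.
by have := @sin_gt0_pi R y; rewrite y1 ypi sy ltxx => /(_ isT).
Qed.

Lemma cexp_realP (z : C) : (exists r, cexp z = rcplx r) <-> exists n : int, im z = n%:~R * pi.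
Proof.
split=> [[r /(congr1 (@im R))]|[n hn]].
  rewrite /cexp !cE mul0r addr0 => /eqP; rewrite mulf_eq0 gt_eqF ?expR_gt0 //= => /eqP.
  exact: sin_eq0P.
exists (expR (re z) * cos (im z)); apply: cplx_ext; rewrite /cexp !cE ?mul0r ?subr0 //.
by rewrite hn sin_intpi mulr0 addr0.
Qed.

Lemma cexp_eq1 (z : C) : cexp z = 1 -> exists n : int, z = n%:~R * two_pi_i.
Proof.
move=> h; have /(congr1 (@re R)) := h; have /(congr1 (@im R)) := h.
rewrite /cexp !cE !mul0r subr0 addr0; set e := expR _; set y := im z => h2 h1.
have e0 : 0 < e := expR_gt0 _.
have cy : e = 1.
  have : e ^+ 2 = 1.
    have -> : e ^+ 2 = (e * cos y) ^+ 2 + (e * sin y) ^+ 2.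
      by rewrite !exprMn -mulrDr cos2Dsin2 mulr1.
    by rewrite h1 h2 expr1n expr0n addr0.
  by move/eqP; rewrite sqrf_eq1 => /orP[/eqP //|/eqP e1]; lra.
rewrite cy mul1r in h1.
have rz : re z = 0 by apply: expR_inj; rewrite -/e cy expR0.
(* The half angle turns [cos y = 1] into [sin (y / 2) = 0], so the period found is [2 * pi] and not
   [pi]. *)
have [n hn] : exists n : int, y / 2 = n%:~R * pi.
  apply: sin_eq0P; apply/eqP; rewrite -sqrf_eq0.
  have := cos2Dsin2 (y / 2); have := cosD (y / 2) (y / 2).
  rewrite -splitr h1; nra.
exists n; apply: cplx_ext; rewrite /two_pi_i -(rcplx_int R n) -[2]/(2%:R) -[2%:R]/(2%:~R) -(rcplx_int R 2) !cE.
  by rewrite rz; ring.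
rewrite -/y; apply: (mulIf (x := 2^-1)); first by rewrite invr_eq0.
by rewrite hn; field.
Qed.

End ComplexExponential.

(** * Cohomology, harmonic forms and monodromy *)

Section Chains.
Variables (R : realType) (X : riemann_surface R).
Local Notation C := (Cplx R).

(** A chain may list a simplex several times; once equal entries are collected, vanishing
    coefficients kill every evaluation. *)
Lemma weighted_sum_eq0 (T : eqType) (V : zmodType) (F : T -> V) (c : seq (int * T)) :
  (forall p, \sum_(y <- c | y.2 == p) y.1 = 0) -> \sum_(y <- c) F y.2 *~ y.1 = 0.
Proof.
move=> hc; pose r := undup [seq y.2 | y <- c].
have -> : \sum_(y <- c) F y.2 *~ y.1 = \sum_(y <- c) \sum_(p <- r | p == y.2) F p *~ y.1.
  apply: eq_big_seq => y yc; rewrite -big_filter.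
  have -> : [seq p <- r | p == y.2] = [:: y.2].
    by apply: filter_pred1_uniq; [exact: undup_uniq|rewrite mem_undup map_f].
  by rewrite big_seq1.
rewrite (exchange_big_dep xpredT) //= big1 // => p _.
rewrite -[RHS](mulr0z (F p)) -(hc p) mulrz_sumr.
by apply: eq_bigl => y; rewrite eq_sym.
Qed.

Definition chain_val (V : zmodType) (D : (R -> X) -> V) (c : chain X) : V :=
  \sum_(y <- c) D y.2 *~ y.1.

Section ChainVal.
Variables (V : zmodType) (D : (R -> X) -> V).

Lemma chain_val_sub c c' : chain_val D (chain_sub c c') = chain_val D c - chain_val D c'.
Proof.
rewrite /chain_val big_cat big_map /= -sumrN; congr (_ + _).
by apply: eq_bigr => y _; rewrite mulrNz.
Qed.

Lemma chain_val_comb n (m : 'I_n -> int) (b : 'I_n -> chain X) :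
  chain_val D (chain_comb m b) = \sum_k chain_val D (b k) *~ m k.
Proof.
rewrite /chain_val big_flatten big_map big_enum /=; apply: eq_bigr => k _.
rewrite big_map mulrz_suml; apply: eq_bigr => y _ /=.
by rewrite mulrC mulrzA.
Qed.

Lemma chain_val_coeff c c' : (forall p, coeff c p = coeff c' p) ->
  chain_val D c = chain_val D c'.
Proof.
move=> h; apply/eqP; rewrite -subr_eq0 -chain_val_sub; apply/eqP.
apply: weighted_sum_eq0 => p; rewrite big_cat big_map /= sumrN.
by have := h p; rewrite /coeff => ->; rewrite subrr.
Qed.

Lemma chain_val_boundary c :
  (forall s, simplex2 s -> D (face0 s) - D (face1 s) + D (face2 s) = 0) ->
  boundary c -> chain_val D c = 0.
Proof.
move=> hD [s [hs hc]].
pose f (y : int * (R * R -> X)) : chain X :=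
  [:: (y.1, face0 y.2); (- y.1, face1 y.2); (y.1, face2 y.2)].
rewrite (@chain_val_coeff c (flatten [seq f y | y <- s])).
  rewrite /chain_val big_flatten big_map big_seq big1 // => y /hs hy.
  by rewrite !big_cons big_nil /= mulrNz addr0 addrA -mulrzBl -mulrzDl hD // mul0rz.
move=> p; rewrite hc /coeff big_flatten big_map; apply: eq_bigr => y _.
rewrite !big_cons big_nil /= /delta.
have E (q : R -> X) : (q == p) = `[< q = p >] by apply/eqP/asboolP.
by rewrite !E; do 3 case: ifP => _; ring.
Qed.

Lemma chain_val_basis n (b : 'I_n -> chain X) c (m : 'I_n -> int) :
  (forall s, simplex2 s -> D (face0 s) - D (face1 s) + D (face2 s) = 0) ->
  boundary (chain_sub c (chain_comb m b)) ->
  chain_val D c = \sum_k chain_val D (b k) *~ m k.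
Proof.
move=> hD /(chain_val_boundary hD)/eqP.
by rewrite chain_val_sub subr_eq0 chain_val_comb => /eqP.
Qed.

Lemma chain_val_loop p : chain_val D [:: (1, p)] = D p.
Proof. by rewrite /chain_val big_seq1. Qed.

End ChainVal.

Lemma loop_cycle (p : R -> X) : path1 p -> p 0 = p 1 -> cycle1 [:: (1, p)].
Proof.
move=> hp p01; split=> [y|x]; first by rewrite inE => /eqP ->.
by rewrite big_seq1 /= p01 subrr mulr0.
Qed.

(** The end points, counted with sign and multiplicity, form a formal sum of points whose
    coefficients are those that [cycle1] makes vanish. *)
Lemma chain_val_coboundary (V : zmodType) (f : X -> V) c : cycle1 c ->
  chain_val (fun p => f (p 1) - f (p 0)) c = 0.
Proof.
move=> [_ hc].
pose w := [seq (y.1, y.2 1) | y <- c] ++ [seq (- y.1, y.2 0) | y <- c].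
have -> : chain_val (fun p => f (p 1) - f (p 0)) c = \sum_(y <- w) f y.2 *~ y.1.
  rewrite big_cat !big_map /= -big_split; apply: eq_bigr => y _ /=.
  by rewrite mulrzBl mulrNz.
apply: weighted_sum_eq0 => x; rewrite -[RHS](hc x) big_cat !big_map /=.
rewrite big_mkcond [X in _ + X]big_mkcond -big_split; apply: eq_bigr => y _ /=.
rewrite /delta; have E (q : X) : (q == x) = `[< q = x >] by apply/eqP/asboolP.
by rewrite !E; do 2 case: ifP => _; ring.
Qed.

(** The potential at [y] is the value of [D] on a chosen path [P y] from a base point. As a chain,
    [p + P (p 0) - P (p 1)] is a cycle, so the three values sum to zero. *)
Lemma exact_of_cycles (V : zmodType) (D : (R -> X) -> V) : connected [set: X] ->
  (forall c, cycle1 c -> chain_val D c = 0) ->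
  exists f : X -> V, forall p, path1 p -> D p = f (p 1) - f (p 0).
Proof.
move=> cX h; have [[x0 _]|nX] := pselect (exists x : X, True); last first.
  by exists (fun=> 0) => p; case: nX; exists (p 0).
have /choice[P hP] : forall y : X, exists p, [/\ path1 p, p 0 = x0 & p 1 = y].
  by move=> y; exact: path_connected.
exists (fun y => D (P y)) => p hp.
have [h1 h10 h11] := hP (p 1); have [h0 h00 h01] := hP (p 0).
have : chain_val D [:: (1, p); (1, P (p 0)); (-1, P (p 1))] = 0.
  apply: h; split=> [y|x].
    by rewrite !inE => /or3P[] /eqP ->.
  by rewrite !big_cons big_nil /= h10 h11 h00 h01; ring.
rewrite /chain_val !big_cons big_nil /= !mulr1z addr0 mulrN1z.
by move=> E; apply/eqP; rewrite -subr_eq0 opprB E.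
Qed.

End Chains.

Section CurveCohomology.
Variables (R : realType) (X : riemann_surface R).
Local Notation C := (Cplx R).
Implicit Types (a : one_form X) (p : R -> X).
Hypotheses (kX : compact [set: X]) (cX : connected [set: X]).

Lemma re_chain_val (D : (R -> X) -> C) (c : chain X) :
  re (chain_val D c) = chain_val (fun p => re (D p)) c.
Proof.
rewrite /chain_val; elim: c => [|y c IH]; first by rewrite !big_nil.
by rewrite !big_cons reD IH -mulrzl -rcplx_int reM re_rcplx im_rcplx mul0r subr0 mulrzl.
Qed.

Lemma chain_valZ (D : (R -> X) -> R) (k : R) (c : chain X) :
  k * chain_val D c = chain_val (fun p => k * D p) c.
Proof. by rewrite /chain_val mulr_sumr; apply: eq_bigr => y _; rewrite mulrzAr. Qed.

Lemma chain_valB (V : zmodType) (D E : (R -> X) -> V) (c : chain X) :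
  chain_val (fun p => D p - E p) c = chain_val D c - chain_val E c.
Proof.
by rewrite /chain_val -sumrB; apply: eq_bigr => y _; rewrite mulrzBl.
Qed.

Lemma eq_chain_val (V : zmodType) (D E : (R -> X) -> V) (c : chain X) :
  (forall p, path1 p -> D p = E p) -> cycle1 c -> chain_val D c = chain_val E c.
Proof. by move=> h [hc _]; apply: eq_big_seq => y /hc /h ->. Qed.

Definition real_int a p : R := 2 * re (path_int a p).

Lemma real_intE a p : path_int a p + (path_int a p)^* = rcplx (real_int a p).
Proof. by apply: cplx_ext; rewrite /real_int !cE; ring. Qed.

Lemma real_int_cocycle a s : holomorphic_form a -> simplex2 s ->
  real_int a (face0 s) - real_int a (face1 s) + real_int a (face2 s) = 0.
Proof.
move=> ha hs; have /(congr1 (@re R)) := path_int_cocycle ha hs.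
by rewrite !cE /real_int => h; rewrite -mulrBr -mulrDr h mulr0.
Qed.

Lemma real_int_cyclesE a c : chain_val (real_int a) c = 2 * re (chain_int a c).
Proof. by rewrite [re _]re_chain_val chain_valZ. Qed.

Lemma real_int_eq0 a : holomorphic_form a ->
  (forall p, path1 p -> p 0 = p 1 -> real_int a p = 0) -> a = fun _ _ => 0.
Proof.
move=> ha h; apply: real_exact_form_eq0 => // p hp p01; have := h p hp p01.
by move=> /eqP; rewrite mulf_eq0 pnatr_eq0 /= => /eqP.
Qed.

Variables (g : nat) (e : 'I_g -> one_form X).
Hypothesis basis : form_basis e.
Variable b : 'I_g.*2 -> chain X.
Hypothesis b_cycle : forall k, cycle1 (b k).
Hypothesis b_basis : forall c, cycle1 c ->
  exists! m : {ffun 'I_g.*2 -> int}, boundary (chain_sub c (chain_comb m b)).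

Let he k : holomorphic_form (e k). Proof. by case: basis. Qed.

Definition real_form (i : 'I_(g + g)) : one_form X :=
  match fintype.split i with inl k => e k | inr k => scale_form 'i (e k) end.

Lemma real_form_holomorphic i : holomorphic_form (real_form i).
Proof. by rewrite /real_form; case: fintype.split => k //; exact: holomorphic_scale. Qed.

Definition real_comb (x : 'rV[R]_(g + g)) : one_form X :=
  form_sum real_form (fun i => rcplx (x 0 i)).

Lemma real_combE x : real_comb x =
  form_sum e (fun k => cplx (x 0 (lshift g k)) (x 0 (rshift g k))).
Proof.
apply/funext => i; apply/funext => z; rewrite /real_comb /form_sum big_split_ord /=.
rewrite -big_split; apply: eq_bigr => k _ /=.
rewrite /real_form (unsplitK (inl k)) (unsplitK (inr k)) /scale_form mulrA -mulrDl.
by congr (_ * _); apply: cplx_ext; rewrite !cE; ring.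
Qed.

Lemma real_comb_holomorphic x : holomorphic_form (real_comb x).
Proof. exact: holomorphic_form_sum real_form_holomorphic _. Qed.

Lemma chain_int_form_sum n (f : 'I_n -> one_form X) (c : 'I_n -> C) ch :
  (forall k, holomorphic_form (f k)) -> cycle1 ch ->
  chain_int (form_sum f c) ch = \sum_k c k * chain_int (f k) ch.
Proof.
move=> hf [hc _]; rewrite /chain_int.
under [RHS]eq_bigr do rewrite mulr_sumr.
rewrite exchange_big /=; apply: eq_big_seq => y /hc hy.
rewrite path_int_form_sum // mulrz_suml; apply: eq_bigr => k _.
by rewrite mulrzAr.
Qed.

Definition period_matrix : 'M[R]_(g + g, g.*2) :=
  \matrix_(i, j) (2 * re (chain_int (real_form i) (b j))).

Lemma period_matrixE x j :
  (x *m period_matrix) 0 j = chain_val (real_int (real_comb x)) (b j).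
Proof.
rewrite real_int_cyclesE chain_int_form_sum //; last exact: real_form_holomorphic.
rewrite mxE.
have -> (r : seq 'I_(g + g)) : re (\sum_(k <- r) rcplx (x 0 k) * chain_int (real_form k) (b j)) =
   \sum_(k <- r) x 0 k * re (chain_int (real_form k) (b j)).
  elim: r => [|k r IH]; first by rewrite !big_nil.
  by rewrite !big_cons reD IH reM re_rcplx im_rcplx mul0r subr0.
by rewrite mulr_sumr; apply: eq_bigr => k _; rewrite mxE mulrCA.
Qed.

Lemma chain_val_real_basis (D : (R -> X) -> R) c :
  (forall s, simplex2 s -> D (face0 s) - D (face1 s) + D (face2 s) = 0) ->
  (forall k, chain_val D (b k) = 0) -> cycle1 c -> chain_val D c = 0.
Proof.
move=> hD hb hc; have [m [hm _]] := b_basis hc.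
by rewrite (chain_val_basis hD hm) big1 // => k _; rewrite hb mul0rz.
Qed.

(** A real combination whose periods vanish on [b] has none on any cycle, hence is the zero form by
    the maximum principle; uniqueness of coordinates in [e] then kills its coefficients. *)
Lemma period_matrix_free : row_free period_matrix.
Proof.
rewrite -kermx_eq0; apply/eqP/row_matrixP => i; rewrite row0.
set x := row i _; have hx : x *m period_matrix = 0.
  by rewrite /x -row_mul mulmx_ker row0.
have hc c : cycle1 c -> chain_val (real_int (real_comb x)) c = 0.
  apply: chain_val_real_basis => [s|k].
    exact/real_int_cocycle/real_comb_holomorphic.
  by rewrite -period_matrixE hx mxE.
have := @real_int_eq0 (real_comb x) (real_comb_holomorphic x).
move=> /(_ _)E; have {E} : real_comb x = fun _ _ => 0.
  by apply: E => p hp p01; rewrite -chain_val_loop; apply: hc; exact: loop_cycle.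
rewrite real_combE => E.
have [_ /(_ (fun _ _ => 0) (holomorphic_form0 X))[c [hc0 uc]]] := basis.
have c0 : c = 0.
  by apply: uc; apply/funext => j; apply/funext => z; rewrite big1 // => k _; rewrite mxE mul0r.
have : c = \row_k cplx (x 0 (lshift g k)) (x 0 (rshift g k)).
  apply: uc; rewrite -E; apply/funext => j; apply/funext => z.
  by apply: eq_bigr => k _; rewrite mxE.
rewrite c0 => /rowP hz; apply/rowP => k; rewrite mxE.
rewrite -(splitK k); case: (fintype.split k) => k' /=; have := hz k'; rewrite !mxE.
  by move=> /(congr1 (@re R)); rewrite re_cplx.
by move=> /(congr1 (@im R)); rewrite im_cplx.
Qed.

(** Here the two descriptions of the genus meet: [g + g] real parameters against [g.*2] cycles make
    the free matrix square, hence full. *)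
Lemma period_surjective (y : 'rV[R]_g.*2) : exists2 a, holomorphic_form a &
  forall k, chain_val (real_int a) (b k) = y 0 k.
Proof.
have full : row_full period_matrix.
  have /eqP rk : \rank period_matrix == (g + g)%N := period_matrix_free.
  by rewrite /row_full rk addnn.
have /submxP[x hx] : (y <= period_matrix)%MS by exact: submx_full.
exists (real_comb x); first exact: real_comb_holomorphic.
by move=> k; rewrite -period_matrixE -hx.
Qed.

Lemma real_periods_inj a a' : holomorphic_form a -> holomorphic_form a' ->
  (forall p, path1 p -> p 0 = p 1 -> real_int a p = real_int a' p) -> a = a'.
Proof.
move=> ha ha' h; have hd := holomorphic_form_lin (-1) ha ha'.
have : (fun i z => a i z + -1 * a' i z) = fun _ _ => 0.
  apply: real_int_eq0 => // p hp p01.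
  rewrite /real_int path_int_lin // mulN1r !cE mulrBr; apply/eqP.
  by rewrite subr_eq0; apply/eqP; exact: h.
move=> E; apply/funext => i; apply/funext => z.
have := congr1 (fun f : one_form X => f i z) E.
by rewrite mulN1r => /eqP; rewrite subr_eq0 => /eqP.
Qed.

(** Coboundaries vanish on loops, so every cocycle of the class returns the same integer. *)
Lemma harmonic_loopE (gamma : H1 X) a (c : (R -> X) -> int) p :
  harmonic_representative gamma a -> cocycles gamma c -> path1 p -> p 0 = p 1 ->
  real_int a p = (c p)%:~R.
Proof.
move=> [_ [c1 hc1 [f hf]]] hc hp p01.
have [c0 _ eg] := cocyclesP gamma; rewrite eg in hc hc1.
have := hf p hp; rewrite p01 subrr rcplx0 addr0 real_intE => /(congr1 (@re R)).
rewrite re_rcplx -rcplx_int re_rcplx => ->.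
have [_ [f0 h0]] := hc; have [_ [f1 h1]] := hc1.
have := h0 p hp; have := h1 p hp; rewrite p01 !subrr => /eqP; rewrite subr_eq0 => /eqP <-.
by move=> /eqP; rewrite subr_eq0 => /eqP ->.
Qed.

Lemma harmonic_unique (gamma : H1 X) a a' :
  harmonic_representative gamma a -> harmonic_representative gamma a' -> a = a'.
Proof.
move=> h h'; have [ha [c hc _]] := h; have [ha' _] := h'.
by apply: real_periods_inj => // p hp p01; rewrite (harmonic_loopE h hc) // (harmonic_loopE h' hc).
Qed.

(** A form with the periods of [c] on the basis [b] has them on all cycles; the difference of the
    two cochains is then exact, with the potential of [exact_of_cycles]. *)
Lemma harmonic_exists (gamma : H1 X) : exists a, harmonic_representative gamma a.
Proof.
have [c hc eg] := cocyclesP gamma.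
pose cR p : R := (c p)%:~R.
have [a ha hab] := period_surjective (\row_k chain_val cR (b k)).
have [|f hf] := @exact_of_cycles _ _ _ (fun p => real_int a p - cR p) cX.
  move=> ch hch; apply: chain_val_real_basis => // [s hs|k].
    have := hc s hs => /(congr1 (fun n : int => n%:~R : R)).
    rewrite intrD rmorphB /= -!/(cR _) => h.
    by have := real_int_cocycle ha hs; lra.
  by rewrite chain_valB hab mxE subrr.
exists a; split=> //; exists c.
  by rewrite eg; split=> //; exists (fun=> 0) => p _; rewrite !subrr.
exists f => p hp; rewrite -(hf p hp) real_intE -rcplx_int -rcplxD; congr rcplx.
by rewrite /cR addrC subrK.
Qed.

Lemma omegaP (gamma : H1 X) : harmonic_representative gamma (omega gamma).
Proof. by rewrite /omega; case: xgetP => // n; have [a /n] := harmonic_exists gamma. Qed.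

Lemma omegaE (gamma : H1 X) a : harmonic_representative gamma a -> omega gamma = a.
Proof. by move=> h; exact: harmonic_unique (omegaP gamma) h. Qed.

(* The class is the cocycle obtained from the real periods by subtracting the
   coboundary of the integrals along chosen paths from a base point. *)
Lemma integral_periods_class a : holomorphic_form a ->
  (forall p, path1 p -> p 0 = p 1 -> exists n : int, real_int a p = n%:~R) ->
  exists gamma : H1 X, harmonic_representative gamma a.
Proof.
move=> ha hint.
suff [f hf] : exists f : X -> R, forall p, path1 p ->
    exists n : int, real_int a p - (f (p 1) - f (p 0)) = n%:~R.
  (* On paths the argument is already an integer and [Num.floor] only converts it. *)
  pose c p := Num.floor (real_int a p - (f (p 1) - f (p 0))).
  have cE p : path1 p -> (c p)%:~R = real_int a p - (f (p 1) - f (p 0)).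
    by move=> hp; have [n hn] := hf p hp; rewrite /c hn intrKfloor.
  have hc : cocycle1 c.
    move=> s hs.
    (* A simplex is continuous on the triangle only, so its faces must be seen to be paths before
       integrality applies to them. *)
    have face_path (h : R -> R * R) : (forall t, triangle (h t)) -> continuous h ->
        (forall t, h t = h (clamp t)) -> path1 (s \o h).
      move=> hT ch hcl; split; last by move=> t; rewrite /= hcl.
      move=> t W hW; have /subspace_continuousP/(_ _ (hT t)) := hs.
      move=> /(_ W hW); rewrite /= nbhs_filterE /within /= => hn.
      have h' : \forall v \near h t, triangle v -> W (s v) by [].
      suff : \forall v \near t, W (s (h v)) by [].
      by apply: filterS (near_comp (ch t) h') => v; apply; exact: hT.
    have cc : continuous (@clamp R) by exact: clamp_continuous.
    have c0 (k : R) : continuous (fun _ : R => k) by move=> t; exact: cvg_cst.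
    have p0 : path1 (face0 s).
      apply: (face_path (fun t => (1 - clamp t, clamp t))) => [t||t].
      - by rewrite /triangle /=; have /andP[? ?] := clamp_in t; split; lra.
      - apply: continuous_pairing => // t; apply: cvgB; [exact: cvg_cst|exact: cc].
      - by rewrite clampK.
    have p1 : path1 (face1 s).
      apply: (face_path (fun t => (0, clamp t))) => [t||t].
      - by rewrite /triangle /=; have /andP[? ?] := clamp_in t; split; lra.
      - exact: continuous_pairing.
      - by rewrite clampK.
    have p2 : path1 (face2 s).
      apply: (face_path (fun t => (clamp t, 0))) => [t||t].
      - by rewrite /triangle /=; have /andP[? ?] := clamp_in t; split; lra.
      - exact: continuous_pairing.
      - by rewrite clampK.
    apply: (@intr_inj R); rewrite intrD rmorphB /= !cE // /face0 /face1 /face2.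
    rewrite !clamp0 !clamp1 subr0 subrr; have := real_int_cocycle ha hs.
    by rewrite /face0 /face1 /face2 => h; lra.
  have eg : exists2 c', cocycle1 c' & cohomology_class c = cohomology_class c' by exists c.
  exists (CohomologyClass eg); split=> //; exists c => /=.
    by split=> //; exists (fun=> 0) => p _; rewrite !subrr.
  exists f => p hp; rewrite real_intE -rcplx_int -rcplxD; congr rcplx.
  by rewrite cE // subrK.
have [[x0 _]|nX] := pselect (exists x : X, True); last first.
  by exists (fun=> 0) => p; case: nX; exists (p 0).
have /choice[P hP] : forall y : X, exists p, [/\ path1 p, p 0 = x0 & p 1 = y].
  by move=> y; exact: path_connected.
exists (fun y => real_int a (P y)) => p hp.
have [h1 h10 h11] := hP (p 1); have [h0 h00 h01] := hP (p 0).
have c1 : path1 (cat_path (P (p 0)) p) by apply: cat_path1.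
pose q := cat_path (cat_path (P (p 0)) p) (rev_path (P (p 1))).
have hr := rev_path1 h1.
have hm : cat_path (P (p 0)) p 1 = rev_path (P (p 1)) 0.
  by rewrite cat_path_end rev_path0 h11.
have hq : path1 q by exact: cat_path1.
have [|n hn] := hint q hq; first by rewrite /q !cat_path0 cat_path_end rev_path_end h00 h10.
exists n; rewrite -hn /real_int /q !path_int_cat // path_int_rev // !cE; ring.
Qed.

(** On a cycle the coboundary in [harmonic_representative] disappears and the integral cocycle
    remains. *)
Lemma harmonic_cycle_int (gamma : H1 X) a c : harmonic_representative gamma a ->
  cycle1 c -> exists n : int, 2 * re (chain_int a c) = n%:~R.
Proof.
move=> [ha [c0 _ [f hf]]] hc; exists (chain_val c0 c).
have := chain_val_coboundary f hc.
rewrite -(@eq_chain_val _ (fun p => real_int a p - (c0 p)%:~R)) //; last first.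
  move=> p hp; have := hf p hp; rewrite real_intE -rcplx_int -rcplxD.
  by move=> /(congr1 (@re R)); rewrite !re_rcplx => ->; rewrite addrC addKr.
rewrite chain_valB real_int_cyclesE => /eqP; rewrite subr_eq0 => /eqP ->.
rewrite /chain_val rmorph_sum /=; apply: eq_bigr => y _.
exact/esym/rmorphMz.
Qed.

End CurveCohomology.

(** * Flat sections and real monodromy *)

Section Monodromy.
Variables (R : realType) (X : riemann_surface R).
Local Notation C := (Cplx R).
Implicit Types (a : one_form X) (p : R -> X).

Lemma lambda_inj a a' : lambda a = lambda a' -> a = a'.
Proof.
move=> h; apply/funext => i; apply/funext => z.
have := congr1 (fun L : connection X => L i (fun=> 1) z) h.
by rewrite /lambda !mulr1 => /addrI/oppr_inj.
Qed.

Lemma flat_along_cexp a p F : continuous p -> along a p 0 1 F ->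
  flat_along (lambda a) p (fun t => cexp (F t - F 0)).
Proof.
move=> cp hF t ht; have [Phi [i [P [ix hP eP]]] e] := hF t ht.
exists i, (fun z => cexp (P z - F 0)); split=> //.
  apply: filterS hP => z hz.
  have dS := cder_comp (cderDc (- F 0) hz) (cder_cexp (P z - F 0)).
  split; first by apply/derivableP_cder; eexists; exact: dS.
  by rewrite /lambda (cder_derive dS) mulrC subrr.
have eP' := near_comp (cp t) eP.
by apply: filterS2 e eP' => u e1 e2 hu; rewrite e1 // e2.
Qed.

(** Variation of constants: [s * cexp (- F)] is locally constant along the path. *)
Lemma flat_alongE a p F s : holomorphic_form a -> continuous p -> along a p 0 1 F ->
  flat_along (lambda a) p s -> s 1 = s 0 * cexp (F 1 - F 0).
Proof.
move=> ha cp hF hs.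
suff : s 0 * cexp (- F 0) = s 1 * cexp (- F 1).
  rewrite [F 1 - _]addrC cexpD mulrA => ->.
  by rewrite -mulrA cexpNM mulr1.
apply: (locally_constant (u := fun t => s t * cexp (- F t)) (@ler01 R)) => t ht.
have [Phi hPhi e] := hF t ht; have [i [S [ix hS eS]]] := hs t ht.
have [P [hP eP]] := primitive_at_chart ha hPhi ix.
have : \forall z \near coord i (p t), cder (fun z => S z * cexp (- P z)) z 0.
  apply: filterS2 hS hP => z [/derivableP_cder[S' dS] lS] dP.
  have := cderM dS (cder_comp (cderN dP) (cder_cexp (- P z))).
  move: lS; rewrite /lambda (cder_derive dS) => /eqP; rewrite subr_eq0 => /eqP ->.
  rewrite /=; have -> // : a i z * S z * cexp (- P z) + S z * (cexp (- P z) * - a i z) = 0.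
  by ring.
move=> /near_n1P[r r0 hr]; have K := cder0_constant hr.
have near_r : \forall y \near p t, n1 (coord i y - coord i (p t)) < r.
  have : nbhs (coord i (p t)) [set w | n1 (w - coord i (p t)) < r] by apply/near_n1P; exists r.
  exact: near_comp (coord_continuous ix).
have n1 := near_comp (cp t) near_r; have n2 := near_comp (cp t) eP.
have val u : 0 <= u <= 1 -> Phi (p u) = P (coord i (p u)) -> F u = Phi (p u) ->
    s u = S (coord i (p u)) -> s u * cexp (- F u) = S (coord i (p u)) * cexp (- P (coord i (p u))).
  by move=> _ h1 h2 h3; rewrite h3 h2 h1.
have : \forall u \near t, 0 <= u <= 1 -> s u * cexp (- F u) = s t * cexp (- F t).
  apply: filterS (filterI (filterI n1 n2) (filterI e eS)) => u [[h1 h2] [h3 h4]] hu.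
  rewrite (val u) ?h3 ?h4 // (val t) //; first exact: K.
  - exact: nbhs_singleton n2.
  - exact: nbhs_singleton e ht.
  - exact: nbhs_singleton eS ht.
by move=> /near_realP[d d0 hd]; exists d => // u hu ud; apply: hd.
Qed.

(** The holonomy is [cexp] of the integral. It may be real of either sign, which allows all
    multiples of [pi] and not only those of [2 * pi]. *)
Lemma real_monodromyP a : holomorphic_form a -> real_monodromy (lambda a) <->
  (forall p, path1 p -> p 0 = p 1 -> exists n : int, im (path_int a p) = n%:~R * pi).
Proof.
move=> ha; split=> h p hp p01; have [cp _] := hp; have [F hF] := along_exists ha cp ler01.
  have [s [r [hs s0 _ s1]]] := h p hp p01; apply/cexp_realP; exists r.
  by rewrite -s1 (path_int_along ha cp hF) (flat_alongE ha cp hF hs) s0 mul1r.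
have /cexp_realP[r hr] := h p hp p01.
exists (fun t => cexp (F t - F 0)), r; split.
- exact: flat_along_cexp.
- by rewrite subrr cexp0.
- by rewrite -rcplx_eq0 -hr cexp_neq0.
- by rewrite -hr (path_int_along ha cp hF).
Qed.

Lemma two_pi_i_neq0 : two_pi_i != 0 :> C.
Proof.
rewrite /two_pi_i !mulf_eq0 pnatr_eq0 rcplx_eq0 (gt_eqF (pi_gt0 R)) /=.
by apply/negP => /eqP /(congr1 (@im R)); rewrite !cE => /eqP; rewrite oner_eq0.
Qed.

Lemma re_two_pi_iM (z : C) : re (two_pi_i * z) = - (2 * pi * im z).
Proof. by rewrite /two_pi_i !cE; ring. Qed.

Lemma im_two_pi_iM (z : C) : im (two_pi_i * z) = 2 * pi * re z.
Proof. by rewrite /two_pi_i !cE; ring. Qed.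

(* [im (2 pi i w) = pi (w + conj w)]: the imaginary part of the period of
   [2 pi i w] lies in [pi Z] exactly when the real period of [w] is an integer. *)
Lemma im_path_int_scale a p : holomorphic_form a -> path1 p ->
  im (path_int (scale_form two_pi_i a) p) = real_int a p * pi.
Proof. by move=> ha hp; rewrite path_int_scale // im_two_pi_iM /real_int; ring. Qed.

Lemma scale_formK a : scale_form two_pi_i (scale_form two_pi_i^-1 a) = a.
Proof.
apply/funext => i; apply/funext => z.
by rewrite /scale_form mulrA mulfV ?two_pi_i_neq0 // mul1r.
Qed.

Lemma scale_form_inj a a' : scale_form two_pi_i a = scale_form two_pi_i a' -> a = a'.
Proof.
move=> h; apply/funext => i; apply/funext => z.
have := congr1 (fun f : one_form X => f i z) h.
by move/(mulfI two_pi_i_neq0).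
Qed.

Lemma real_monodromy_class a : compact [set: X] -> connected [set: X] ->
  holomorphic_form a -> real_monodromy (lambda a) ->
  exists2 gamma : H1 X, harmonic_representative gamma (scale_form two_pi_i^-1 a) &
    a = scale_form two_pi_i (scale_form two_pi_i^-1 a).
Proof.
move=> kX cX ha /(real_monodromyP ha) h.
have hs := holomorphic_scale two_pi_i^-1 ha.
have [|gamma hg] := @integral_periods_class R X cX _ hs.
  move=> p hp p01; have [n hn] := h p hp p01; exists n.
  apply: (mulIf (x := pi)); first by rewrite gt_eqF ?pi_gt0.
  by rewrite -im_path_int_scale // scale_formK.
by exists gamma => //; rewrite scale_formK.
Qed.

Lemma real_monodromy_harmonic (gamma : H1 X) a : harmonic_representative gamma a ->
  real_monodromy (lambda (scale_form two_pi_i a)).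
Proof.
move=> hg; have [ha _] := hg; apply/real_monodromyP; first exact: holomorphic_scale.
have [c hc eg] := cocyclesP gamma => p hp p01.
have cg : cocycles gamma c.
  by rewrite eg; split=> //; exists (fun=> 0) => q _; rewrite !subrr.
by exists (c p); rewrite im_path_int_scale // (harmonic_loopE hg cg).
Qed.

End Monodromy.

(** * Lattice coordinates on the dual of the holomorphic forms *)

Section TorusCoordinates.
Variables (R : realType) (X : riemann_surface R).
Local Notation C := (Cplx R).
Implicit Types (a : one_form X) (p : R -> X).
Hypotheses (kX : compact [set: X]) (cX : connected [set: X]).
Variables (g : nat) (e : 'I_g -> one_form X).
Hypothesis basis : form_basis e.

Let he k : holomorphic_form (e k). Proof. by case: basis. Qed.

Lemma form_coordP a : holomorphic_form a -> a = form_sum e (fun k => form_coord e a 0 k).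
Proof.
move=> ha; have [_ /(_ a ha)[c [hc _]]] := basis.
by rewrite /form_coord; case: xgetP => [d _ hd|/(_ c) []].
Qed.

Lemma form_coordE a (c : 'I_g -> C) : a = form_sum e c ->
  forall k, form_coord e a 0 k = c k.
Proof.
move=> h k; have ha : holomorphic_form a by rewrite h; exact: holomorphic_form_sum.
have [_ /(_ a ha)[d [_ ud]]] := basis.
have <- : d = form_coord e a by apply: ud; exact: form_coordP.
suff -> : d = \row_k c k by rewrite mxE.
apply: ud; rewrite {1}h; apply/funext => i; apply/funext => z.
by apply: eq_bigr => j _; rewrite mxE.
Qed.

Lemma form_coord_basis k j : form_coord e (e k) 0 j = (j == k)%:R.
Proof.
apply: (form_coordE (c := fun j => (j == k)%:R)).
apply/funext => i; apply/funext => z; rewrite /form_sum (bigD1 k) //= eqxx mul1r.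
by rewrite big1 ?addr0 // => l /negbTE ->; rewrite mul0r.
Qed.

Lemma form_evalDl (l l' : 'rV[C]_g) a : form_eval e (l + l') a = form_eval e l a + form_eval e l' a.
Proof. by rewrite /form_eval -big_split; apply: eq_bigr => k _; rewrite mxE mulrDl. Qed.

Lemma form_evalZl (c : C) (l : 'rV[C]_g) a : form_eval e (c *: l) a = c * form_eval e l a.
Proof. by rewrite /form_eval mulr_sumr; apply: eq_bigr => k _; rewrite mxE mulrA. Qed.

Lemma form_eval_sum n (f : 'I_n -> one_form X) (c : 'I_n -> C) l :
  (forall k, holomorphic_form (f k)) ->
  form_eval e l (form_sum f c) = \sum_k c k * form_eval e l (f k).
Proof.
move=> hf; rewrite /form_eval.
have E : form_sum f c = form_sum e (fun j => \sum_k c k * form_coord e (f k) 0 j).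
  apply/funext => i; apply/funext => z; rewrite /form_sum.
  under [RHS]eq_bigr do rewrite mulr_suml.
  rewrite exchange_big /=; apply: eq_bigr => k _.
  rewrite {1}(form_coordP (hf k)) /form_sum mulr_sumr.
  by apply: eq_bigr => j _; rewrite mulrA.
under eq_bigr do rewrite (form_coordE E) mulr_sumr.
rewrite exchange_big /=; apply: eq_bigr => k _.
by rewrite mulr_sumr; apply: eq_bigr => j _; rewrite mulrCA.
Qed.

Lemma form_eval_scale (c : C) l a : holomorphic_form a ->
  form_eval e l (scale_form c a) = c * form_eval e l a.
Proof.
move=> ha; have := @form_eval_sum 1 (fun=> a) (fun=> c) l (fun=> ha).
rewrite big_ord1 => <-; congr form_eval.
by apply/funext => i; apply/funext => z; rewrite /form_sum big_ord1.
Qed.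

(** Evaluation and integration are both linear in the form and agree on the basis [e]. *)
Lemma form_eval_cycle a c (l : 'rV[C]_g) : holomorphic_form a -> cycle1 c ->
  (forall k, l 0 k = chain_int (e k) c) -> form_eval e l a = chain_int a c.
Proof.
move=> ha hc hl; rewrite {2}(form_coordP ha) chain_int_form_sum //.
by apply: eq_bigr => k _; rewrite hl mulrC.
Qed.

Lemma form_eval_inj a a' : holomorphic_form a -> holomorphic_form a' ->
  (forall v, form_eval e v a = form_eval e v a') -> a = a'.
Proof.
move=> ha ha' h; rewrite (form_coordP ha) (form_coordP ha'); congr form_sum.
apply/funext => k; have ev b : form_eval e (delta_mx 0 k) b = form_coord e b 0 k.
  rewrite /form_eval (bigD1 k) //= mxE !eqxx mul1r big1 ?addr0 // => j /negbTE jk.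
  by rewrite mxE jk mul0r.
by have := h (delta_mx 0 k); rewrite !ev.
Qed.

Variable b : 'I_g.*2 -> chain X.
Hypothesis b_cycle : forall k, cycle1 (b k).
Hypothesis b_basis : forall c, cycle1 c ->
  exists! m : {ffun 'I_g.*2 -> int}, boundary (chain_sub c (chain_comb m b)).

Variable eta : 'I_g.*2 -> one_form X.
Hypothesis eta_holomorphic : forall k, holomorphic_form (eta k).
Hypothesis eta_dual : forall k j, 2 * re (chain_int (eta k) (b j)) = (j == k)%:R.

(** The forms [eta] are dual to the cycles [b] under real periods. These real-linear coordinates
    therefore take integral values on periods, and [lattice_vec] is the basis they belong to. *)
Definition lattice_coord (k : 'I_g.*2) (l : 'rV[C]_g) : R := 2 * re (form_eval e l (eta k)).
Definition lattice_vec (k : 'I_g.*2) : 'rV[C]_g := \row_j chain_int (e j) (b k).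

Lemma lattice_vec_period k : period e (lattice_vec k).
Proof. by exists (b k) => // j; rewrite mxE. Qed.

Lemma lattice_coord_vec k j : lattice_coord k (lattice_vec j) = (j == k)%:R.
Proof.
by rewrite /lattice_coord (@form_eval_cycle _ (b j)) // => i; rewrite mxE.
Qed.

Lemma lattice_coordD k l l' : lattice_coord k (l + l') = lattice_coord k l + lattice_coord k l'.
Proof. by rewrite /lattice_coord form_evalDl reD mulrDr. Qed.

Lemma lattice_coordZ k (s : R) l : lattice_coord k (rcplx s *: l) = s * lattice_coord k l.
Proof. by rewrite /lattice_coord form_evalZl reM re_rcplx im_rcplx; ring. Qed.

Lemma real_int_integral (D : (R -> X) -> R) c :
  (forall s, simplex2 s -> D (face0 s) - D (face1 s) + D (face2 s) = 0) ->
  (forall k, exists n : int, chain_val D (b k) = n%:~R) -> cycle1 c ->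
  exists n : int, chain_val D c = n%:~R.
Proof.
move=> hD /choice[n hn] hc; have [m [hm _]] := b_basis hc.
exists (\sum_k n k *~ m k); rewrite (chain_val_basis hD hm) rmorph_sum.
by apply: eq_bigr => k _; rewrite hn; exact/esym/rmorphMz.
Qed.

Lemma lattice_coord_period k l : period e l -> exists n : int, lattice_coord k l = n%:~R.
Proof.
move=> [c hc hl]; rewrite /lattice_coord (form_eval_cycle (eta_holomorphic k) hc hl).
rewrite -real_int_cyclesE; apply: real_int_integral => // [s hs|j].
  exact: real_int_cocycle.
by rewrite real_int_cyclesE eta_dual; exists (j == k)%:R; case: (j == k).
Qed.

(** Both sides have the same real periods on [b], hence on all loops. *)
Lemma real_expansion a : holomorphic_form a ->
  a = form_sum eta (fun k => rcplx (2 * re (chain_int a (b k)))).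
Proof.
move=> ha; set a' := form_sum _ _.
have ha' : holomorphic_form a' by exact: holomorphic_form_sum.
apply: (real_periods_inj kX cX) => // p hp p01.
pose D p := real_int a p - real_int a' p.
suff : chain_val D [:: (1, p)] = 0.
  by rewrite chain_val_loop => /eqP; rewrite subr_eq0 => /eqP.
apply: (chain_val_real_basis b_basis) => [s hs|k|]; last exact: loop_cycle.
  have := real_int_cocycle ha hs; have := real_int_cocycle ha' hs; rewrite /D; lra.
rewrite chain_valB !real_int_cyclesE chain_int_form_sum //.
have reE (r : seq 'I_g.*2) : 2 * re (\sum_(j <- r) rcplx (2 * re (chain_int a (b j))) * chain_int (eta j) (b k)) =
    \sum_(j <- r) 2 * re (chain_int a (b j)) * (k == j)%:R.
  elim: r => [|j r IH]; first by rewrite !big_nil mulr0.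
  by rewrite !big_cons reD mulrDr IH reM re_rcplx im_rcplx mul0r subr0 mulrCA eta_dual.
rewrite reE (bigD1 k) //= eqxx mulr1 big1 ?addr0 ?subrr // => j jk.
by rewrite eq_sym (negbTE jk) mulr0.
Qed.

Lemma real_eval_expansion a l : holomorphic_form a ->
  2 * re (form_eval e l a) = \sum_k 2 * re (chain_int a (b k)) * lattice_coord k l.
Proof.
move=> ha; rewrite {1}(real_expansion ha) form_eval_sum //.
elim: (index_enum _) => [|j r IH]; first by rewrite !big_nil mulr0.
by rewrite !big_cons reD mulrDr IH reM re_rcplx im_rcplx mul0r subr0 mulrCA.
Qed.

(** Expansion in [eta] kills the real part of [l] on every holomorphic form; evaluating on ['i]
    times the form kills the imaginary part. *)
Lemma lattice_coord_inj l : (forall k, lattice_coord k l = 0) -> l = 0.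
Proof.
move=> h; have re0 a : holomorphic_form a -> re (form_eval e l a) = 0.
  move=> ha; have := real_eval_expansion l ha; rewrite big1 => [/eqP|k _].
    by rewrite mulf_eq0 pnatr_eq0 => /eqP.
  by rewrite h mulr0.
apply/rowP => k; rewrite mxE.
have -> : l 0 k = form_eval e l (e k).
  rewrite /form_eval (bigD1 k) //= form_coord_basis eqxx mulr1 big1 ?addr0 // => j jk.
  by rewrite form_coord_basis (negbTE jk) mulr0.
apply: cplx_ext; first exact: re0.
have := re0 _ (holomorphic_scale 'i (he k)); rewrite form_eval_scale // !cE mul0r sub0r mul1r.
by move=> /eqP; rewrite oppr_eq0 => /eqP.
Qed.

Lemma lattice_expansion l : l = \sum_k rcplx (lattice_coord k l) *: lattice_vec k.
Proof.
apply/eqP; rewrite -subr_eq0; apply/eqP/lattice_coord_inj => k.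
have cN v : lattice_coord k (- v) = - lattice_coord k v.
  by rewrite -scaleN1r -rcplx1 -rcplxN lattice_coordZ mulN1r.
have c0 : lattice_coord k 0 = 0 by rewrite -(scale0r (0 : 'rV[C]_g)) -rcplx0 lattice_coordZ mul0r.
have cS (r : seq 'I_g.*2) : lattice_coord k (\sum_(j <- r) rcplx (lattice_coord j l) *: lattice_vec j) =
    \sum_(j <- r) lattice_coord j l * (j == k)%:R.
  elim: r => [|j r IH]; first by rewrite !big_nil.
  by rewrite !big_cons lattice_coordD IH lattice_coordZ lattice_coord_vec.
rewrite lattice_coordD cN cS (bigD1 k) //= eqxx mulr1 big1 ?addr0 ?subrr // => j jk.
by rewrite (negbTE jk) mulr0.
Qed.

Lemma phi_expansion (gamma : H1 X) : exists n : 'I_g.*2 -> int, forall l,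
  phi e gamma l = rcplx (\sum_k (n k)%:~R * lattice_coord k l).
Proof.
have hg := omegaP kX cX basis b_cycle b_basis gamma; have [ha _] := hg.
have /choice[n hn] : forall k, exists n : int, 2 * re (chain_int (omega gamma) (b k)) = n%:~R.
  by move=> k; exact: harmonic_cycle_int hg (b_cycle k).
exists n => l; rewrite /phi; apply: cplx_ext; rewrite !cE ?subrr //.
rewrite -mulr2n -mulr_natl real_eval_expansion //.
by apply: eq_bigr => k _; rewrite hn.
Qed.

(** The integral combination of the dual forms has integral real periods, so it is the harmonic form
    of a class. With [phi_expansion], the functionals of classes are exactly the integral
    combinations of coordinates. *)
Lemma phi_surjective (n : 'I_g.*2 -> int) : exists gamma : H1 X, forall l,
  phi e gamma l = rcplx (\sum_k (n k)%:~R * lattice_coord k l).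
Proof.
pose a := form_sum eta (fun k => rcplx (n k)%:~R).
have ha : holomorphic_form a by exact: holomorphic_form_sum.
have aE k : 2 * re (chain_int a (b k)) = (n k)%:~R.
  have -> : (n k)%:~R = \sum_j (n j)%:~R * (k == j)%:R :> R.
    rewrite (bigD1 k) //= eqxx mulr1 big1 ?addr0 // => j jk.
    by rewrite eq_sym (negbTE jk) mulr0.
  rewrite chain_int_form_sum //.
  elim: (index_enum _) => [|j r IH]; first by rewrite !big_nil mulr0.
  by rewrite !big_cons reD mulrDr IH reM re_rcplx im_rcplx mul0r subr0 mulrCA eta_dual.
have [|gamma hg] := integral_periods_class cX ha.
  move=> p hp p01; rewrite -chain_val_loop; apply: real_int_integral; last exact: loop_cycle.
    by move=> s hs; exact: real_int_cocycle.
  by move=> k; exists (n k); rewrite real_int_cyclesE.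
exists gamma => l; rewrite /phi (omegaE kX cX basis b_cycle b_basis hg).
apply: cplx_ext; rewrite !cE ?subrr //.
rewrite -mulr2n -mulr_natl real_eval_expansion //.
by apply: eq_bigr => k _; rewrite aE.
Qed.

End TorusCoordinates.

(** * Differential operators on [Pic^0] *)

Section Pic0.
Variables (R : realType) (X : riemann_surface R) (g : nat) (e : 'I_g -> one_form X).
Local Notation C := (Cplx R).
Local Notation V := 'rV[C]_g.
Local Notation T := (pic0_borel e).

Lemma re_continuous : continuous (@re R).
Proof.
move=> z W /nbhs_ballP[d /= d0 hd]; apply/near_n1P; exists d => // w hw.
by apply: hd; rewrite -ball_normE /= distrC -reN -reD; apply: le_lt_trans (re_le_n1 _) hw.
Qed.

Lemma im_continuous : continuous (@im R).
Proof.
move=> z W /nbhs_ballP[d /= d0 hd]; apply/near_n1P; exists d => // w hw.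
by apply: hd; rewrite -ball_normE /= distrC -imN -imD; apply: le_lt_trans (im_le_n1 _) hw.
Qed.

Lemma near_rowP (l : V) (P : V -> Prop) : (\forall v \near l, P v) <->
  exists2 r : R, 0 < r & forall v : V, (forall k, n1 (v 0 k - l 0 k) < r) -> P v.
Proof.
split=> [/nbhs_ballP[d /= d0 h]|[r r0 h]].
  have d0' : 0 < re d by move: d0; rewrite lt_cplx !cE => /andP[].
  exists (re d) => // v hv; apply: h; split=> // i k; rewrite ord1 -ball_normE /= lt_cplx.
  apply/andP; split.
    by rewrite normC_abs2 im_rcplx; move: d0; rewrite lt_cplx !cE => /andP[/eqP ->].
  by apply: le_lt_trans (normC_le _) _; rewrite n1B.
apply/nbhs_ballP; exists (rcplx (r / 2)) => /=; first by rewrite lt_cplx !cE eqxx/= divr_gt0.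
move=> v [_ hv]; apply: h => k; have := hv 0 k; rewrite -ball_normE /= lt_cplx => /andP[_].
rewrite re_rcplx => hk; rewrite n1B; apply: le_lt_trans (n1_le_normC _) _.
by rewrite mulrC -ltr_pdivlMr.
Qed.

Lemma addr_row_continuous (y : V) : continuous (fun l : V => l + y).
Proof.
move=> l W /near_rowP[r r0 h]; apply/near_rowP; exists r => // v hv.
by apply: h => k; rewrite !mxE opprD addrACA subrr addr0; exact: hv.
Qed.

Lemma pic0_projP (l l' : V) : pic0_proj e l = pic0_proj e l' <-> period e (l - l').
Proof.
rewrite /pic0_proj; split=> [/(eqquotP (pic0 e))|h].
  by rewrite ring_quotient.Quotient.equivE => /asboolP.
by apply/(eqquotP (pic0 e)); rewrite ring_quotient.Quotient.equivE; apply/asboolP.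
Qed.

Lemma pic0_projD (l l' : V) : pic0_proj e (l + l') = pic0_proj e l + pic0_proj e l'.
Proof. exact: ring_quotient.Quotient.pi_add. Qed.

Lemma pic0_projK (x : pic0 e) : pic0_proj e (repr x) = x.
Proof. exact: reprK. Qed.

Lemma pic0_repr_period (l : V) : period e (repr (pic0_proj e l) - l).
Proof. by apply/pic0_projP; rewrite pic0_projK. Qed.

Lemma pic0_open_measurable (A : set (pic0 e)) : pic0_open A -> measurable (A : set T).
Proof. by move=> hA; exact: sub_sigma_algebra. Qed.

Lemma pic0_continuous_measurable (f : pic0 e -> R) : continuous (f \o pic0_proj e) ->
  measurable_fun [set: T] (f : T -> R).
Proof.
move=> cf; apply: (measurability _ (RGenOInfty.measurableE R)).
move=> _ [_ [x ->] <-]; rewrite setTI; apply: pic0_open_measurable.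
apply: (@open_comp _ _ (f \o pic0_proj e) `]x, +oo[); first by move=> l _; exact: cf.
by rewrite set_itvE; exact: open_gt.
Qed.

Definition cmeasurable (f : pic0 e -> C) :=
  measurable_fun [set: T] (@re R \o f : T -> R) /\
  measurable_fun [set: T] (@im R \o f : T -> R).

Lemma continuous_cmeasurable f : continuous (f \o pic0_proj e) -> cmeasurable f.
Proof.
move=> cf; split; apply: pic0_continuous_measurable.
  exact: (continuous_comp2 cf re_continuous).
exact: (continuous_comp2 cf im_continuous).
Qed.

Lemma measurable_translation (y : pic0 e) : measurable_fun [set: T] ((fun x => x + y) : T -> T).
Proof.
apply: (@measurability _ _ T T setT _ (@pic0_open R X g e)) => // _ [A oA <-].
rewrite setTI; apply: pic0_open_measurable.
suff -> : pic0_open ((fun x : pic0 e => x + y) @^-1` A) = open ((fun l => l + repr y) @^-1` (pic0_proj e @^-1` A)).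
  by apply: open_comp => // l _; exact: addr_row_continuous.
congr open; apply/seteqP; split => l /=; by rewrite pic0_projD pic0_projK.
Qed.

Lemma cmeasurable_abs2 f : cmeasurable f ->
  measurable_fun [set: T] (fun x : T => (abs2 (f x))%:E).
Proof.
move=> [h1 h2]; apply/measurable_EFinP; apply: measurable_funD; apply: measurable_funX; assumption.
Qed.

Lemma cmeasurableD f f' : cmeasurable f -> cmeasurable f' -> cmeasurable (fun x => f x + f' x).
Proof.
move=> [h1 h2] [h1' h2']; split.
  rewrite (_ : _ \o _ = (@re R \o f) \+ (@re R \o f')); first exact: measurable_funD.
  by apply/funext => x; rewrite /= reD.
rewrite (_ : _ \o _ = (@im R \o f) \+ (@im R \o f')); first exact: measurable_funD.
by apply/funext => x; rewrite /= imD.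
Qed.

Lemma cmeasurable_cst c : cmeasurable (fun=> c).
Proof. by split; exact: measurable_cst. Qed.

Lemma cmeasurableM f f' : cmeasurable f -> cmeasurable f' -> cmeasurable (fun x => f x * f' x).
Proof.
move=> [h1 h2] [h1' h2']; split.
  rewrite (_ : _ \o _ = ((@re R \o f) \* (@re R \o f')) \- ((@im R \o f) \* (@im R \o f'))).
    by apply: measurable_funB; exact: measurable_funM.
  by apply/funext => x; rewrite /= reM.
rewrite (_ : _ \o _ = ((@re R \o f) \* (@im R \o f')) \+ ((@im R \o f) \* (@re R \o f'))).
  by apply: measurable_funD; exact: measurable_funM.
by apply/funext => x; rewrite /= imM.
Qed.

Lemma cmeasurableZ c f : cmeasurable f -> cmeasurable (fun x => c * f x).
Proof. by move=> hf; apply: cmeasurableM => //; exact: cmeasurable_cst. Qed.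

Lemma cmeasurableB f f' : cmeasurable f -> cmeasurable f' -> cmeasurable (fun x => f x - f' x).
Proof.
move=> h h'; have := cmeasurableD h (cmeasurableZ (-1) h').
by congr cmeasurable; apply/funext => x; rewrite mulN1r.
Qed.

Lemma cmeasurable_translation f y : cmeasurable f -> cmeasurable (fun x => f (x + y)).
Proof.
move=> [h1 h2]; split.
  exact: (measurableT_comp h1 (measurable_translation y)).
exact: (measurableT_comp h2 (measurable_translation y)).
Qed.

Variable mu : {measure set T -> \bar R}.

Lemma norm2_ge0 f : (0 <= norm2 mu f)%E.
Proof. by apply: integral_ge0 => x _; rewrite lee_fin abs2_ge0. Qed.

Lemma norm2_le (k : R) f f' : 0 <= k -> cmeasurable f -> cmeasurable f' ->
  (forall x, abs2 (f x) <= k * abs2 (f' x)) -> (norm2 mu f <= k%:E * norm2 mu f')%E.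
Proof.
move=> k0 hf hf' h; rewrite /norm2 -ge0_integralZl_EFin //; last first.
- exact: cmeasurable_abs2.
- by move=> x _; rewrite lee_fin abs2_ge0.
apply: ge0_le_integral => //.
- by move=> x _; rewrite lee_fin abs2_ge0.
- exact: cmeasurable_abs2.
- by apply: measurable_funeM; exact: cmeasurable_abs2.
- by move=> x _; rewrite -EFinM lee_fin.
Qed.

Lemma abs2D_le (z w : C) : abs2 (z + w) <= 2 * (abs2 z + abs2 w).
Proof. rewrite /abs2 !cE; have := sqr_ge0 (re z - re w); have := sqr_ge0 (im z - im w); nra. Qed.

(** [norm2] is the square of a norm, so this bound with factor 2 takes the place of the triangle
    inequality. *)
Lemma norm2D_le f f' : cmeasurable f -> cmeasurable f' ->
  (norm2 mu (fun x => f x + f' x)%R <= 2%:E * (norm2 mu f + norm2 mu f'))%E.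
Proof.
move=> hf hf'; rewrite /norm2 -ge0_integralD //; last 4 first.
- by move=> x _; rewrite lee_fin abs2_ge0.
- exact: cmeasurable_abs2.
- by move=> x _; rewrite lee_fin abs2_ge0.
- exact: cmeasurable_abs2.
rewrite -ge0_integralZl_EFin //; last 2 first.
- by move=> x _; rewrite -EFinD lee_fin addr_ge0 ?abs2_ge0.
- by apply: emeasurable_funD; exact: cmeasurable_abs2.
apply: ge0_le_integral => //.
- by move=> x _; rewrite lee_fin abs2_ge0.
- by apply: cmeasurable_abs2; exact: cmeasurableD.
- by apply: measurable_funeM; apply: emeasurable_funD; exact: cmeasurable_abs2.
- by move=> x _; rewrite -EFinD -EFinM lee_fin abs2D_le.
Qed.

Lemma norm2Z c f : cmeasurable f -> norm2 mu (fun x => c * f x) = ((abs2 c)%:E * norm2 mu f)%E.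
Proof.
move=> hf; rewrite /norm2 -ge0_integralZl_EFin ?abs2_ge0 //; last first.
- exact: cmeasurable_abs2.
- by move=> x _; rewrite lee_fin abs2_ge0.
by apply: eq_integral => x _; rewrite abs2M EFinM.
Qed.

Lemma norm2_cst c : norm2 mu (fun=> c) = ((abs2 c)%:E * mu [set: T])%E.
Proof. by rewrite /norm2 integral_cst. Qed.

Hypothesis mu_haar : haar mu.

Lemma norm2_translation f (y : pic0 e) : cmeasurable f ->
  norm2 mu (fun x => f (x + y)) = norm2 mu f.
Proof.
move=> hf; pose tau : T -> T := fun x => x + y.
have mt : measurable_fun [set: T] tau := measurable_translation y.
have [_ _ inv] := mu_haar.
rewrite /norm2; transitivity (\int[pushforward mu tau]_x (abs2 (f x))%:E)%E.
  rewrite (ge0_integral_pushforward mt mu measurableT (cmeasurable_abs2 hf)).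
    by rewrite preimage_setT.
  by move=> x _; rewrite lee_fin abs2_ge0.
apply: (eq_measure_integral mu) => A mA _ /=; rewrite /pushforward.
(* The preimage of [A] under translation by [y] is the translate of [A] by [- y]. *)
rewrite -(inv A (- y)) //; congr (mu _); apply/seteqP; split=> x /=.
  by move=> Ax; exists (x + y) => //; rewrite addrK.
by move=> [z Az <-]; rewrite /tau subrK.
Qed.

End Pic0.

(** * Riemann sums and directional derivatives *)

Section DirectionalDerivatives.
Variables (R : realType) (g : nat).
Local Notation C := (Cplx R).
Local Notation V := 'rV[C]_g.
Implicit Types (f h : V -> C) (l v w : V).

Lemma continuous_lin (T : topologicalType) (f h : T -> C) (c : C) :
  continuous f -> continuous h -> continuous (fun x : T => f x + c * h x).
Proof.
move=> cf ch l; apply: (@cvgD _ _ _ (nbhs l)); first exact: cf.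
by apply: (@cvgM _ _ (nbhs l)); [exact: cvg_cst|exact: ch].
Qed.

Lemma continuous_scale (T : topologicalType) (f : T -> C) (c : C) :
  continuous f -> continuous (fun x : T => c * f x).
Proof. by move=> cf l; apply: (@cvgM _ _ (nbhs l)); [exact: cvg_cst|exact: cf]. Qed.

Lemma rderM (u u' : R -> C) t a b : rder u t a -> rder u' t b ->
  rder (fun s => u s * u' s) t (a * u' t + u t * b).
Proof.
move=> hu hu'.
have sq y c : rder y t c -> rder (fun s => y s * y s) t (2 * y t * c).
  by move=> hy; apply: (rder_comp (P := fun z => z * z) hy); exact: cder_sqr.
have half (x y : C) : x = 2 * y -> 2^-1 * x = y by move=> ->; rewrite mulKf ?pnatr_eq0.
have := rderZ 2^-1 (rderB (rderB (sq _ _ (rderD hu hu')) (sq _ _ hu)) (sq _ _ hu')).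
rewrite (half _ (a * u' t + u t * b)); last by ring.
by apply: rder_ext => s; apply: half; ring.
Qed.

Lemma rder_shift (u : R -> C) s (a : C) : rder (fun t => u (s + t)) 0 a -> rder u s a.
Proof.
move=> h eps /h[d d0 hd]; exists d => // t td; have := hd (t - s).
by rewrite subr0 addr0 (addrC s) subrK => /(_ td).
Qed.

Lemma rder_scale (u : R -> C) (c : R) (a : C) : rder u 0 a ->
  rder (fun t => u (c * t)) 0 (rcplx c * a).
Proof.
move=> h eps eps0; have c1 : 0 < `|c| + 1 by rewrite ltr_wpDl.
have [|d d0 hd] := h (eps / (`|c| + 1)); first by rewrite divr_gt0.
exists (d / (`|c| + 1)); first by rewrite divr_gt0.
move=> s; rewrite subr0 ltr_pdivlMr // mulrC => sd.
have := hd (c * s); rewrite subr0 normrM mulr0 => /(_ _) H.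
rewrite mulrA -rcplxM [s * c]mulrC; apply: le_trans (H _) _.
  by apply: le_lt_trans sd; rewrite ler_wpM2r // lerDl.
rewrite mulrA ler_wpM2r // -mulrA ler_piMr ?ltW // mulrC.
by rewrite ltr_pdivrMr // mul1r ltrDl.
Qed.

(** Supplies the bound on the second derivative that [riemann_sum] asks for. *)
Lemma rder_locally_bounded (u u' : R -> C) (a b : R) : a <= b ->
  (forall t, a <= t <= b -> rder u t (u' t)) ->
  exists M : R, forall t, a <= t <= b -> n1 (u t) <= M.
Proof.
move=> ab h.
apply: (cousin1 (Q := fun a b => exists M : R, forall t, a <= t <= b -> n1 (u t) <= M) ab).
  move=> x y z _ [M hM] [N hN]; exists (Num.max M N) => t /andP[xt tz].
  rewrite le_max; case: (leP t y) => ty; first by rewrite hM ?xt.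
  by rewrite hN ?orbT // (ltW ty).
move=> x hx; have [d [d0 hd]] := rder_lipschitz (h x hx).
exists d => // y z _ _ hyz hd'; exists (n1 (u x) + (n1 (u' x) + 1) * d) => t ht.
have td : `|t - x| < d by rewrite ltr_norml; lra.
have -> : u t = u x + (u t - u x) by rewrite addrC subrK.
apply: le_trans (n1D _ _) _; rewrite lerD2l; apply: le_trans (hd t td) _.
by apply: ler_wpM2l; [rewrite addr_ge0 ?n1_ge0|exact: ltW].
Qed.

(** Left-endpoint sums: on an interval of length [1 / n] the mean value inequality, used twice,
    bounds the error by [4 * M / n ^+ 2], and there are [n] intervals. *)
Lemma riemann_sum (u u' u'' : R -> C) :
  (forall t, 0 <= t <= 1 -> rder u t (u' t)) ->
  (forall t, 0 <= t <= 1 -> rder u' t (u'' t)) ->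
  (exists M : R, forall t, 0 <= t <= 1 -> n1 (u'' t) <= M) ->
  exists K : R, forall N : nat,
    n1 (u 1 - u 0 - rcplx N.+1%:R^-1 * \sum_(j < N.+1) u' (j%:R / N.+1%:R)) <= K / N.+1%:R.
Proof.
move=> hu hu' [M hM]; exists (4 * M) => N; set n : R := N.+1%:R.
have n0 : 0 < n by rewrite ltr0n.
pose tt (j : nat) : R := j%:R / n.
have ttS j : tt j.+1 = tt j + n^-1 by rewrite /tt -addn1 natrD mulrDl mul1r.
have tt_ge0 j : 0 <= tt j by rewrite divr_ge0 // ltW.
have tt_le1 j : (j <= N.+1)%N -> tt j <= 1 by move=> jN; rewrite /tt ler_pdivrMr // mul1r ler_nat.
have M0 : 0 <= M by apply: le_trans (n1_ge0 _) (hM 0 _); rewrite lexx ler01.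
have inv0 : 0 <= n^-1 by rewrite invr_ge0 ltW.
have step j : (j < N.+1)%N ->
    n1 (u (tt j.+1) - u (tt j) - rcplx n^-1 * u' (tt j)) <= 4 * M / n / n.
  move=> jN; have j0 := tt_ge0 j; have j1 := tt_le1 _ jN; have tS := ttS j.
  have := @rder_bound R (fun t => u t - rcplx t * u' (tt j)) (fun t => u' t - u' (tt j))
     (2 * M * n^-1) (tt j) (tt j.+1).
  rewrite (_ : _ - _ - _ = u (tt j.+1) - u (tt j) - rcplx n^-1 * u' (tt j)); last first.
    by rewrite tS rcplxD; ring.
  move=> H; apply: le_trans (H _ _ _) _.
  - by rewrite tS lerDl.
  - by move=> t ht; apply: rderB; [apply: hu; lra|exact: rder_id].
  - move=> t /andP[t1 t2]; have := @rder_bound R u' u'' M (tt j) t t1.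
    move=> H'; apply: le_trans (H' _ _) _.
    + by move=> s hs; apply: hu'; lra.
    + by move=> s hs; apply: hM; lra.
    + by apply: ler_wpM2l; [rewrite mulr_ge0|rewrite lerBlDl -tS].
  - by rewrite tS addrC addKr le_eqVlt; apply/orP; left; apply/eqP; rewrite /=; ring.
have tel : u 1 - u 0 = \sum_(j < N.+1) (u (tt j.+1) - u (tt j)).
  have -> : (1 : R) = tt N.+1 by rewrite /tt divff // gt_eqF.
  have -> : (0 : R) = tt 0%N by rewrite /tt mul0r.
  by rewrite -(big_mkord xpredT (fun j => u (tt j.+1) - u (tt j))) telescope_sumr.
rewrite tel mulr_sumr -sumrB.
set q := 4 * M / n / n in step *.
have sum_bound (m : nat) : (m <= N.+1)%N ->
    n1 (\sum_(0 <= j < m) (u (tt j.+1) - u (tt j) - rcplx n^-1 * u' (tt j))) <= m%:R * q.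
  elim: m => [|m IH] mN; first by rewrite big_nil n10 mul0r.
  rewrite big_nat_recr //=; apply: le_trans (n1D _ _) _.
  by apply: le_trans (lerD (IH (ltnW mN)) (step m mN)) _; rewrite -[m.+1%:R]natr1 mulrDl mul1r lexx.
have := sum_bound N.+1 (leqnn _); rewrite big_mkord => H; apply: le_trans H _.
by rewrite -/n /q le_eqVlt; apply/orP; left; apply/eqP; field; rewrite gt_eqF.
Qed.

Local Notation line f l v := (fun t : R => f (l + rcplx t *: v)).

Lemma dir_deriveE f l v a : rder (line f l v) 0 a -> dir_derive v f l = a.
Proof.
move=> /rderP[h1 h2]; apply: cplx_ext; rewrite /dir_derive !cE derive1E;
  exact: derive_val.
Qed.

Lemma dir_derive_rder f l v :
  derivable (fun t : R => re (f (l + rcplx t *: v))) 0 1 ->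
  derivable (fun t : R => im (f (l + rcplx t *: v))) 0 1 ->
  rder (line f l v) 0 (dir_derive v f l).
Proof.
move=> h1 h2; apply/rderP; rewrite /dir_derive !cE !derive1E.
by split; [exact: DeriveDef h1 erefl|exact: DeriveDef h2 erefl].
Qed.

Lemma smooth_continuous f : smooth_vec f -> continuous f.
Proof. by move=> /(_ [::])[]. Qed.

Lemma smooth_dir_derive f v : smooth_vec f -> smooth_vec (dir_derive v f).
Proof.
move=> h s; have := h (s ++ [:: v]); rewrite foldr_cat /=.
exact.
Qed.

Lemma smooth_rder f l v s : smooth_vec f ->
  rder (line f l v) s (dir_derive v f (l + rcplx s *: v)).
Proof.
move=> h; apply: rder_shift; have [_ /(_ v (l + rcplx s *: v))[h1 h2]] := h [::].
have := dir_derive_rder h1 h2; apply: rder_ext => t.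
by rewrite -addrA -scalerDl -rcplxD.
Qed.

Lemma smooth_rder0 f l v : smooth_vec f -> rder (line f l v) 0 (dir_derive v f l).
Proof. by move=> /(smooth_rder l v 0); rewrite rcplx0 scale0r addr0. Qed.

Lemma dir_derive_lin f h (c : C) l v : smooth_vec f -> smooth_vec h ->
  dir_derive v (fun l => f l + c * h l) l = dir_derive v f l + c * dir_derive v h l.
Proof.
move=> hf hh; apply: dir_deriveE; apply: rderD; first exact: smooth_rder0.
by apply: rderZ; exact: smooth_rder0.
Qed.

Lemma smooth_foldr f s : smooth_vec f -> smooth_vec (foldr (@dir_derive R g) f s).
Proof. by move=> hf; elim: s => [|v s IH]; [exact: hf|exact: smooth_dir_derive]. Qed.

Lemma smooth_lin f h (c : C) : smooth_vec f -> smooth_vec h ->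
  smooth_vec (fun l => f l + c * h l).
Proof.
move=> hf hh s.
have -> : foldr (@dir_derive R g) (fun l => f l + c * h l) s =
    fun l => foldr (@dir_derive R g) f s l + c * foldr (@dir_derive R g) h s l.
  elim: s => [|v s IH]; first by [].
  rewrite [LHS]/= IH; apply/funext => l.
  exact: dir_derive_lin (smooth_foldr s hf) (smooth_foldr s hh).
have [cf df] := hf s; have [ch dh] := hh s; split=> [|v l].
  exact: continuous_lin cf ch.
have /rderP[h1 h2] := rderD (smooth_rder0 l v (smooth_foldr s hf))
  (rderZ c (smooth_rder0 l v (smooth_foldr s hh))).
by split; exact: ex_derive.
Qed.

(** Every iterated derivative is a multiple of [f], so smoothness reduces to continuity. *)
Lemma smooth_eigen f : continuous f ->
  (forall v, exists c : C, forall l, rder (line f l v) 0 (c * f l)) -> smooth_vec f.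
Proof.
move=> cf hf s.
have [k ->] : exists k : C, foldr (@dir_derive R g) f s = fun l => k * f l.
  elim: s => [|v s [k IH]] /=; first by exists 1; apply/funext => l; rewrite mul1r.
  have [c hc] := hf v; exists (k * c); apply/funext => l; rewrite IH.
  by rewrite (dir_deriveE (rderZ k (hc l))) mulrA.
split=> [|v l]; first exact: continuous_scale cf.
by have [c hc] := hf v; have /rderP[h1 h2] := rderZ k (hc l); split; exact: ex_derive.
Qed.

Lemma dir_deriveZ f l v (c : R) : smooth_vec f ->
  dir_derive (rcplx c *: v) f l = rcplx c * dir_derive v f l.
Proof.
move=> hf; apply: dir_deriveE; have := rder_scale c (smooth_rder0 l v hf).
by apply: rder_ext => t; rewrite scalerA -rcplxM mulrC.
Qed.

(** The displacement goes along [v] first and then along [w] from the displaced point; continuity of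
    the derivative along [w] controls the second part. *)
Lemma dir_deriveD f l v w : smooth_vec f ->
  dir_derive (v + w) f l = dir_derive v f l + dir_derive w f l.
Proof.
move=> hf; apply: dir_deriveE.
have -> : (line f l (v + w)) = fun t => (f (l + rcplx t *: v)) +
    (f (l + rcplx t *: v + rcplx t *: w) - f (l + rcplx t *: v)).
  by apply/funext => t; rewrite [RHS]addrC subrK scalerDr addrA.
apply: rderD; first exact: smooth_rder0.
move=> eps eps0; have e2 : 0 < eps / 2 by rewrite divr_gt0.
have cw : continuous (dir_derive w f) := smooth_continuous (smooth_dir_derive w hf).
have /(cvg_n1P (F := nbhs l))/(_ _ e2)/near_rowP[r r0 hr] := cw l.
(* [B] dominates every coordinate of [v] and [w], so for [|t| < r / B] all displaced points stay
   within [r] of [l]. *)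
pose B := \sum_k (n1 (v 0 k) + n1 (w 0 k)) + 1.
have B0 : 0 < B.
  by rewrite ltr_wpDl // sumr_ge0 // => k _; rewrite addr_ge0 ?n1_ge0.
have BE k : n1 (v 0 k) + n1 (w 0 k) < B.
  rewrite /B (bigD1 k) //=; set S := \sum_(j | _) _.
  have S0 : 0 <= S by rewrite sumr_ge0 // => j _; rewrite addr_ge0 ?n1_ge0.
  lra.
exists (r / B); first by rewrite divr_gt0.
move=> t; rewrite rcplx0 !scale0r !addr0 subrr !subr0 ltr_pdivlMr // => tr.
have small s : `|s| <= `|t| -> n1 (dir_derive w f (l + rcplx t *: v + rcplx s *: w) - dir_derive w f l) <= eps / 2.
  move=> st; apply/ltW/hr => k; rewrite !mxE.
  have -> : l 0 k + rcplx t * v 0 k + rcplx s * w 0 k - l 0 k =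
    rcplx t * v 0 k + rcplx s * w 0 k by ring.
  apply: le_lt_trans tr; apply: le_trans (n1D _ _) _; rewrite !n1_rcplxM.
  apply: (@le_trans _ _ (`|t| * (n1 (v 0 k) + n1 (w 0 k)))).
    rewrite [leRHS]mulrDr; apply: lerD; first exact: lexx.
    by apply: ler_wpM2r; [exact: n1_ge0|exact: st].
  by rewrite ler_wpM2l // ltW.
have := @rder_bound_sym R (fun s => f (l + rcplx t *: v + rcplx s *: w) - rcplx s * dir_derive w f l)
  (fun s => dir_derive w f (l + rcplx t *: v + rcplx s *: w) - dir_derive w f l) (eps / 2) 0 t.
rewrite rcplx0 scale0r addr0 mul0r !subr0 => H.
rewrite (_ : _ - _ - _ = f (l + rcplx t *: v + rcplx t *: w) - rcplx t * dir_derive w f l - f (l + rcplx t *: v)); last by ring.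
have -> : eps * `|t| = 2 * (eps / 2) * `|t| by field.
apply: H => s hs; first by apply: rderB; [exact: smooth_rder|exact: rder_id].
apply: small; move: hs; case: (leP 0 t) => t0 /andP[s1 s2].
  by rewrite !ger0_norm.
by rewrite !ler0_norm ?lerN2 // ltW.
Qed.

(** Twisting by [cexp (- c t)] turns the derivative into the defect [V f - c f]: zero for an
    eigenfunction, small in norm for an approximate one. *)
Lemma rder_twisted f l v (c : C) s : smooth_vec f ->
  rder (fun t => cexp (rcplx t * - c) * f (l + rcplx t *: v)) s
    (cexp (rcplx s * - c) * (dir_derive v f (l + rcplx s *: v) + - c * f (l + rcplx s *: v))).
Proof.
move=> hf; have := rderM (rder_cexp (rder_id (- c) s)) (smooth_rder l v s hf).
set A := (X in rder _ _ X); set B := (X in _ -> rder _ _ X).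
by have -> : A = B by rewrite /A /B; ring.
Qed.

End DirectionalDerivatives.

(** * Operators, characters and exponentials on [Pic^0] *)

Section Operators.
Variables (R : realType) (X : riemann_surface R) (g : nat) (e : 'I_g -> one_form X).
Local Notation C := (Cplx R).
Local Notation V := 'rV[C]_g.
Local Notation T := (pic0_borel e).
Local Notation proj := (pic0_proj e).
Implicit Types (f : pic0 e -> C) (v w l : V).

Lemma vector_fieldE v f l : vector_field v f (proj l) = dir_derive v (f \o proj) l.
Proof.
rewrite /vector_field /dir_derive; congr (cplx (derive1 _ 0) (derive1 _ 0));
  apply/funext => t /=; by rewrite !pic0_projD pic0_projK.
Qed.

Lemma vector_field_comp v f : vector_field v f \o proj = dir_derive v (f \o proj).
Proof. by apply/funext => l; exact: vector_fieldE. Qed.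

Lemma smooth_vector_field v f : smooth f -> smooth (vector_field v f).
Proof. by move=> hf; rewrite /smooth /= vector_field_comp; exact: smooth_dir_derive. Qed.

Lemma smooth_pic0_lin f f' c : smooth f -> smooth f' -> smooth (fun x => f x + c * f' x).
Proof. by move=> hf hf'; exact: (smooth_lin c hf hf'). Qed.

Lemma smooth_pic0_scale f c : smooth f -> smooth (fun x => c * f x).
Proof.
move=> hf; have := smooth_pic0_lin (c - 1) hf hf.
by congr smooth; apply/funext => x; ring.
Qed.

Lemma smooth_cmeasurable f : smooth f -> cmeasurable f.
Proof. by move=> hf; apply: continuous_cmeasurable; exact: smooth_continuous. Qed.

(** The two levels of generation collapse into one induction over the invariant fields. *)
Lemma A_GL1_ind (Q : operator e -> Prop) :
  (forall v, Q (hol_field v)) -> (forall v, Q (antihol_field v)) ->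
  (forall c : C, Q (fun f x => c * f x)) ->
  (forall P P', Q P -> Q P' -> Q (fun f x => P f x + P' f x)) ->
  (forall P P', Q P -> Q P' -> Q (P \o P')) ->
  forall P, A_GL1 P -> Q P.
Proof.
move=> h1 h2 h3 h4 h5 P; elim=> {P} [P [hP|hP]|c|P P' _ ? _ ?|P P' _ ? _ ?]; auto.
  by elim: hP => {P} [P [v _ <-]|c|P P' _ ? _ ?|P P' _ ? _ ?]; auto.
by elim: hP => {P} [P [v _ <-]|c|P P' _ ? _ ?|P P' _ ? _ ?]; auto.
Qed.

Lemma hol_field_D v : D_GL1 (hol_field v : operator e).
Proof. by apply: gen_mem; exists v. Qed.

Lemma hol_field_A v : A_GL1 (hol_field v : operator e).
Proof. by apply: gen_mem; left; exact: hol_field_D. Qed.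

Lemma antihol_field_A v : A_GL1 (antihol_field v : operator e).
Proof. by apply: gen_mem; right; apply: gen_mem; exists v. Qed.

Lemma D_sub_A (P : operator e) : D_GL1 P -> A_GL1 P.
Proof. by move=> hP; apply: gen_mem; left. Qed.

Lemma vector_fieldD v : (vector_field v : operator e) =
  fun f x => hol_field v f x + antihol_field v f x.
Proof.
apply/funext => f; apply/funext => x; rewrite /hol_field /antihol_field -mulrDr.
rewrite [X in _ * X](_ : _ = 2 * vector_field v f x) ?mulKf ?pnatr_eq0 //; ring.
Qed.

Lemma vector_field_A v : A_GL1 (vector_field v : operator e).
Proof.
by rewrite vector_fieldD; apply: gen_add; [exact: hol_field_A|exact: antihol_field_A].
Qed.

(** Written with scalar operators and compositions, the field has the shape to which the clauses of
    [character] apply. *)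
Lemma hol_fieldE v : (hol_field v : operator e) = (fun f x => 2^-1 * f x) \o
  (fun f x => vector_field v f x + ((fun f x => - 'i * f x) \o vector_field ('i *: v)) f x).
Proof. by apply/funext => f; apply/funext => x; rewrite /hol_field /= mulNr. Qed.

Lemma antihol_fieldE v : (antihol_field v : operator e) = (fun f x => 2^-1 * f x) \o
  (fun f x => vector_field v f x + ((fun f x => 'i * f x) \o vector_field ('i *: v)) f x).
Proof. by []. Qed.

Lemma scalar_A c : A_GL1 ((fun f x => c * f x) : operator e).
Proof. exact: gen_scalar. Qed.

Section Characters.
Variable chi : operator e -> C.
Hypothesis hchi : character (@A_GL1 _ _ _ e) chi.

Lemma character_hol v :
  chi (hol_field v) = 2^-1 * (chi (vector_field v) - 'i * chi (vector_field ('i *: v))).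
Proof.
have [sc ad mu _] := hchi; rewrite hol_fieldE.
have As := scalar_A; have Av := vector_field_A.
have Ac : A_GL1 ((fun f x => - 'i * f x) \o vector_field ('i *: v) : operator e).
  by apply: gen_comp; [exact: As|exact: Av].
by rewrite (mu _ _ (As _) (gen_add (Av v) Ac)) (ad _ _ (Av v) Ac) (mu _ _ (As _) (Av _)) !sc mulNr.
Qed.

Lemma character_antihol v :
  chi (antihol_field v) = 2^-1 * (chi (vector_field v) + 'i * chi (vector_field ('i *: v))).
Proof.
have [sc ad mu _] := hchi; rewrite antihol_fieldE.
have As := scalar_A; have Av := vector_field_A.
have Ac : A_GL1 ((fun f x => 'i * f x) \o vector_field ('i *: v) : operator e).
  by apply: gen_comp; [exact: As|exact: Av].
by rewrite (mu _ _ (As _) (gen_add (Av v) Ac)) (ad _ _ (Av v) Ac) (mu _ _ (As _) (Av _)) !sc.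
Qed.

(** Vector fields are additive in [v] on smooth functions; the last clause of [character] passes
    from there to the values of [chi]. *)
Lemma character_vectorD v w :
  chi (vector_field (v + w)) = chi (vector_field v) + chi (vector_field w).
Proof.
have [sc ad mu ext] := hchi; rewrite -ad; try exact: vector_field_A.
apply: ext; first exact: vector_field_A.
  by apply: gen_add; exact: vector_field_A.
by move=> f hf; apply/funext => x; rewrite /vector_field dir_deriveD.
Qed.

Lemma character_vectorZ (c : R) v :
  chi (vector_field (rcplx c *: v)) = rcplx c * chi (vector_field v).
Proof.
have [sc ad mu ext] := hchi; rewrite -[X in X * _]sc -mu.
- apply: ext; first exact: vector_field_A.
    by apply: gen_comp; [exact: scalar_A|exact: vector_field_A].
  by move=> f hf; apply/funext => x; rewrite /vector_field dir_deriveZ.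
- exact: scalar_A.
- exact: vector_field_A.
Qed.

End Characters.

Lemma character_ext (chi chi' : operator e -> C) :
  character (@A_GL1 _ _ _ e) chi -> character (@A_GL1 _ _ _ e) chi' ->
  (forall v, chi (vector_field v) = chi' (vector_field v)) -> same_character chi chi'.
Proof.
move=> hc hc' h P hP.
(* Membership is carried through the induction because the clauses of [character] demand it of each
   factor. *)
suff [] : A_GL1 P /\ chi P = chi' P by [].
move: P hP; apply: A_GL1_ind => [v|v|c|P P' [aP eP] [aP' eP']|P P' [aP eP] [aP' eP']].
- by split; [exact: hol_field_A|rewrite !character_hol // !h].
- by split; [exact: antihol_field_A|rewrite !character_antihol // !h].
- by split; [exact: scalar_A|case: hc => -> _ _ _; case: hc' => -> _ _ _].
- split; first exact: gen_add.
  by case: hc => _ -> // _ _; case: hc' => _ -> // _ _; rewrite eP eP'.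
- split; first exact: gen_comp.
  by case: hc => _ _ -> // _; case: hc' => _ _ -> // _; rewrite eP eP'.
Qed.

(** Along the segment from 0 to [l], the twisted function of [rder_twisted] has zero derivative. *)
Lemma eigenfunction_unique (chi : operator e -> C) f l : eigenfunction chi f ->
  f (proj l) = f (proj 0) * cexp (chi (vector_field l)).
Proof.
move=> [hf _ eig]; set c := chi _; pose F := f \o proj.
have hF : smooth_vec F := hf.
have dF y : dir_derive l F y = c * F y.
  rewrite -vector_field_comp /=.
  have := eig _ (vector_field_A l) => /(congr1 (fun k => k (proj y))) ->.
  by [].
have := @rder0_const R (fun t => cexp (rcplx t * - c) * F (0 + rcplx t *: l)) 0 1 ler01.
rewrite rcplx1 rcplx0 mul1r mul0r scale1r scale0r addr0 add0r cexp0 mul1r => H.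
have {H} <- : cexp (- c) * F l = f (proj 0).
  apply: H => t _; have := rder_twisted 0 l c t hF.
  by rewrite dF mulNr subrr mulr0.
by rewrite mulrAC cexpNM mul1r.
Qed.

(** The exponents of the unitary characters of the torus: integrality on periods is what lets
    [theta_exp] descend to the quotient. *)
Definition integral_functional (theta : V -> R) :=
  [/\ forall l l', theta (l + l') = theta l + theta l',
      forall s l, theta (rcplx s *: l) = s * theta l &
      forall l, period e l -> exists n : int, theta l = n%:~R].

Lemma cexp_2pi_int (n : int) : cexp (two_pi_i * rcplx n%:~R) = 1 :> C.
Proof.
have c1 : cexp two_pi_i = 1 :> C.
  have := re_two_pi_iM (1 : C); have := im_two_pi_iM (1 : C).
  rewrite mulr1 re1 im1 mulr0 oppr0 mulr1 => h1 h2; rewrite /cexp h1 h2.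
  apply: cplx_ext; rewrite !cE expR0 mulr_natl cos2pi sin2pi; ring.
have nat_ m : cexp (two_pi_i * rcplx m%:R) = 1 :> C.
  elim: m => [|m IH]; first by rewrite rcplx0 mulr0 cexp0.
  by rewrite -natr1 rcplxD mulrDr cexpD IH rcplx1 mulr1 c1 mulr1.
case: n => n; first by rewrite -pmulrn.
rewrite NegzE mulrNz -pmulrn rcplxN mulrN.
by have := cexpNM (two_pi_i * rcplx n.+1%:R : C); rewrite nat_ mulr1.
Qed.

Variable theta : V -> R.
Hypothesis htheta : integral_functional theta.

Lemma thetaD l l' : theta (l + l') = theta l + theta l'. Proof. by case: htheta. Qed.
Lemma thetaZ s l : theta (rcplx s *: l) = s * theta l. Proof. by case: htheta. Qed.

Lemma theta0 : theta 0 = 0.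
Proof. by rewrite -(scale0r (0 : V)) -rcplx0 thetaZ mul0r. Qed.

Lemma thetaN l : theta (- l) = - theta l.
Proof. by apply/eqP; rewrite -addr_eq0 -thetaD addNr theta0. Qed.

(** A real-linear functional is bounded through its values on the real basis [delta_mx 0 k],
    ['i *: delta_mx 0 k]. *)
Lemma theta_bound : exists2 K : R, 0 < K & forall l (r : R), 0 < r ->
  (forall k, n1 (l 0 k) < r) -> `|theta l| <= K * r.
Proof.
pose M k := `|theta (delta_mx 0 k)| + `|theta ('i *: delta_mx 0 k)|.
have S0 : 0 <= \sum_k M k by rewrite sumr_ge0 // => k _; rewrite addr_ge0.
exists (\sum_k M k + 1); first by rewrite ltr_wpDl.
move=> l r r0 hr.
have th_sum (s : seq 'I_g) (F : 'I_g -> V) : theta (\sum_(k <- s) F k) = \sum_(k <- s) theta (F k).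
  by elim: s => [|k s IH]; rewrite ?big_nil ?theta0 // !big_cons thetaD IH.
rewrite {1}(row_sum_delta l) th_sum mulrDl mul1r mulr_suml.
apply: le_trans (ler_norm_sum _ _ _) _; apply: (@le_trans _ _ (\sum_k M k * r)); last first.
  by rewrite lerDl ltW.
apply: ler_sum => k _.
have -> : l 0 k *: delta_mx 0 k = rcplx (re (l 0 k)) *: delta_mx 0 k + rcplx (im (l 0 k)) *: ('i *: delta_mx 0 k) :> V.
  by rewrite scalerA -scalerDl; congr (_ *: _); apply: cplx_ext; rewrite !cE; ring.
rewrite thetaD !thetaZ; apply: le_trans (ler_normD _ _) _; rewrite !normrM.
have h1 := re_le_n1 (l 0 k); have h2 := im_le_n1 (l 0 k); have h3 := ltW (hr k).
rewrite /M mulrDl; apply: lerD; rewrite mulrC; apply: ler_wpM2l => //.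
  exact: le_trans h1 h3.
exact: le_trans h2 h3.
Qed.

Definition theta_exp l : C := cexp (two_pi_i * rcplx (theta l)).

Lemma theta_expD l l' : theta_exp (l + l') = theta_exp l * theta_exp l'.
Proof. by rewrite /theta_exp thetaD rcplxD mulrDr cexpD. Qed.

Lemma theta_exp_period l : period e l -> theta_exp l = 1.
Proof. by case: htheta => _ _ h /h[n hn]; rewrite /theta_exp hn cexp_2pi_int. Qed.

Lemma theta_exp_rder l v :
  rder (fun t : R => theta_exp (l + rcplx t *: v)) 0 (two_pi_i * rcplx (theta v) * theta_exp l).
Proof.
have h := rderZ (theta_exp l) (rder_cexp (rder_id (two_pi_i * rcplx (theta v)) 0)).
have -> : two_pi_i * rcplx (theta v) * theta_exp l =
  theta_exp l * (cexp (rcplx 0 * (two_pi_i * rcplx (theta v))) * (two_pi_i * rcplx (theta v))).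
  by rewrite rcplx0 mul0r cexp0 mul1r mulrC.
move: h; apply: rder_ext => t.
by rewrite theta_expD /theta_exp thetaZ rcplxM; congr (_ * cexp _); ring.
Qed.

Lemma theta_exp_continuous : continuous theta_exp.
Proof.
have [K K0 hK] := theta_bound.
move=> l; apply: (cvg_n1P (F := nbhs l) _ _).2 => eps eps0.
have [d d0 hd] := cder_cont (cder_cexp (two_pi_i * rcplx (theta l))) eps0.
have N0 : 0 < n1 (two_pi_i : C) + 1 by rewrite ltr_wpDl ?n1_ge0.
apply/near_rowP; exists (d / (K * (n1 (two_pi_i : C) + 1))); first by rewrite divr_gt0 // mulr_gt0.
move=> v hv; apply: hd.
have -> : two_pi_i * rcplx (theta v) - two_pi_i * rcplx (theta l) = rcplx (theta (v - l)) * two_pi_i.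
  by rewrite thetaD thetaN rcplxD rcplxN; ring.
rewrite n1_rcplxM; set r := d / _ in hv.
have r0 : 0 < r by rewrite divr_gt0 // mulr_gt0.
have := hK (v - l) r r0 => /(_ _) H.
apply: (@le_lt_trans _ _ (K * r * n1 (two_pi_i : C))).
  by apply: ler_wpM2r; [exact: n1_ge0|apply: H => k; rewrite !mxE; exact: hv].
have -> : d = K * r * (n1 (two_pi_i : C) + 1) by rewrite /r; field; rewrite !gt_eqF.
by have := mulr_gt0 K0 r0; lra.
Qed.

Lemma theta_exp_smooth : smooth_vec theta_exp.
Proof.
apply: smooth_eigen; first exact: theta_exp_continuous.
by move=> v; exists (two_pi_i * rcplx (theta v)) => l; exact: theta_exp_rder.
Qed.

Definition pic0_exp (x : pic0 e) : C := theta_exp (repr x).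

Lemma pic0_exp_proj l : pic0_exp (proj l) = theta_exp l.
Proof.
have E : repr (proj l) = l + (repr (proj l) - l) by rewrite [RHS]addrC subrK.
by rewrite /pic0_exp E theta_expD (theta_exp_period (pic0_repr_period e l)) mulr1.
Qed.

Lemma pic0_exp_comp : pic0_exp \o proj = theta_exp.
Proof. by apply/funext => l; exact: pic0_exp_proj. Qed.

Lemma pic0_exp_smooth : smooth pic0_exp.
Proof. by rewrite /smooth /= pic0_exp_comp; exact: theta_exp_smooth. Qed.

Lemma pic0_exp0 : pic0_exp 0 = 1.
Proof.
have -> : 0 = proj 0 by apply: (addrI (proj 0)); rewrite -pic0_projD !addr0.
by rewrite pic0_exp_proj /theta_exp theta0 rcplx0 mulr0 cexp0.
Qed.

Lemma pic0_exp_abs2 x : abs2 (pic0_exp x) = 1.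
Proof.
rewrite /pic0_exp /theta_exp /abs2 /cexp re_two_pi_iM im_rcplx mulr0 oppr0 expR0.
by rewrite rcplx1 mul1r re_cplx im_cplx cos2Dsin2.
Qed.

Lemma pic0_exp_neq0 x : pic0_exp x != 0.
Proof. exact: cexp_neq0. Qed.

Lemma vector_field_exp v c : vector_field v (fun x => c * pic0_exp x) =
  fun x => two_pi_i * rcplx (theta v) * (c * pic0_exp x).
Proof.
apply/funext => x; rewrite -(pic0_projK x) vector_fieldE; apply: dir_deriveE.
have := rderZ c (theta_exp_rder (repr x) v); rewrite pic0_exp_proj mulrCA.
by apply: rder_ext => t /=; rewrite pic0_exp_proj.
Qed.

(** The eigenvalue is read off at the origin, where the exponential equals 1. *)
Definition exp_character (P : operator e) : C := P pic0_exp 0.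

(** All multiples are treated at once because, in a composition, the inner operator returns a
    multiple of the exponential. *)
Lemma exp_eigen P : A_GL1 P -> forall c,
  P (fun x => c * pic0_exp x) = fun x => exp_character P * (c * pic0_exp x).
Proof.
move=> hP.
have [k hk] : exists k, forall c, P (fun x => c * pic0_exp x) = fun x => k * (c * pic0_exp x).
  move: P hP; apply: A_GL1_ind => [v|v|c|P P' [k hk] [k' hk']|P P' [k hk] [k' hk']].
  - exists (2^-1 * (two_pi_i * rcplx (theta v) - 'i * (two_pi_i * rcplx (theta ('i *: v))))) => c.
    by apply/funext => x; rewrite /hol_field !vector_field_exp; ring.
  - exists (2^-1 * (two_pi_i * rcplx (theta v) + 'i * (two_pi_i * rcplx (theta ('i *: v))))) => c.
    by apply/funext => x; rewrite /antihol_field !vector_field_exp; ring.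
  - by exists c.
  - by exists (k + k') => c; apply/funext => x; rewrite hk hk' mulrDl.
  - exists (k * k') => c; apply/funext => x; rewrite /= hk'.
    have -> : (fun x => k' * (c * pic0_exp x)) = fun x => (k' * c) * pic0_exp x.
      by apply/funext => y; rewrite mulrA.
    by rewrite hk; ring.
have E1 : (fun x => 1 * pic0_exp x) = pic0_exp by apply/funext => x; rewrite mul1r.
move=> c; rewrite hk; congr (fun k => (fun x => k * (c * pic0_exp x))).
by rewrite /exp_character -{1}E1 hk pic0_exp0 !mulr1.
Qed.

Lemma exp_eigen1 P : A_GL1 P -> P pic0_exp = fun x => exp_character P * pic0_exp x.
Proof.
move=> hP; have E1 : (fun x => 1 * pic0_exp x) = pic0_exp by apply/funext => x; rewrite mul1r.
by rewrite -{1}E1 (exp_eigen hP); apply/funext => x; rewrite mul1r.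
Qed.

Lemma exp_character_vector v : exp_character (vector_field v) = two_pi_i * rcplx (theta v).
Proof.
have E1 : (fun x => 1 * pic0_exp x) = pic0_exp by apply/funext => x; rewrite mul1r.
by rewrite /exp_character -{1}E1 vector_field_exp pic0_exp0 !mulr1.
Qed.

Lemma exp_characterP : character (@A_GL1 _ _ _ e) exp_character.
Proof.
split=> [c|P Q hP hQ //|P Q hP hQ|P Q hP hQ h].
- by rewrite /exp_character pic0_exp0 mulr1.
- rewrite {1}/exp_character /= (exp_eigen1 hQ) (exp_eigen hP).
  by rewrite pic0_exp0 mulr1.
- by rewrite /exp_character h //; exact: pic0_exp_smooth.
Qed.

Lemma exp_eigenfunction : eigenfunction exp_character pic0_exp.
Proof.
split; first exact: pic0_exp_smooth.
  by exists 0; exact: pic0_exp_neq0.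
by move=> P /exp_eigen1.
Qed.

Lemma exp_eigenspace (chi : operator e -> C) f :
  (forall v, chi (vector_field v) = two_pi_i * rcplx (theta v)) ->
  eigenfunction chi f -> f = fun x => f 0 * pic0_exp x.
Proof.
move=> hc hf; apply/funext => x; rewrite -{1}(pic0_projK x) (eigenfunction_unique _ hf) hc.
by congr (f _ * _); apply: (addrI (proj 0)); rewrite -pic0_projD !addr0.
Qed.

Variable mu : {measure set T -> \bar R}.
Hypothesis mu_haar : haar mu.

Lemma pic0_exp_L2 c : L2 mu (fun x => c * pic0_exp x).
Proof.
have [h1 h2] := smooth_cmeasurable (smooth_pic0_scale c pic0_exp_smooth).
split=> //; rewrite /norm2.
have [_ fin _] := mu_haar.
under eq_integral do rewrite abs2M pic0_exp_abs2 mulr1.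
rewrite integral_cst //; apply: lte_mul_pinfty; rewrite ?lee_fin ?abs2_ge0 //.
Qed.

(** An exact eigenfunction, normalized by the total mass, serves for every tolerance. *)
Lemma exp_character_spectrum : spectrum mu exp_character.
Proof.
split; first exact: exp_characterP.
move=> n P eps eps0 hP; have [pos fin _] := mu_haar.
pose m := fine (mu [set: T]).
have mE : mu [set: T] = m%:E by rewrite fineK // ge0_fin_numE.
have m0 : 0 < m by rewrite -lte_fin -mE.
pose s : C := rcplx (Num.sqrt m)^-1.
exists (fun x => s * pic0_exp x); split.
- exact: smooth_pic0_scale pic0_exp_smooth.
- rewrite /norm2; under eq_integral do rewrite abs2M pic0_exp_abs2 mulr1.
  rewrite integral_cst // mE -EFinM; congr EFin.
  by rewrite /s /abs2 !cE expr0n addr0 exprVn sqr_sqrtr ?mulVf ?gt_eqF // ltW.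
- move=> k; rewrite exp_eigen // /norm2.
  under eq_integral do rewrite subrr /abs2 re0 im0 expr0n addr0.
  by rewrite integral0 lte_fin.
Qed.

End Operators.

(** * Integrality of the spectrum on the period lattice *)

Section SpectrumCharacters.
Variables (R : realType) (X : riemann_surface R) (g : nat) (e : 'I_g -> one_form X).
Local Notation C := (Cplx R).
Local Notation V := 'rV[C]_g.
Local Notation T := (pic0_borel e).
Local Notation proj := (pic0_proj e).
Variable mu : {measure set T -> \bar R}.
Hypothesis mu_haar : haar mu.

Lemma sqr_sum_le (I : Type) (s : seq I) (a : I -> R) :
  (\sum_(j <- s) a j) ^+ 2 <= (size s)%:R * \sum_(j <- s) a j ^+ 2.
Proof.
elim: s => [|j s IH]; first by rewrite !big_nil expr0n mul0r.
rewrite !big_cons /=; set S := \sum_(j <- s) a j in IH *; set Q := \sum_(j <- s) a j ^+ 2 in IH *.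
rewrite -[(size s).+1%:R]natr1; set m : R := (size s)%:R in IH *.
have [m0|m0] := posnP (size s).
  have mE : m = 0 by rewrite /m m0.
  have s0 : s = [::] by exact: size0nil.
  by rewrite mE /S /Q s0 !big_nil add0r mul1r !addr0.
have mp : 0 < m by rewrite ltr0n.
suff : 0 <= m * (Q + m * a j ^+ 2 - 2 * S * a j).
  by rewrite pmulr_rge0 //; nra.
have := sqr_ge0 (S - m * a j); nra.
Qed.

Lemma abs2_sum_le (I : Type) (s : seq I) (z : I -> C) :
  abs2 (\sum_(j <- s) z j) <= (size s)%:R * \sum_(j <- s) abs2 (z j).
Proof.
have reS : re (\sum_(j <- s) z j) = \sum_(j <- s) re (z j).
  by elim: s => [|j s IH]; rewrite ?big_nil // !big_cons reD IH.
have imS : im (\sum_(j <- s) z j) = \sum_(j <- s) im (z j).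
  by elim: {reS} s => [|j s IH]; rewrite ?big_nil // !big_cons imD IH.
rewrite /abs2 reS imS big_split mulrDr; apply: lerD; exact: sqr_sum_le.
Qed.

Lemma cmeasurable_sum (I : Type) (s : seq I) (F : I -> pic0 e -> C) :
  (forall j, cmeasurable (F j)) -> cmeasurable (fun x => \sum_(j <- s) F j x).
Proof.
move=> hF; elim: s => [|j s IH].
  have := @cmeasurable_cst R X g e 0.
  by congr cmeasurable; apply/funext => x; rewrite big_nil.
have := cmeasurableD (hF j) IH.
by congr cmeasurable; apply/funext => x; rewrite big_cons.
Qed.

(** Convexity of the squared norm, by the Cauchy-Schwarz inequality at each point. *)
Lemma norm2_average_le (N : nat) (F : 'I_N.+1 -> pic0 e -> C) (B : R) :
  (forall j, cmeasurable (F j)) -> (forall j, (norm2 mu (F j) <= B%:E)%E) ->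
  (norm2 mu (fun x => rcplx N.+1%:R^-1 * \sum_j F j x)%R <= B%:E)%E.
Proof.
move=> mF hF; set n : R := N.+1%:R; have n0 : 0 < n by rewrite ltr0n.
have n1 : 0 <= n^-1 by rewrite invr_ge0 ltW.
have mS : cmeasurable (fun x => \sum_j F j x) := cmeasurable_sum _ mF.
have mA j : measurable_fun [set: T] (fun x : T => (abs2 (F j x))%:E) by exact: cmeasurable_abs2.
apply: (@le_trans _ _ (n^-1%:E * \sum_j norm2 mu (F j))%E).
  rewrite /norm2 -ge0_integral_sum //; last by move=> j x _; rewrite lee_fin abs2_ge0.
  rewrite -ge0_integralZl_EFin //; last 2 first.
  - by move=> x _; apply: sume_ge0 => j _; rewrite lee_fin abs2_ge0.
  - exact: emeasurable_sum.
  apply: ge0_le_integral => //.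
  - by move=> x _; rewrite lee_fin abs2_ge0.
  - by apply: cmeasurable_abs2; exact: cmeasurableZ.
  - by apply: measurable_funeM; exact: emeasurable_sum.
  - move=> x _; rewrite sumEFin -EFinM lee_fin abs2M.
    have -> : abs2 (rcplx n^-1 : C) = n^-1 * n^-1 by rewrite /abs2 !cE; ring.
    rewrite -mulrA; apply: ler_wpM2l => //; rewrite ler_pdivrMl //.
    have := abs2_sum_le (enum 'I_N.+1) (fun j => F j x).
    by rewrite !big_enum /= size_enum_ord.
apply: (@le_trans _ _ (n^-1%:E * \sum_(j < N.+1) B%:E)%E).
  by apply: lee_wpmul2l; rewrite ?lee_fin //; apply: lee_sum => j _.
by rewrite sumEFin -EFinM lee_fin sumr_const card_ord -mulr_natl mulrA mulVf ?mul1r // gt_eqF.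
Qed.

Lemma limn_einf_le (u : nat -> \bar R) (M : \bar R) : (forall n, (u n <= M)%E) ->
  (limn_einf u <= M)%E.
Proof.
move=> h; rewrite limn_einf_lim; apply: lime_le; first exact: is_cvg_einfs.
apply: nearW => n; apply: le_trans (h n); apply: ereal_inf_lbound.
by exists n => /=.
Qed.

Lemma cvg_abs2 (u : nat -> C) (l : C) : u @ \oo --> l ->
  (fun N => (abs2 (u N))%:E) @ \oo --> (abs2 l)%:E.
Proof.
move=> cv.
have cre : (fun N => re (u N)) @ \oo --> re l by move=> W hW; exact: (cv _ (re_continuous hW)).
have cim : (fun N => im (u N)) @ \oo --> im l by move=> W hW; exact: (cv _ (im_continuous hW)).
apply: cvg_EFin; first by apply: nearW.
suff ca : (fun N => abs2 (u N)) @ \oo --> abs2 l by exact: ca.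
exact: (cvgD (cvgM cre cre) (cvgM cim cim)).
Qed.

(* [u(s) = exp (- c s) f (x + s lam)] has derivative
   [exp (- c s) (V f - c f) (x + s lam)]; its increment over [0, 1] is the limit
   of Riemann sums, to which Fatou's lemma and translation invariance apply. *)
Lemma approximate_eigen_period (f : pic0 e -> C) (lam : V) (c : C) (eps : R) :
  smooth f -> period e lam -> 0 < eps ->
  (norm2 mu (fun x => vector_field lam f x - c * f x)%R < eps%:E)%E ->
  ((abs2 (cexp (- c) - 1))%:E * norm2 mu f <= (expR (2 * `|re c|) * eps)%:E)%E.
Proof.
move=> hf plam eps0 hG.
pose G x := vector_field lam f x + - c * f x.
have sG : smooth G := smooth_pic0_lin (- c) (smooth_vector_field lam hf) hf.
have mG := smooth_cmeasurable sG.
pose tt (N j : nat) : R := j%:R / N.+1%:R.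
pose F N (j : 'I_N.+1) x := cexp (rcplx (tt N j) * - c) * G (x + proj (rcplx (tt N j) *: lam)).
pose U N x := rcplx N.+1%:R^-1 * \sum_j F N j x.
have mF N j : cmeasurable (F N j).
  by apply: cmeasurableZ; exact: cmeasurable_translation.
have mU N : cmeasurable (U N) by apply: cmeasurableZ; apply: cmeasurable_sum.
set B := _ * eps.
(* Translation leaves the norm of [G] unchanged, and for [0 <= s <= 1] the factor [cexp (- s c)] has
   squared modulus at most [expR (2 * |re c|)]. *)
have normF N j : (norm2 mu (F N j) <= B%:E)%E.
  rewrite norm2Z; last exact: cmeasurable_translation.
  rewrite norm2_translation // /B EFinM; apply: lee_pmul.
  - by rewrite lee_fin abs2_ge0.
  - exact: norm2_ge0.
  - rewrite lee_fin; set s := tt N j.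
    have s01 : 0 <= s <= 1.
      rewrite /s /tt divr_ge0 //= ler_pdivrMr ?ltr0n // mul1r ler_nat ltnW //.
    have -> : abs2 (cexp (rcplx s * - c)) = expR (- (2 * s * re c)).
      rewrite /abs2 /cexp !cE; set a := s * - re c - _; set b := s * - im c + _.
      have -> : - (2 * s * re c) = a + a by rewrite /a; ring.
      transitivity (expR a ^+ 2 * (cos b ^+ 2 + sin b ^+ 2)); first by ring.
      by rewrite cos2Dsin2 mulr1 [expR (a + a)]expRD expr2.
    rewrite ler_expR; have := ler_norm (- re c); rewrite normrN; have := normr_ge0 (re c).
    by case/andP: s01; nra.
  - apply: ltW; apply: le_lt_trans hG; rewrite le_eqVlt; apply/orP; left; apply/eqP.
    by congr norm2; apply/funext => x; rewrite /G mulNr.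
have normU N : (norm2 mu (U N) <= B%:E)%E by exact: norm2_average_le.
have cvgU x : (fun N => (abs2 (U N x))%:E) @ \oo --> (abs2 ((cexp (- c) - 1) * f x))%:E.
  set l := repr x; have xE : proj l = x by exact: pic0_projK.
  pose Ff := f \o proj; have hFf : smooth_vec Ff := hf.
  pose u t := cexp (rcplx t * - c) * Ff (l + rcplx t *: lam).
  pose u1 t := cexp (rcplx t * - c) * (G \o proj) (l + rcplx t *: lam).
  have dG (H : V -> C) (sH : smooth_vec H) : smooth_vec (fun y => dir_derive lam H y + - c * H y).
    exact: smooth_lin (smooth_dir_derive lam sH) sH.
  have GE : G \o proj = fun y => dir_derive lam Ff y + - c * Ff y.
    by apply/funext => y; rewrite /G /= vector_fieldE.
  have sG' : smooth_vec (G \o proj) by rewrite GE; exact: dG.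
  have du t : rder u t (u1 t) by rewrite /u1 GE; exact: rder_twisted.
  have du1 t := rder_twisted l lam c t sG'.
  (* The constant [K] depends on [x]: the averages are shown to converge pointwise, which is what
     Fatou's lemma takes. *)
  have [|K hK] := riemann_sum (fun t _ => du t) (fun t _ => du1 t).
    by apply: (rder_locally_bounded (@ler01 R)) => t _; exact: (rder_twisted l lam c t (dG _ sG')).
  (* [lam] is a period, so both ends of the orbit lie over [x]. *)
  have u01 : u 1 - u 0 = (cexp (- c) - 1) * f x.
    rewrite /u rcplx1 rcplx0 mul1r mul0r scale1r scale0r addr0 cexp0 mul1r /Ff /= xE.
    have -> : proj (l + lam) = x.
      by rewrite -xE; apply/pic0_projP; rewrite addrAC subrr add0r.
    by ring.
  have UE N : rcplx N.+1%:R^-1 * \sum_(j < N.+1) u1 (j%:R / N.+1%:R) = U N x.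
    by rewrite /U; congr (_ * _); apply: eq_bigr => j _; rewrite /u1 /F /= pic0_projD xE.
  have cv : (fun N => U N x) @ \oo --> (cexp (- c) - 1) * f x.
    apply: (cvg_n1P _ _).2 => eps1 eps10.
    exists (Num.Def.archi_bound (K / eps1)) => // N /= hN.
    have := hK N; rewrite u01 UE n1B => h; apply: le_lt_trans h _.
    rewrite ltr_pdivrMr ?ltr0n // mulrC -ltr_pdivrMr //.
    have [K0|K0] := leP 0 (K / eps1); last by apply: lt_trans K0 _; rewrite ltr0n.
    by apply: lt_trans (archi_boundP K0) _; rewrite ltr_nat ltnS.
  exact: cvg_abs2 cv.
have mf : cmeasurable f by exact: smooth_cmeasurable.
rewrite -norm2Z // /norm2.
have fat := @fatou _ T R mu [set: T] measurableT (fun N (x : T) => (abs2 (U N x))%:E).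
apply: le_trans _ (le_trans (fat _ _) _).
- rewrite le_eqVlt; apply/orP; left; apply/eqP; apply: eq_integral => x _.
  rewrite is_cvg_limn_einfE; last by apply/cvg_ex; eexists; exact: cvgU.
  by rewrite (cvg_lim _ (cvgU x)).
- by move=> N; exact: cmeasurable_abs2.
- by move=> N x _; rewrite lee_fin abs2_ge0.
- exact: limn_einf_le.
Qed.

(** [approximate_eigen_period] is applied to normalized functions with arbitrarily small tolerance,
    so the factor [cexp (- c) - 1] must vanish. *)
Lemma spectrum_period (chi : operator e -> C) (lam : V) : spectrum mu chi ->
  period e lam -> cexp (chi (vector_field lam)) = 1.
Proof.
move=> [hc happ] pl; set c := chi _.
suff h : abs2 (cexp (- c) - 1) = 0.
  move/eqP: h; rewrite /abs2 paddr_eq0 ?sqr_ge0 // !sqrf_eq0 => /andP[/eqP h1 /eqP h2].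
  have /eqP : cexp (- c) - 1 = 0 by exact: cplx_ext.
  by rewrite subr_eq0 => /eqP E; have := cexpNM c; rewrite E mul1r.
apply/eqP; rewrite eq_le abs2_ge0 andbT; apply/ler_addgt0Pl => eps eps0; rewrite addr0.
have p0 : 0 < expR (2 * `|re c|) := expR_gt0 _.
have e0 : 0 < eps / expR (2 * `|re c|) by rewrite divr_gt0.
have [|f [sf nf hf]] := happ 1%N (fun=> vector_field lam) _ e0.
  by move=> _; exact: vector_field_A.
have := approximate_eigen_period sf pl e0 (hf ord0).
by rewrite nf mule1 lee_fin mulrCA divff ?mulr1 // gt_eqF.
Qed.

Variables (m : nat) (t : 'I_m -> V -> R) (lam : 'I_m -> V).
Hypothesis lam_period : forall k, period e (lam k).
Hypothesis expansion : forall l, l = \sum_k rcplx (t k l) *: lam k.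

(** On a lattice field the value is an integer times [two_pi_i]; real linearity of [chi] on vector
    fields extends this along [expansion]. *)
Lemma spectrum_exp (chi : operator e -> C) : spectrum mu chi -> exists n : 'I_m -> int,
  forall v, chi (vector_field v) = two_pi_i * rcplx (\sum_k (n k)%:~R * t k v).
Proof.
move=> hchi; have [hc _] := hchi.
have /choice[n hn] : forall k, exists n : int, chi (vector_field (lam k)) = n%:~R * two_pi_i.
  by move=> k; apply: cexp_eq1; exact: spectrum_period.
exists n => v.
have c0 : chi (vector_field (0 : V)) = 0.
  by have := character_vectorZ hc 0 (0 : V); rewrite rcplx0 scale0r mul0r.
have cS (s : seq 'I_m) : chi (vector_field (\sum_(k <- s) rcplx (t k v) *: lam k)) =
    two_pi_i * rcplx (\sum_(k <- s) (n k)%:~R * t k v).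
  elim: s => [|k s IH]; first by rewrite !big_nil c0 rcplx0 mulr0.
  rewrite !big_cons character_vectorD // IH character_vectorZ // hn rcplxD mulrDr.
  by congr (_ + _); rewrite rcplxM rcplx_int; ring.
by rewrite {1}(expansion v) cS.
Qed.

End SpectrumCharacters.

(** * Density of the Fourier harmonics *)

Section TrigonometricApproximation.
Variables (R : realType) (X : riemann_surface R) (g : nat) (e : 'I_g -> one_form X).
Local Notation C := (Cplx R).
Local Notation V := 'rV[C]_g.
Local Notation T := (pic0_borel e).
Local Notation proj := (pic0_proj e).

(** Trigonometric polynomials, built one term at a time so that products, bounds and decompositions
    go by induction. *)
Inductive trig : (pic0 e -> C) -> Prop :=
| trig0 : trig (fun=> 0)
| trigA c theta p : integral_functional e theta -> trig p ->
    trig (fun x => c * pic0_exp theta x + p x).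

Lemma trigD p q : trig p -> trig q -> trig (fun x => p x + q x).
Proof.
move=> hp hq; elim: hp => [|c theta p' ht _ IH].
  by move: hq; congr trig; apply/funext => x; rewrite add0r.
by have := trigA c ht IH; congr trig; apply/funext => x; rewrite addrA.
Qed.

Lemma integral_functionalD theta theta' : integral_functional e theta ->
  integral_functional e theta' -> integral_functional e (fun l => theta l + theta' l).
Proof.
move=> [a1 a2 a3] [b1 b2 b3]; split=> [l l'|s l|l hl].
- by rewrite a1 b1; ring.
- by rewrite a2 b2; ring.
- by have [n ->] := a3 _ hl; have [m ->] := b3 _ hl; exists (n + m); rewrite intrD.
Qed.

Lemma integral_functionalZ (n : int) theta : integral_functional e theta ->
  integral_functional e (fun l => n%:~R * theta l).
Proof.
move=> [a1 a2 a3]; split=> [l l'|s l|l hl].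
- by rewrite a1; ring.
- by rewrite a2; ring.
- by have [m ->] := a3 _ hl; exists (n * m); rewrite intrM.
Qed.

Lemma integral_functional_sum (I : Type) (s : seq I) (theta : I -> V -> R) :
  (forall k, integral_functional e (theta k)) ->
  integral_functional e (fun l => \sum_(k <- s) theta k l).
Proof.
move=> h; elim: s => [|k s IH].
  split=> [l l'|t l|l hl]; rewrite ?big_nil ?addr0 ?mulr0 //.
  by exists 0.
have := integral_functionalD (h k) IH; congr integral_functional.
by apply/funext => l; rewrite big_cons.
Qed.

Lemma pic0_expD theta theta' (x : pic0 e) :
  pic0_exp (fun l => theta l + theta' l) x = pic0_exp theta x * pic0_exp theta' x.
Proof. by rewrite /pic0_exp /theta_exp rcplxD mulrDr cexpD. Qed.

Lemma trigZ c p : trig p -> trig (fun x => c * p x).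
Proof.
elim=> [|c' theta p' ht _ IH].
  by have := trig0; congr trig; apply/funext => x; rewrite mulr0.
by have := trigA (c * c') ht IH; congr trig; apply/funext => x; rewrite mulrDr mulrA.
Qed.

Lemma trigM p q : trig p -> trig q -> trig (fun x => p x * q x).
Proof.
have key c theta q' : integral_functional e theta -> trig q' ->
    trig (fun x => c * pic0_exp theta x * q' x).
  move=> ht; elim=> [|c' theta' p' ht' _ IH].
    by have := trig0; congr trig; apply/funext => x; rewrite mulr0.
  have := trigA (c * c') (integral_functionalD ht ht') IH.
  by congr trig; apply/funext => x; rewrite pic0_expD; ring.
move=> hp hq; elim: hp => [|c theta p' ht _ IH].
  by have := trig0; congr trig; apply/funext => x; rewrite mul0r.
by have := trigD (key c theta q ht hq) IH; congr trig; apply/funext => x; rewrite mulrDl.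
Qed.

Lemma trig_exp c theta : integral_functional e theta -> trig (fun x => c * pic0_exp theta x).
Proof.
by move=> ht; have := trigA c ht trig0; congr trig; apply/funext => x; rewrite addr0.
Qed.

Lemma trig_cst c : trig (fun=> c).
Proof.
have h : integral_functional e (fun=> 0).
  by split=> [l l'|s l|l _]; rewrite ?addr0 ?mulr0 //; exists 0.
have := trig_exp c h; congr trig; apply/funext => x.
by rewrite /pic0_exp /theta_exp rcplx0 mulr0 cexp0 mulr1.
Qed.

Lemma trig_cmeasurable p : trig p -> cmeasurable p.
Proof.
elim=> [|c theta p' ht _ IH]; first exact: cmeasurable_cst.
apply: cmeasurableD IH; apply: cmeasurableZ; exact: smooth_cmeasurable (pic0_exp_smooth ht).
Qed.

Definition abs2_bounded (f : pic0 e -> C) := exists M : R, forall x, abs2 (f x) <= M.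

Lemma abs2_boundedD f h : abs2_bounded f -> abs2_bounded h -> abs2_bounded (fun x => f x + h x).
Proof.
move=> [M hM] [N hN]; exists (2 * (M + N)) => x; apply: le_trans (abs2D_le _ _) _.
by have := hM x; have := hN x; lra.
Qed.

Lemma abs2_boundedM f h : abs2_bounded f -> abs2_bounded h -> abs2_bounded (fun x => f x * h x).
Proof.
move=> [M hM] [N hN]; exists (M * N) => x; rewrite abs2M.
by apply: ler_pM; rewrite ?abs2_ge0.
Qed.

Lemma abs2_bounded_cst c : abs2_bounded (fun=> c).
Proof. by exists (abs2 c). Qed.

Lemma trig_bounded p : trig p -> abs2_bounded p.
Proof.
elim=> [|c theta p' ht _ IH]; first exact: abs2_bounded_cst.
apply: abs2_boundedD IH; apply: abs2_boundedM (abs2_bounded_cst c) _.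
by exists 1 => x; rewrite pic0_exp_abs2.
Qed.

Variable mu : {measure set T -> \bar R}.

Definition approximable (f : pic0 e -> C) := cmeasurable f /\
  forall eps : R, 0 < eps -> exists2 p, trig p & (norm2 mu (fun x => f x - p x)%R < eps%:E)%E.

Lemma approximable_trig p : trig p -> approximable p.
Proof.
move=> hp; split; first exact: trig_cmeasurable.
move=> eps eps0; exists p => //; rewrite /norm2.
by under eq_integral do rewrite subrr /abs2 re0 im0 expr0n addr0; rewrite integral0 lte_fin.
Qed.

(** Two terms and the factor 2 of [norm2D_le] account for the quarters. *)
Lemma norm2D_lt F f h (eps : R) : (forall x, F x = f x + h x) -> cmeasurable f -> cmeasurable h ->
  (norm2 mu f < (eps / 4)%:E)%E -> (norm2 mu h < (eps / 4)%:E)%E ->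
  (norm2 mu F < eps%:E)%E.
Proof.
move=> /funext -> mf mh hf hh; apply: le_lt_trans (norm2D_le _ mf mh) _.
have fin u : (norm2 mu u < (eps / 4)%:E)%E -> exists2 r : R, norm2 mu u = r%:E & r < eps / 4.
  move=> hu; exists (fine (norm2 mu u)); last first.
    by rewrite -lte_fin fineK // ge0_fin_numE ?norm2_ge0 // (lt_trans hu) // ltry.
  by rewrite fineK // ge0_fin_numE ?norm2_ge0 // (lt_trans hu) // ltry.
have [a -> ha] := fin _ hf; have [b -> hb] := fin _ hh.
by rewrite -EFinD -EFinM lte_fin; lra.
Qed.

Lemma norm2M_lt f h (M eps : R) : cmeasurable f -> cmeasurable h -> 0 < eps ->
  (forall x, abs2 (f x) <= M) -> (norm2 mu h < (eps / (`|M| + 1))%:E)%E ->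
  (norm2 mu (fun x => f x * h x)%R < eps%:E)%E.
Proof.
move=> mf mh eps0 hM hh; have M0 : 0 < `|M| + 1 by rewrite ltr_wpDl.
apply: le_lt_trans (norm2_le mu (ltW M0) (cmeasurableM mf mh) mh _) _.
  move=> x; rewrite abs2M; apply: ler_wpM2r; first exact: abs2_ge0.
  by have := hM x; have := ler_norm M; lra.
by rewrite -lte_pdivlMl // -EFinM mulrC.
Qed.

Lemma approximableD f h : approximable f -> approximable h -> approximable (fun x => f x + h x).
Proof.
move=> [mf hf] [mh hh]; split; first exact: cmeasurableD.
move=> eps eps0; have e4 : 0 < eps / 4 by lra.
have [p tp np] := hf _ e4; have [q tq nq] := hh _ e4.
exists (fun x => p x + q x); first exact: trigD.
apply: (norm2D_lt _ _ _ np nq); first by move=> x; ring.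
  by apply: cmeasurableB => //; exact: trig_cmeasurable.
by apply: cmeasurableB => //; exact: trig_cmeasurable.
Qed.

(** From [f h - p q = f (h - q) + q (f - p)]: first [q] is chosen against the bound of [f], then [p]
    against the bound of [q], which is known only at that point. *)
Lemma approximableM f h : abs2_bounded f -> approximable f -> approximable h ->
  approximable (fun x => f x * h x).
Proof.
move=> [M hM] [mf hf] [mh hh]; split; first exact: cmeasurableM.
move=> eps eps0; have e4 : 0 < eps / 4 by lra.
have [|q tq nq] := hh (eps / 4 / (`|M| + 1)); first by rewrite divr_gt0 // ltr_wpDl.
have [N hN] := trig_bounded tq.
have [|p tp np] := hf (eps / 4 / (`|N| + 1)); first by rewrite divr_gt0 // ltr_wpDl.
have mp := trig_cmeasurable tp; have mq := trig_cmeasurable tq.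
exists (fun x => p x * q x); first exact: trigM.
have n1 := norm2M_lt mf (cmeasurableB mh mq) e4 hM nq.
have n2 := norm2M_lt mq (cmeasurableB mf mp) e4 hN np.
apply: (norm2D_lt _ _ _ n1 n2); first by move=> x; ring.
  by apply: cmeasurableM => //; exact: cmeasurableB.
by apply: cmeasurableM => //; exact: cmeasurableB.
Qed.

Lemma approximableZ c f : approximable f -> approximable (fun x => c * f x).
Proof.
exact: approximableM (abs2_bounded_cst c) (approximable_trig (trig_cst c)).
Qed.

(** Dominated convergence with majorant [k * abs2 h], followed by approximation of a single
    [f_ N]. *)
Lemma approximable_lim (f_ : nat -> pic0 e -> C) f h (k : R) :
  (forall n, approximable (f_ n)) -> (forall x, f_ ^~ x @ \oo --> f x) ->
  cmeasurable h -> (norm2 mu h < +oo)%E ->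
  (forall n x, abs2 (f_ n x - f x) <= k * abs2 (h x)) -> approximable f.
Proof.
move=> hf cf mh nh hk.
have mf : cmeasurable f.
  split.
    have h1 := @measurable_fun_cvg _ T R [set: T] (fun n (x : T) => re (f_ n x)) (fun x : T => re (f x)).
    apply: h1 => [n|x _]; first exact: (hf n).1.1.
    by move=> W hW; exact: (cf x _ (re_continuous hW)).
  have h1 := @measurable_fun_cvg _ T R [set: T] (fun n (x : T) => im (f_ n x)) (fun x : T => im (f x)).
  apply: h1 => [n|x _]; first exact: (hf n).1.2.
  by move=> W hW; exact: (cf x _ (im_continuous hW)).
split=> // eps eps0; have e4 : 0 < eps / 4 by lra.
have mD n : cmeasurable (fun x => f_ n x - f x) := cmeasurableB (hf n).1 mf.
have cv : norm2 mu (fun x => f_ n x - f x) @[n --> \oo] --> 0%E.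
  have := @dominated_cvg _ T R mu [set: T] measurableT (fun n (x : T) => (abs2 (f_ n x - f x))%:E)
    (fun=> 0%E) (fun x : T => (k%:E * (abs2 (h x))%:E)%E).
  rewrite integral0 /norm2; apply => //.
  - by move=> n; exact: cmeasurable_abs2.
  - move=> x _.
    have -> : 0%E = (abs2 (0 : C))%:E by rewrite /abs2 re0 im0 expr0n addr0.
    apply: cvg_abs2; rewrite -(subrr (f x)); exact: cvgB (cf x) (cvg_cst _).
  - apply: integrableZl => //; apply/integrableP; split; first exact: cmeasurable_abs2.
    by under eq_integral do rewrite gee0_abs ?lee_fin ?abs2_ge0 //.
  - by move=> n x _; rewrite gee0_abs ?lee_fin ?abs2_ge0 // -EFinM lee_fin.
have := cv [set y | (y < (eps / 4)%:E)%E] _ => /(_ _)[|N _ hN].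
  by apply: open_nbhs_nbhs; split; [exact: open_ereal_lt_ereal|rewrite /= lte_fin].
have := hN N (leqnn N) => /= hN1.
have [p tp np] := (hf N).2 _ e4; exists p => //.
have n1 : (norm2 mu (fun x => - (f_ N x - f x))%R < (eps / 4)%:E)%E.
  by move: hN1; congr (_ < _)%E; apply: eq_integral => x _; rewrite /abs2 reN imN !sqrrN.
apply: (norm2D_lt _ _ _ n1 np); first by move=> x; ring.
  have := cmeasurableZ (-1) (mD N); congr cmeasurable.
  by apply/funext => x; rewrite mulN1r.
by apply: cmeasurableB (trig_cmeasurable tp); exact: (hf N).1.
Qed.

Hypothesis mu_fin : (mu [set: T] < +oo)%E.

Lemma approximable_bounded_lim (f_ : nat -> pic0 e -> C) f (M : R) :
  (forall n, approximable (f_ n)) -> (forall x, f_ ^~ x @ \oo --> f x) ->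
  (forall n x, abs2 (f_ n x - f x) <= M) -> approximable f.
Proof.
move=> hf cf hM; apply: (approximable_lim hf cf (@cmeasurable_cst R X g e 1) (k := M)).
  by rewrite norm2_cst /abs2 re1 im1 expr1n expr0n addr0 mul1e.
by move=> n x; rewrite /abs2 re1 im1 expr1n expr0n addr0 mulr1; exact: hM.
Qed.

End TrigonometricApproximation.

(** * A polynomial iteration converging to a step *)

Section Smoothstep.
Variable R : realType.

(** The cubic fixing 0, 1/2 and 1, where 1/2 is repelling: iteration drives [[0, 1]] to a step at
    1/2. Being a polynomial, it sends trigonometric polynomials to trigonometric polynomials. *)
Definition smoothstep (h : R) := 3 * h ^+ 2 - 2 * h ^+ 3.

Definition threshold (h : R) : R := if 1 / 2 < h then 1 else if h == 1 / 2 then 1 / 2 else 0.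

Lemma smoothstep_itv h : 0 <= h <= 1 -> 0 <= smoothstep h <= 1.
Proof.
move=> /andP[h0 h1]; rewrite /smoothstep; apply/andP; split.
  rewrite (_ : _ - _ = h ^+ 2 * (3 - 2 * h)); last by ring.
  by rewrite mulr_ge0 ?sqr_ge0 //; lra.
rewrite -subr_ge0 (_ : _ - _ = (1 - h) ^+ 2 * (1 + 2 * h)); last by ring.
by rewrite mulr_ge0 ?sqr_ge0 //; lra.
Qed.

Lemma iter_smoothstep_itv n h : 0 <= h <= 1 -> 0 <= iter n smoothstep h <= 1.
Proof. by move=> hh; elim: n => [//|n IH]; exact: smoothstep_itv. Qed.

Lemma smoothstep1B h : smoothstep (1 - h) = 1 - smoothstep h.
Proof. by rewrite /smoothstep; ring. Qed.

Lemma iter_smoothstep1B n h : iter n smoothstep (1 - h) = 1 - iter n smoothstep h.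
Proof. by elim: n => [//|n IH]; rewrite !iterS IH smoothstep1B. Qed.

Lemma smoothstep_cvg_gt h : 1 / 2 < h <= 1 -> (fun n => iter n smoothstep h) @ \oo --> (1 : R).
Proof.
move=> /andP[hh h1].
(* [1 - smoothstep a = (1 - a) * (1 - a * (2 * a - 1))], and for [h <= a <= 1] the second factor is
   at most [r < 1]: convergence is geometric. *)
pose r := 1 - h * (2 * h - 1).
have r0 : 0 <= r < 1 by rewrite /r; apply/andP; split; nra.
have key n : h <= iter n smoothstep h <= 1 /\ 1 - iter n smoothstep h <= r ^+ n.
  elim: n => [|n [/andP[a1 a2] a3]]; first by rewrite /= expr0 lexx h1; split=> //; lra.
  rewrite iterS exprS; set a := iter n smoothstep h in a1 a2 a3 *.
  have sE : 1 - smoothstep a = (1 - a) * (1 - a * (2 * a - 1)) by rewrite /smoothstep; ring.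
  have ra : 0 <= 1 - a * (2 * a - 1) <= r by rewrite /r; apply/andP; split; nra.
  case/andP: ra => ra1 ra2; case/andP: r0 => r0 r1.
  have E : 1 - smoothstep a <= r * r ^+ n.
    rewrite sE mulrC; apply: ler_pM => //; lra.
  have s1 : 0 <= 1 - smoothstep a by rewrite sE mulr_ge0 //; lra.
  split=> //; apply/andP; split; last by lra.
  have : 1 - smoothstep a <= 1 - a.
    rewrite sE -[leRHS]mulr1; apply: ler_wpM2l; [lra|].
    by nra.
  by lra.
apply: (@squeeze_cvgr _ _ _ R (fun n => 1 - r ^+ n) (fun=> 1)).
- by apply: nearW => n; have [/andP[? ?] ?] := key n; apply/andP; split; lra.
- rewrite -[X in _ --> X]subr0; apply: cvgB; first exact: cvg_cst.
  by apply: cvg_expr; rewrite ger0_norm; case/andP: r0.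
- exact: cvg_cst.
Qed.

Lemma smoothstep_cvg h : 0 <= h <= 1 -> (fun n => iter n smoothstep h) @ \oo --> threshold h.
Proof.
move=> /andP[h0 h1]; rewrite /threshold; case: ltP => hh.
  by apply: smoothstep_cvg_gt; rewrite hh h1.
case: eqP => [->|/eqP hn].
  have E n : iter n smoothstep (1 / 2) = 1 / 2.
    by elim: n => [//|n IH]; rewrite iterS IH /smoothstep; field.
  by under eq_fun do rewrite E; exact: cvg_cst.
(* The symmetry exchanging [h] and [1 - h] reduces this side to the other. *)
have hlt : h < 1 / 2 by rewrite lt_neqAle hn.
have := @smoothstep_cvg_gt (1 - h).
have -> : 1 / 2 < 1 - h <= 1 by apply/andP; split; lra.
move=> /(_ erefl) c1.
have -> : (fun n => iter n smoothstep h) = (fun n => 1 - iter n smoothstep (1 - h)).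
  by apply/funext => n; rewrite iter_smoothstep1B; ring.
by rewrite -(subrr (1 : R)); apply: cvgB c1; exact: cvg_cst.
Qed.

Lemma cos_near_int (s d : R) : 0 < d -> d < 1 / 2 -> cos (2 * pi * d) < cos (2 * pi * s) ->
  exists n : int, `|s - n%:~R| < d.
Proof.
move=> d0 d1 hc; have p0 := @pi_gt0 R.
(* The nearest integer, so that [2 * pi * |u|] lies in [[0, pi]], where [cos] decreases. *)
pose n := Num.floor (s + 1 / 2); exists n; set u := s - n%:~R.
have /andP[n1 n2] := floor_itv (s + 1 / 2); rewrite -/n intrD in n1 n2.
have u1 : `|u| <= 1 / 2 by rewrite ler_norml /u; apply/andP; split; lra.
move: hc; have -> : cos (2 * pi * s) = cos (2 * pi * `|u|).
  have E (x : R) : cos (2 * pi * x) = re (cexp (two_pi_i * rcplx x)).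
    by rewrite /cexp re_two_pi_iM im_two_pi_iM !cE mulr0 oppr0 expR0; ring.
  have -> : cos (2 * pi * `|u|) = cos (2 * pi * u).
    by have [_|_] := ger0P u; rewrite ?mulrN ?cosN.
  rewrite !E; have -> : s = u + n%:~R by rewrite /u; ring.
  by rewrite rcplxD mulrDr cexpD cexp_2pi_int mulr1.
have itv (w : R) : 0 <= w -> w <= 1 / 2 -> 2 * pi * w \in `[0, pi].
  move=> w0 w1; rewrite in_itv /=; apply/andP; split; last by nra.
  by rewrite !mulr_ge0 ?ler0n ?(ltW p0).
rewrite ltr_cos ?itv ?(ltW d0) ?(ltW d1) //.
by rewrite -!mulrA ltr_pM2l // ltr_pM2l.
Qed.

End Smoothstep.

(** * The sigma-algebra of approximable sets *)

Section Indicators.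
Variables (R : realType) (X : riemann_surface R) (g : nat) (e : 'I_g -> one_form X).
Local Notation C := (Cplx R).
Local Notation V := 'rV[C]_g.
Local Notation T := (pic0_borel e).
Local Notation proj := (pic0_proj e).
Variable mu : {measure set T -> \bar R}.
Hypothesis mu_fin : (mu [set: T] < +oo)%E.

Definition cindic (A : set (pic0 e)) (x : pic0 e) : C := rcplx (\1_A x).

Lemma cindicE A x : cindic A x = if x \in A then 1 else 0.
Proof. by rewrite /cindic indicE; case: (x \in A); rewrite ?rcplx1 ?rcplx0. Qed.

Lemma cindic_bounded A : abs2_bounded (cindic A).
Proof.
exists 1 => x; rewrite cindicE /abs2; case: ifP => _; rewrite ?re1 ?im1 ?re0 ?im0.
  by rewrite expr1n expr0n addr0.
by rewrite expr0n addr0 ler01.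
Qed.

Lemma abs2_cindicB A B x : abs2 (cindic A x - cindic B x) <= 1.
Proof.
rewrite !cindicE /abs2; case: ifP => _; case: ifP => _;
  rewrite ?subrr ?subr0 ?sub0r ?reN ?imN ?re1 ?im1 ?re0 ?im0; lra.
Qed.

Definition approximable_set (A : set (pic0 e)) := approximable mu (cindic A).

Lemma approximable_set0 : approximable_set set0.
Proof.
have := approximable_trig mu (@trig0 _ _ _ e); congr approximable; apply/funext => x.
by rewrite cindicE in_set0.
Qed.

Lemma approximable_setC A : approximable_set A -> approximable_set (~` A).
Proof.
move=> hA; have := approximableD (approximable_trig mu (trig_cst e 1)) (approximableZ (-1) hA).
congr approximable; apply/funext => x; rewrite !cindicE in_setC.
by case: (x \in A) => /=; rewrite mulN1r ?subrr ?subr0.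
Qed.

Lemma approximable_setI A B : approximable_set A -> approximable_set B -> approximable_set (A `&` B).
Proof.
move=> hA hB; have := approximableM (cindic_bounded A) hA hB.
congr approximable; apply/funext => x; rewrite !cindicE in_setI.
by case: (x \in A); case: (x \in B) => /=; rewrite ?mulr1 ?mulr0 ?mul0r.
Qed.

Lemma approximable_setU A B : approximable_set A -> approximable_set B -> approximable_set (A `|` B).
Proof.
move=> hA hB; rewrite -(setCK (A `|` B)) setCU.
by apply: approximable_setC; apply: approximable_setI; exact: approximable_setC.
Qed.

(** At each point the indicators of the finite unions are eventually constant, and bounded
    convergence applies. *)
Lemma approximable_bigcup (A : nat -> set (pic0 e)) : (forall n, approximable_set (A n)) ->
  approximable_set (\bigcup_n A n).
Proof.
move=> hA; pose B n := \big[setU/set0]_(k < n) A k.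
have hB n : approximable_set (B n).
  rewrite /B; elim: n => [|n IH]; first by rewrite big_ord0; exact: approximable_set0.
  by rewrite big_ord_recr /=; exact: approximable_setU.
apply: (approximable_bounded_lim mu_fin hB (M := 1)); last by move=> n x; exact: abs2_cindicB.
move=> x; apply: cvg_near_cst.
have [[N _ hN]|hx] := pselect ((\bigcup_n A n) x).
  exists N.+1 => // n /= hn; rewrite !cindicE !mem_set //; first by exists N.
  by rewrite /B -bigcup_mkord; exists N.
apply: nearW => n; rewrite !cindicE !memNset // /B -bigcup_mkord => -[k _ hk].
by apply: hx; exists k.
Qed.

Lemma approximable_sigma_algebra : sigma_algebra [set: pic0 e] approximable_set.
Proof.
split; first exact: approximable_set0.
  by move=> A hA; rewrite setTD; exact: approximable_setC.
by move=> A hA; exact: approximable_bigcup.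
Qed.

Lemma cvg_rcplx (u : nat -> R) l : u @ \oo --> l -> (fun n => rcplx (u n) : C) @ \oo --> rcplx l.
Proof.
move=> cu; apply: (cvg_n1P _ _).2 => eps eps0.
move/cvgrPdist_lt: cu => /(_ _ eps0); apply: filterS => n hn.
by rewrite /n1 !cE subr0 normr0 addr0 distrC.
Qed.

Lemma trig_smoothstep (G : pic0 e -> R) : trig (fun x => rcplx (G x)) ->
  trig (fun x => rcplx (smoothstep (G x))).
Proof.
move=> hG; have h2 := trigM hG hG.
have := trigD (trigZ (rcplx 3) h2) (trigZ (rcplx (-2)) (trigM h2 hG)).
by congr trig; apply/funext => x; apply: cplx_ext; rewrite /smoothstep !cE; ring.
Qed.

(* The smoothstep iterates of [G] are trigonometric polynomials with limit [f]
   in [{0, 1/2, 1}], and [2 f^2 - f] is the indicator of [1 / 2 < G]. *)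
Lemma approximable_superlevel (G : pic0 e -> R) : trig (fun x => rcplx (G x)) ->
  (forall x, 0 <= G x <= 1) -> approximable_set [set x | 1 / 2 < G x].
Proof.
move=> hG G01.
have hi n : trig (fun x => rcplx (iter n (@smoothstep R) (G x))).
  by elim: n => [//|n IH]; exact: (trig_smoothstep IH).
have b01 (r : R) : 0 <= r <= 1 -> abs2 (rcplx r : C) <= 1.
  by case/andP => r0 r1; rewrite /abs2 !cE expr0n addr0; nra.
have t01 r : 0 <= r <= 1 -> 0 <= (threshold r : R) <= 1.
  by move=> _; rewrite /threshold; case: ifP => _; [|case: ifP => _]; lra.
have hth : approximable mu (fun x => rcplx (threshold (G x))).
  apply: (approximable_bounded_lim mu_fin (M := 1) (fun n => approximable_trig mu (hi n))).
    by move=> x; apply: cvg_rcplx; exact: smoothstep_cvg.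
  move=> n x; have := iter_smoothstep_itv n (G01 x); have := t01 _ (G01 x).
  set a := threshold _; set b := iter _ _ _; rewrite /abs2 !cE subr0 expr0n addr0; nra.
have bth : abs2_bounded (fun x => rcplx (threshold (G x)) : C).
  by exists 1 => x; apply: b01; exact: t01.
have := approximableD (approximableZ (rcplx 2) (approximableM bth hth hth))
  (approximableZ (rcplx (-1)) hth).
congr approximable; apply/funext => x; rewrite cindicE /threshold; apply: cplx_ext;
  case: ifPn => [h|h].
- by rewrite mem_set // !cE; ring.
- rewrite memNset; last by move=> /= hh; rewrite hh in h.
  by case: ifP => _; rewrite !cE; field.
- by rewrite mem_set // !cE; ring.
- rewrite memNset; last by move=> /= hh; rewrite hh in h.
  by case: ifP => _; rewrite !cE; field.
Qed.

(** The conjugate of an exponential is the exponential of the opposite functional. *)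
Lemma trig_re p : trig p -> @trig _ _ _ e (fun x => rcplx (re (p x))).
Proof.
elim=> [|c theta p' ht _ IH].
  by have := @trig0 _ _ _ e; congr trig; apply/funext => x; rewrite re0 rcplx0.
have htN := integral_functionalZ (-1) ht.
have := trigD (trigD (trig_exp (rcplx 2^-1 * c) ht) (trig_exp (rcplx 2^-1 * c^*) htN)) IH.
congr trig; apply/funext => x; rewrite -!mulrA -mulrDr.
rewrite reD rcplxD; congr (_ + _).
have -> : pic0_exp (fun l => (-1)%:~R * theta l) x = (pic0_exp theta x)^*.
  rewrite /pic0_exp /theta_exp /cexp !re_two_pi_iM !im_two_pi_iM; set r := theta _.
  by apply: cplx_ext; rewrite !cE !mulr0 oppr0 expR0 mulN1r mulrN ?cosN ?sinN; ring.
by move: (pic0_exp theta x) => z; apply: cplx_ext; rewrite !cE; field.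
Qed.

Lemma approximable_box theta (q c : R) : integral_functional e theta -> -1 <= c <= 1 ->
  approximable_set [set x : pic0 e | c < cos (2 * pi * (theta (repr x) - q))].
Proof.
move=> ht /andP[c0 c1].
(* An affine rescaling into [[0, 1]] sending the level [c] to [1 / 2]: a cosine differs from [c] by
   at most 2, hence the divisor 4. *)
pose G (x : pic0 e) := 1 / 2 + (cos (2 * pi * (theta (repr x) - q)) - c) / 4.
have hG : trig (fun x : pic0 e => rcplx (G x)).
  have := trigD (trig_cst e (rcplx (1 / 2 - c / 4)))
    (trigZ (rcplx (1 / 4)) (trig_re (trig_exp (cexp (two_pi_i * rcplx (- q))) ht))).
  congr trig; apply/funext => x; rewrite /pic0_exp /theta_exp -cexpD -mulrDr -rcplxD -rcplxM -rcplxD.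
  rewrite /cexp re_two_pi_iM im_two_pi_iM !cE mulr0 oppr0 expR0 addrC.
  rewrite /G [in RHS]addrC [theta _ - q]addrC; move: (cos _) => k; congr rcplx; lra.
have := approximable_superlevel hG.
have -> : [set x | 1 / 2 < G x] = [set x : pic0 e | c < cos (2 * pi * (theta (repr x) - q))].
  apply/seteqP; split=> x /=; rewrite /G; lra.
apply=> x; have := cos_le1 (2 * pi * (theta (repr x) - q)); have := cos_geN1 (2 * pi * (theta (repr x) - q)).
by rewrite /G => h1 h2; apply/andP; split; lra.
Qed.

End Indicators.

(** * Density of the eigenfunctions in [L^2] *)

Section FourierDensity.
Import HBNNSimple.
Variables (R : realType) (X : riemann_surface R) (g : nat) (e : 'I_g -> one_form X).
Local Notation C := (Cplx R).
Local Notation V := 'rV[C]_g.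
Local Notation T := (pic0_borel e).
Local Notation proj := (pic0_proj e).
Variable mu : {measure set T -> \bar R}.
Hypothesis mu_haar : haar mu.
Variables (m : nat) (t : 'I_m -> V -> R) (lam : 'I_m -> V).
Hypothesis t_integral : forall k, integral_functional e (t k).
Hypothesis lam_period : forall k, period e (lam k).
Hypothesis expansion : forall l, l = \sum_k rcplx (t k l) *: lam k.

Let mu_fin : (mu [set: T] < +oo)%E. Proof. by case: mu_haar. Qed.

(* The first clause is redundant unless [m = 0]. *)
Definition box (i : {ffun 'I_m -> rat} * rat) : set (pic0 e) := [set x |
  ratr i.2 < (1 : R) /\
  forall k, ratr i.2 < cos (2 * pi * (t k (repr x) - ratr (i.1 k))) ].

Lemma approximable_set_box i : approximable_set mu (box i).
Proof.
case: i => q c; set c' := @ratr R c.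
(* [approximable_box] wants a level in [[-1, 1]]; from 1 on the box is empty, below -1 it is
   everything. *)
have [c1|c1] := ltP c' 1; last first.
  have -> : box (q, c) = set0; last exact: approximable_set0.
  by apply/seteqP; split=> // x /= [h _]; rewrite ltNge c1 in h.
have [c0|c0] := leP (-1) c'; last first.
  have -> : box (q, c) = ~` set0; last first.
    by apply: approximable_setC; exact: approximable_set0.
  apply/seteqP; split=> [x _ []|x _]; split=> [//|k] /=.
  by apply: lt_le_trans c0 _; exact: cos_geN1.
have hb k : approximable_set mu [set x : pic0 e | c' < cos (2 * pi * (t k (repr x) - ratr (q k)))].
  by apply: approximable_box => //; rewrite c0 ltW.
have -> : box (q, c) = \big[setI/setT]_k [set x : pic0 e | c' < cos (2 * pi * (t k (repr x) - ratr (q k)))].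
  apply/seteqP; split=> x /=.
    by move=> [_ h]; elim/big_ind: _ => //= A B; split.
  move=> h; split=> // k; rewrite (bigD1 k) //= in h; exact: h.1.
elim/big_ind: _ => //; last by move=> A B; exact: approximable_setI.
by rewrite -setC0; apply: approximable_setC; exact: approximable_set0.
Qed.

(** Rational boxes form a countable base of the quotient topology: membership says that each
    coordinate [t k] is close to the centre modulo 1. *)
Lemma box_basis (U : set (pic0 e)) l : pic0_open U -> U (proj l) ->
  exists2 i, box i (proj l) & box i `<=` U.
Proof.
move=> oU Ul.
have /near_rowP[r r0 hr] : \forall v \near l, U (proj v) by exact: open_nbhs_nbhs.
pose S := \sum_j \sum_k n1 (lam k 0 j).
have S0 : 0 <= S by rewrite sumr_ge0 // => j _; rewrite sumr_ge0 // => k _; exact: n1_ge0.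
(* [d < 1 / 2] keeps [2 * pi * d] where [cos] decreases, and [2 * d * S < r] lets every lattice
   coordinate move by [2 * d] without leaving the ball around [l]. *)
pose d := Num.min (1 / 3) (r / (4 * (S + 1))).
have d0 : 0 < d by rewrite lt_min; apply/andP; split; [lra|rewrite divr_gt0 //; lra].
have d1 : d < 1 / 2 by rewrite gt_min; apply/orP; left; lra.
have dS : 2 * d * S < r.
  have : d <= r / (4 * (S + 1)) by rewrite ge_min lexx orbT.
  by rewrite ler_pdivlMr; [nra|lra].
have p0 := @pi_gt0 R.
have itv (w : R) : 0 <= w -> w <= 1 / 2 -> 2 * pi * w \in `[0, pi].
  move=> w0 w1; rewrite in_itv /=; apply/andP; split; last by nra.
  by rewrite !mulr_ge0 ?ler0n ?(ltW p0).
(* A rational level between these cosines accepts distances below [d / 2], hence the point of [l],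
   and rejects those from [d] on. *)
have cd : cos (2 * pi * d) < cos (2 * pi * (d / 2)).
  by rewrite ltr_cos ?itv //; [rewrite -!mulrA ltr_pM2l // ltr_pM2l //; lra|lra..].
have [c] := rat_in_itvoo cd; rewrite in_itv /= => /andP[c1 c2].
have /choice[q hq] : forall k, exists q : rat, `|t k l - ratr q| < d / 2.
  move=> k; have [|q] := @rat_in_itvoo R (t k l - d / 2) (t k l + d / 2); first by lra.
  by rewrite in_itv /= => /andP[h1 h2]; exists q; rewrite ltr_norml; apply/andP; split; lra.
have per (k : 'I_m) (x y : V) : proj x = proj y ->
    cos (2 * pi * (t k x - ratr (q k))) = cos (2 * pi * (t k y - ratr (q k))).
  move=> /pic0_projP pxy; have [a1 a2 /(_ _ pxy)[n hn]] := t_integral k.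
  have E s : cos (2 * pi * s) = re (cexp (two_pi_i * rcplx (s : R))).
    by rewrite /cexp re_two_pi_iM im_two_pi_iM !cE mulr0 oppr0 expR0; ring.
  rewrite !E; have -> : t k x - ratr (q k) = (t k y - ratr (q k)) + n%:~R.
    by have := a1 (x - y) y; rewrite subrK hn => ->; ring.
  by rewrite rcplxD mulrDr cexpD cexp_2pi_int mulr1.
exists ([ffun k => q k], c).
  split=> [|k] /=; first by apply: lt_le_trans c2 _; exact: cos_le1.
  rewrite ffunE (per k _ l); last exact: pic0_projK.
  apply: lt_le_trans c2 _; set s := t k l - _.
  have -> : cos (2 * pi * s) = cos (2 * pi * `|s|).
    by have [_|_] := ger0P s; rewrite ?mulrN ?cosN.
  have := hq k; rewrite -/s => hs; have := normr_ge0 s => s0.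
  apply: ltW; rewrite ltr_cos ?itv //; [by rewrite -!mulrA ltr_pM2l // ltr_pM2l|lra..].
move=> x [_ hx] /=; set y : V := repr x.
have /choice[n hn] : forall k, exists n : int, `|t k y - ratr (q k) - n%:~R| < d.
  by move=> k; apply: cos_near_int => //; apply: lt_trans c1 _; have := hx k; rewrite /= ffunE.
(* Subtracting lattice vectors moves [y] to the representative of [x] that lies near [l]. *)
pose v := \sum_k rcplx (t k y - (n k)%:~R) *: lam k.
have vE : y = v + \sum_k rcplx (n k)%:~R *: lam k.
  rewrite {1}(expansion y) -big_split /=; apply: eq_bigr => k _.
  by rewrite -scalerDl -rcplxD subrK.
have pv : proj v = x.
  rewrite -(pic0_projK x) -/y; apply/pic0_projP; rewrite {1}vE opprD addrA subrr add0r.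
  apply/asboolP; rewrite -[asbool _]/(_ \in periods e) rpredN; apply: rpred_sum => k _.
  have -> : rcplx (n k)%:~R *: lam k = lam k *~ n k.
    by rewrite rcplx_int scaler_int.
  by apply: rpredMz; apply/asboolP; exact: lam_period.
rewrite -pv; apply: hr => j.
have -> : v 0 j - l 0 j = \sum_k rcplx (t k y - (n k)%:~R - t k l) * lam k 0 j.
  rewrite {1}(expansion l) /v !summxE -sumrB; apply: eq_bigr => k _.
  by rewrite !mxE !rcplxD !rcplxN; ring.
have n1_sum (s : seq 'I_m) (F : 'I_m -> C) : n1 (\sum_(k <- s) F k) <= \sum_(k <- s) n1 (F k).
  elim: s => [|k s IH]; first by rewrite !big_nil /n1 re0 im0 !normr0 addr0.
  by rewrite !big_cons; apply: le_trans (n1D _ _) _; apply: lerD.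
apply: le_lt_trans (n1_sum _ _) _; apply: le_lt_trans _ dS.
apply: (@le_trans _ _ (\sum_k 2 * d * n1 (lam k 0 j))).
  apply: ler_sum => k _; rewrite n1_rcplxM; apply: ler_wpM2r; first exact: n1_ge0.
  have := hn k; have := hq k; rewrite !ltr_norml ler_norml => /andP[? ?] /andP[? ?].
  by apply/andP; split; lra.
rewrite -mulr_sumr; apply: ler_wpM2l; first by rewrite mulr_ge0 // ltW.
rewrite /S (bigD1 j) //= -[leLHS]addr0; apply: lerD => //.
by apply: sumr_ge0 => i _; apply: sumr_ge0 => k _; exact: n1_ge0.
Qed.

Lemma approximable_open (U : set (pic0 e)) : pic0_open U -> approximable_set mu U.
Proof.
move=> oU.
(* [unpickle] enumerates the boxes; those not contained in [U] are replaced by the empty set. *)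
pose F (n : nat) : set (pic0 e) := if unpickle n is Some i then
  if `[< box i `<=` U >] then box i else set0 else set0.
have -> : U = \bigcup_n F n.
  apply/seteqP; split=> [x Ux|x [n _]].
    have [|i hi hU] := @box_basis U (repr x) oU; first by rewrite pic0_projK.
    exists (pickle i) => //; rewrite /F pickleK; case: asboolP => // _.
    by rewrite -(pic0_projK x).
  by rewrite /F; case: (unpickle n) => // i; case: asboolP => // h /h.
apply: (approximable_bigcup mu_fin) => n; rewrite /F.
case: (unpickle n) => [i|]; last exact: approximable_set0.
by case: asboolP => _; [exact: approximable_set_box|exact: approximable_set0].
Qed.

Lemma approximable_measurable (A : set T) : measurable A -> approximable_set mu A.
Proof.
move=> mA; apply: (smallest_sub (approximable_sigma_algebra mu_fin)) mA => U.
exact: approximable_open.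
Qed.

Lemma approximable_sum (I : Type) (s : seq I) (F : I -> pic0 e -> C) :
  (forall j, approximable mu (F j)) -> approximable mu (fun x => \sum_(j <- s) F j x).
Proof.
move=> hF; elim: s => [|j s IH].
  by have := approximable_trig mu (@trig0 _ _ _ e); congr approximable; apply/funext => x; rewrite big_nil.
by have := approximableD (hF j) IH; congr approximable; apply/funext => x; rewrite big_cons.
Qed.

(** Increasing simple functions converge to [u], and the squared error is dominated by [u ^+ 2]
    itself. *)
Lemma approximable_nonneg (u : T -> R) : measurable_fun [set: T] u -> (forall x, 0 <= u x) ->
  (norm2 mu (fun x => rcplx (u x)) < +oo)%E -> approximable mu (fun x => rcplx (u x)).
Proof.
move=> mu_ u0 nu.
have mE : measurable_fun [set: T] (EFin \o u) by exact: measurableT_comp.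
have u0E (x : T) : [set: T] x -> (0 <= (EFin \o u) x)%E by move=> _; rewrite lee_fin.
pose a n : {nnsfun T >-> R} := nnsfun_approx measurableT mE n.
have ca x : (fun n => a n x) @ \oo --> u x.
  by have := @cvg_nnsfun_approx _ T R _ measurableT _ mE u0E x I => /fine_cvg.
have au n x : 0 <= a n x <= u x.
  apply/andP; split; first exact: fun_ge0.
  have <- : limn (fun n => a n x) = u x by exact: cvg_lim (ca x).
  apply: (nondecreasing_cvgn_le (u_ := fun n => a n x)) => [i j hij|]; last by apply/cvg_ex; eexists; exact: ca.
  by have /lefP := nd_nnsfun_approx measurableT mE hij; apply.
have mn : cmeasurable (fun x => rcplx (u x) : C).
  by split => //; exact: measurable_cst.
apply: (approximable_lim (f_ := fun n x => rcplx (a n x)) _ _ mn nu (k := 1)).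
- move=> n.
  have := @approximable_sum _ (finmap.enum_fset (fset_set (range (a n))))
    (fun y x => rcplx y * cindic (a n @^-1` [set y]) x).
  rewrite (_ : (fun x => _) = fun x => rcplx (a n x)); last first.
    apply/funext => x; rewrite fimfunE fsbig_finite //=.
    elim: (finmap.enum_fset _) => [|y s IH]; first by rewrite !big_nil rcplx0.
    by rewrite !big_cons IH rcplxD rcplxM.
  by apply => y; apply: approximableZ; apply: approximable_measurable; exact: measurable_sfunP.
- by move=> x; exact: (cvg_rcplx (ca x)).
- move=> n x; have /andP[a0 a1] := au n x.
  by rewrite /abs2 !cE subr0 expr0n /= !addr0 mul1r; nra.
Qed.

Lemma approximable_L2 f : L2 mu f -> approximable mu f.
Proof.
move=> [mr mi nf].
have key (u : T -> R) : measurable_fun [set: T] u -> (forall x, u x ^+ 2 <= abs2 (f x)) ->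
    approximable mu (fun x => rcplx (u x)).
  move=> mu_ hu.
  have pos (w : T -> R) : measurable_fun [set: T] w -> (forall x, 0 <= w x) ->
      (forall x, w x ^+ 2 <= abs2 (f x)) -> approximable mu (fun x => rcplx (w x)).
    move=> mw w0 wf; apply: approximable_nonneg => //; apply: le_lt_trans nf.
    have mn : cmeasurable (fun x => rcplx (w x) : C) by split => //; exact: measurable_cst.
    have := @norm2_le _ _ _ _ mu 1 _ f ler01 mn (conj mr mi); rewrite mul1e; apply=> x.
    by rewrite /abs2 !cE expr0n addr0 mul1r; exact: wf.
  have hp := pos (u^\+)%R (measurable_funrpos mu_) (fun x => funrpos_ge0 _ _).
  have hn := pos (u^\-)%R (measurable_funrneg mu_) (fun x => funrneg_ge0 _ _).
  have := approximableD (hp _) (approximableZ (rcplx (-1)) (hn _)).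
  rewrite (_ : (fun x => _) = fun x => rcplx (u x)); last first.
    apply/funext => x; rewrite -rcplxM -rcplxD mulN1r; congr rcplx.
    by have := congr1 (fun h => h x) (funrposBneg u); apply.
  apply=> x; apply: le_trans (hu x); rewrite /funrpos /funrneg.
    by case: (leP (u x) 0) => h; rewrite ?expr0n ?sqr_ge0.
  by case: (leP (- u x) 0) => h; rewrite ?expr0n ?sqr_ge0 ?sqrrN.
have hr := key _ mr _; have hi := key _ mi _.
have := approximableD (hr _) (approximableZ 'i (hi _)).
rewrite (_ : (fun x => _) = f); last by apply/funext => x; apply: cplx_ext; rewrite !cE /=; ring.
by apply=> x; rewrite /abs2 /=; have := sqr_ge0 (re (f x)); have := sqr_ge0 (im (f x)); lra.
Qed.

Lemma trig_eigenfunctions p : trig p -> exists n (h : 'I_n -> pic0 e -> C),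
  (forall k, exists2 chi, spectrum mu chi & eigenfunction chi (h k)) /\
  p = fun x => \sum_k h k x.
Proof.
elim=> [|c theta p' ht _ [n [h [hh hp]]]].
  by exists 0%N, (fun _ _ => 0); split=> [[]//|]; apply/funext => x; rewrite big_ord0.
(* A zero coefficient would not give an eigenfunction, so such a term is dropped. *)
have [->|c0] := eqVneq c 0.
  by exists n, h; split=> //; rewrite hp; apply/funext => x; rewrite mul0r add0r.
exists n.+1, (fun k => if unlift ord0 k is Some j then h j else fun x => c * pic0_exp theta x).
split=> [k|]; last first.
  apply/funext => x; rewrite hp big_ord_recl unlift_none; congr (_ + _).
  by apply: eq_bigr => j _; rewrite liftK.
case: (unlift ord0 k) => [j|]; first exact: hh.
exists (@exp_character _ _ _ e theta); first exact: exp_character_spectrum.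
split; first exact: (smooth_pic0_scale c (pic0_exp_smooth ht)).
  by exists 0; rewrite pic0_exp0 // mulr1.
by move=> P hP; exact: exp_eigen.
Qed.

Lemma eigenfunctions_dense f (eps : R) : L2 mu f -> 0 < eps ->
  exists n (h : 'I_n -> pic0 e -> C),
    (forall k, exists2 chi, spectrum mu chi & eigenfunction chi (h k)) /\
    (norm2 mu (fun x => f x - \sum_k h k x)%R < eps%:E)%E.
Proof.
move=> /approximable_L2[_ hf] /hf[p /trig_eigenfunctions[n [h [hh ->]]] hp].
by exists n, h.
Qed.

End FourierDensity.
(** * The spectrum *)

Section GL1Spectrum.
Variables (R : realType) (X : riemann_surface R).
Local Notation C := (Cplx R).
Hypothesis (kX : compact [set: X]) (cX : connected [set: X]).
Variables (g : nat) (e : 'I_g -> one_form X).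
Local Notation V := 'rV[C]_g.
Local Notation T := (pic0_borel e).
Hypothesis basis : form_basis e.
Variable b : 'I_g.*2 -> chain X.
Hypothesis b_cycle : forall k, cycle1 (b k).
Hypothesis b_basis : forall c, cycle1 c ->
  exists! m : {ffun 'I_g.*2 -> int}, boundary (chain_sub c (chain_comb m b)).
Variable mu : {measure set T -> \bar R}.
Hypothesis mu_haar : haar mu.

Lemma omega_holomorphic gamma : holomorphic_form (omega gamma : one_form X).
Proof. by have [] := omegaP kX cX basis b_cycle b_basis gamma. Qed.

Lemma scale_omega_holomorphic gamma c : holomorphic_form (scale_form c (omega gamma) : one_form X).
Proof. exact: holomorphic_scale c (omega_holomorphic gamma). Qed.

Lemma dual_forms_exist : exists eta : 'I_g.*2 -> one_form X,
  (forall k, holomorphic_form (eta k)) /\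
  forall k j, 2 * re (chain_int (eta k) (b j)) = (j == k)%:R.
Proof.
have /choice[eta h] : forall k, exists a : one_form X, holomorphic_form a /\
    forall j, 2 * re (chain_int a (b j)) = (j == k)%:R.
  move=> k.
  have [a ha hk] := period_surjective kX cX basis b_cycle b_basis (\row_j (j == k)%:R).
  by exists a; split=> // j; rewrite -real_int_cyclesE hk mxE.
by exists eta; split=> k; [exact: (h k).1|exact: (h k).2].
Qed.

Definition harmonic_functional gamma (l : V) : R := 2 * re (form_eval e l (omega gamma)).

Lemma phi_harmonic_functional gamma l : phi e gamma l = rcplx (harmonic_functional gamma l).
Proof. by rewrite /phi /harmonic_functional; apply: cplx_ext; rewrite !cE; ring. Qed.

Lemma fourier_harmonicE gamma : fourier_harmonic (e := e) gamma = pic0_exp (harmonic_functional gamma).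
Proof. by apply/funext => x; rewrite /fourier_harmonic phi_harmonic_functional. Qed.

(** The dual forms are hidden here: what remains is a basis of periods with integral coordinates,
    and the passage between classes and integer vectors. *)
Lemma lattice_coordinates : exists (t : 'I_g.*2 -> V -> R) (lam : 'I_g.*2 -> V),
  [/\ forall k, integral_functional e (t k), forall k, period e (lam k),
      forall l, l = \sum_k rcplx (t k l) *: lam k,
      forall gamma, exists n : 'I_g.*2 -> int, forall l,
        harmonic_functional gamma l = \sum_k (n k)%:~R * t k l &
      forall n : 'I_g.*2 -> int, exists gamma, forall l,
        harmonic_functional gamma l = \sum_k (n k)%:~R * t k l].
Proof.
have [eta [eta_hol eta_dual]] := dual_forms_exist.
exists (lattice_coord e eta), (lattice_vec e b); split.
- move=> k; split; [exact: lattice_coordD|exact: lattice_coordZ|].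
  by move=> l; exact: (lattice_coord_period basis b_basis eta_hol eta_dual).
- exact: lattice_vec_period.
- exact: lattice_expansion.
- move=> gamma; have [n hn] := phi_expansion kX cX basis b_cycle b_basis eta_hol eta_dual gamma.
  by exists n => l; have := hn l; rewrite phi_harmonic_functional => /(congr1 (@re R)).
- move=> n; have [gamma hn] := phi_surjective kX cX basis b_cycle b_basis eta_hol eta_dual n.
  by exists gamma => l; have := hn l; rewrite phi_harmonic_functional => /(congr1 (@re R)).
Qed.

Lemma harmonic_functional_integral gamma : integral_functional e (harmonic_functional gamma).
Proof.
have [t [lam [ht _ _ hn _]]] := lattice_coordinates.
have [n /funext ->] := hn gamma.
by apply: integral_functional_sum => k; exact: integral_functionalZ.
Qed.

Lemma spectrum_class (chi : operator e -> C) : spectrum mu chi -> exists gamma,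
  forall v, chi (vector_field v) = two_pi_i * rcplx (harmonic_functional gamma v).
Proof.
have [t [lam [_ hlam hexp _ hg]]] := lattice_coordinates.
move=> /(spectrum_exp mu_haar hlam hexp)[n hn].
by have [gamma hgamma] := hg n; exists gamma => v; rewrite hn hgamma.
Qed.

(** The [(1, 0)] part of the real functional [2 * re z] is [z]: half of
    [2 re z - 'i * 2 re ('i * z)] equals [re z + 'i * im z]. *)
Lemma character_hol_harmonic_functional (chi : operator e -> C) gamma :
  character (@A_GL1 _ _ _ e) chi ->
  (forall v, chi (vector_field v) = two_pi_i * rcplx (harmonic_functional gamma v)) ->
  forall v, chi (hol_field v) = form_eval e v (scale_form two_pi_i (omega gamma)).
Proof.
move=> hc hv v; rewrite (character_hol hc) !hv (form_eval_scale basis _ _ (omega_holomorphic gamma)) /harmonic_functional form_evalZl.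
set z := form_eval _ _ _.
have -> : 2^-1 * (two_pi_i * rcplx (2 * re z) - 'i * (two_pi_i * rcplx (2 * re ('i * z)))) =
    two_pi_i * (2^-1 * (rcplx (2 * re z) - 'i * rcplx (2 * re ('i * z)))) :> C by ring.
by congr (_ * _); apply: cplx_ext; rewrite !cE; field.
Qed.

Lemma character_restricts_to (chi : operator e -> C) gamma :
  character (@A_GL1 _ _ _ e) chi ->
  (forall v, chi (vector_field v) = two_pi_i * rcplx (harmonic_functional gamma v)) ->
  restricts_to chi (lambda (scale_form two_pi_i (omega gamma))).
Proof.
move=> hc hv; exists (scale_form two_pi_i (omega gamma)); split.
- exact: scale_omega_holomorphic.
- exact: erefl.
- have [h1 h2 h3 h4] := hc; split=> //; move=> P Q /D_sub_A hP /D_sub_A hQ.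
  + exact: h2.
  + exact: h3.
  + exact: h4.
- exact: character_hol_harmonic_functional.
Qed.

(** A form is determined by its pairing with the holomorphic fields, so the oper must be that of the
    class found by [spectrum_class]. *)
Lemma restricts_to_class (chi : operator e -> C) L : spectrum mu chi -> restricts_to chi L ->
  exists2 gamma, L = lambda (scale_form two_pi_i (omega gamma)) &
    forall v, chi (vector_field v) = two_pi_i * rcplx (harmonic_functional gamma v).
Proof.
move=> hs [a [ha -> _ hv]]; have [gamma hgamma] := spectrum_class hs.
exists gamma; last exact: hgamma.
congr lambda; apply: (form_eval_inj basis ha (scale_omega_holomorphic gamma _)).
move=> v; rewrite -hv; by have [hc _] := hs; exact: character_hol_harmonic_functional.
Qed.

Lemma restricts_to_omega (chi : operator e -> C) gamma : spectrum mu chi ->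
  restricts_to chi (lambda (scale_form two_pi_i (omega gamma))) ->
  forall v, chi (vector_field v) = two_pi_i * rcplx (harmonic_functional gamma v).
Proof.
move=> hs /(restricts_to_class hs)[gamma' /lambda_inj /scale_form_inj E hv] v.
by rewrite hv /harmonic_functional E // two_pi_i_neq0.
Qed.

Lemma oper_real_monodromy_omega :
  [set L : connection X | gl1_oper L /\ real_monodromy L] =
  [set lambda (scale_form two_pi_i (omega gamma)) | gamma in [set: H1 X]].
Proof.
apply/seteqP; split=> [L [[a ha <-] hm]|_ [gamma _ <-]].
  have [gamma hg ->] := real_monodromy_class kX cX ha hm.
  exists gamma; first exact: I.
  by rewrite (omegaE kX cX basis b_cycle b_basis hg).
split.
  exists (scale_form two_pi_i (omega gamma)); last exact: erefl.
  exact: scale_omega_holomorphic.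
exact: real_monodromy_harmonic (omegaP kX cX basis b_cycle b_basis gamma).
Qed.

(** Values on a lattice field are integers times [two_pi_i]; distinct ones are more than 1 apart,
    which isolates the points of the spectrum. *)
Lemma norm_two_pi_i_int (n : int) : `|two_pi_i * n%:~R : C| < 1 -> n = 0.
Proof.
move=> h; apply/eqP; apply: contraTT h => n0; rewrite -real_leNgt ?normr_real ?real1 //.
have h1 : (1 : C) <= `|n%:~R| by rewrite -intr_norm ler1z -gtz0_ge1 normr_gt0.
have h2 : (1 : C) <= `|two_pi_i|.
  have -> : two_pi_i = rcplx (2 * pi) * 'i :> C.
    by apply: cplx_ext; rewrite /two_pi_i !cE; ring.
  rewrite normrM normCi mulr1 -rcplx1.
  have p2 := @pi_ge2 R.
  have h3 x : 0 <= x -> `|rcplx x : C| = rcplx x.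
    by move=> x0; rewrite ger0_norm // lecE /= eqxx.
  by rewrite h3 ?lecE /= ?eqxx /=; lra.
by rewrite normrM -[X in X <= _]mulr1; apply: ler_pM.
Qed.

Lemma discrete_spectrum_pic0 : discrete_spectrum mu.
Proof.
have [t [lam [ht hlam hexp hn _]]] := lattice_coordinates.
split.
- move=> chi hs; have [gamma hv] := spectrum_class hs.
  have [sm nz he] := exp_eigenfunction (harmonic_functional_integral gamma).
  exists (pic0_exp (harmonic_functional gamma)); split=> // P hP; rewrite he //.
  apply/funext => x; congr (_ * _); apply: character_ext hP.
  + exact: (exp_characterP (harmonic_functional_integral gamma)).
  + by case: hs.
  + by move=> v; rewrite hv (exp_character_vector (harmonic_functional_integral gamma)).
(* The fields of the lattice basis with tolerance 1 detect the integers, hence the character. *)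
- move=> chi hs; exists g.*2, (fun k => vector_field (lam k)), 1; split=> //.
    by move=> k; exact: vector_field_A.
  move=> chi' hs' hd; have [c1 _] := hs; have [c2 _] := hs'.
  apply: character_ext => // v.
  have [gamma hv] := spectrum_class hs; have [gamma' hv'] := spectrum_class hs'.
  have E k : harmonic_functional gamma' (lam k) = harmonic_functional gamma (lam k).
    have [_ _ /(_ _ (hlam k))[n1 h1]] := harmonic_functional_integral gamma.
    have [_ _ /(_ _ (hlam k))[n2 h2]] := harmonic_functional_integral gamma'.
    have := hd k; rewrite hv hv' h1 h2 !rcplx_int -mulrBr -intrB rcplx1 => /norm_two_pi_i_int.
    by move/eqP; rewrite subr_eq0 => /eqP ->.
  rewrite hv hv' (hexp v); congr (_ * rcplx _).
  have th_sum gam : harmonic_functional gam (\sum_k rcplx (t k v) *: lam k) = \sum_k t k v * harmonic_functional gam (lam k).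
    rewrite (big_morph (harmonic_functional gam) (thetaD (harmonic_functional_integral gam)) (theta0 (harmonic_functional_integral gam))).
    by apply: eq_bigr => k _; rewrite (thetaZ (harmonic_functional_integral gam)).
  by rewrite !th_sum; apply: eq_bigr => k _; rewrite E.
- move=> f eps; exact: (eigenfunctions_dense mu_haar ht hlam hexp).
Qed.

End GL1Spectrum.
Theorem theorem5p4 (R : realType) (X : riemann_surface R) (g : nat)
    (e : 'I_g -> one_form X)
    (mu : {measure set (pic0_borel e) -> \bar R})
    (curve : smooth_projective_curve X) (genus : has_genus X g)
    (genus_gt0 : (0 < g)%N) (basis : form_basis e) (mu_haar : haar mu) :
  (* omega_gamma and the function e^{2 pi i phi_gamma} are well defined *)
  [/\ forall gamma : H1 X, exists! a : one_form X, harmonic_representative gamma a,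
      forall (gamma : H1 X) (l : 'rV[Cplx R]_g),
        fourier_harmonic gamma (pic0_proj e l) = cexp (two_pi_i * phi e gamma l),
  (* (1) *)
      [/\ discrete_spectrum mu,
          forall chi, spectrum mu chi ->
            exists! L : connection X, restricts_to chi L,
          forall chi L, spectrum mu chi -> restricts_to chi L ->
            gl1_oper L /\ real_monodromy L &
          forall L : connection X, gl1_oper L -> real_monodromy L ->
            exists2 chi, spectrum mu chi /\ restricts_to chi L &
              forall chi', spectrum mu chi' -> restricts_to chi' L ->
                same_character chi' chi] &
  (* (2) *)
      [set L : connection X | gl1_oper L /\ real_monodromy L] =
        [set lambda (scale_form two_pi_i (omega gamma))
           | gamma in [set: H1 X]] /\
      forall (gamma : H1 X) chi, spectrum mu chi ->
        restricts_to chi (lambda (scale_form two_pi_i (omega gamma))) ->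
        [/\ L2 mu (fourier_harmonic gamma),
            eigenfunction chi (fourier_harmonic gamma) &
            forall f, eigenfunction chi f ->
              exists c : Cplx R, f = fun x => c * fourier_harmonic gamma x]].
Proof.
have [kX cX _] := curve; have [_ [b [b_cycle b_basis]]] := genus.
have omega_ gamma := omegaP kX cX basis b_cycle b_basis gamma.
have theta_ gamma := harmonic_functional_integral kX cX basis b_cycle b_basis gamma.
have sets := oper_real_monodromy_omega kX cX basis b_cycle b_basis.
have class_ := restricts_to_class kX cX basis b_cycle b_basis mu_haar.
have chi_class := spectrum_class kX cX basis b_cycle b_basis mu_haar.
have restr := character_restricts_to kX cX basis b_cycle b_basis.
split.
- move=> gamma; exists (omega gamma); split=> // a ha.
  exact: (harmonic_unique kX cX (omega_ gamma) ha).
- by move=> gamma l; rewrite fourier_harmonicE pic0_exp_proj // phi_harmonic_functional.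
- split.
  + exact: discrete_spectrum_pic0.
  + move=> chi hs; have [hc _] := hs; have [gamma hv] := chi_class _ hs.
    exists (lambda (scale_form two_pi_i (omega gamma))); split; first exact: restr.
    (* Two classes prescribing the same values of [chi] have forms with equal pairings, hence equal
       forms. *)
    move=> L /(class_ _ _ hs)[gamma' -> hv']; congr lambda.
    have hol := scale_omega_holomorphic kX cX basis b_cycle b_basis.
    apply: (form_eval_inj basis (hol _ _) (hol _ _)) => v; rewrite -(character_hol_harmonic_functional kX cX basis b_cycle b_basis hc hv).
    exact: (character_hol_harmonic_functional kX cX basis b_cycle b_basis hc hv').
  + move=> chi L hs /(class_ _ _ hs)[gamma -> _].
    rewrite -[_ /\ _]/([set L : connection X | gl1_oper L /\ real_monodromy L] _) sets.
    by exists gamma.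
  + move=> L hL rL.
    have : [set L : connection X | gl1_oper L /\ real_monodromy L] L by [].
    rewrite sets => -[gamma _ <-].
    (* The eigenvalue character of the Fourier harmonic of [gamma] realizes the given oper. *)
    have hc := exp_characterP (theta_ gamma); have hv := exp_character_vector (theta_ gamma).
    exists (@exp_character _ _ _ e (harmonic_functional e gamma)).
      by split; [exact: (exp_character_spectrum (theta_ gamma))|exact: restr].
    move=> chi' hs' hr'; apply: character_ext => //; first by case: hs'.
    move=> v; rewrite hv.
    exact: (restricts_to_omega kX cX basis b_cycle b_basis mu_haar hs' hr').
- split=> // gamma chi hs hr.
  have hv := restricts_to_omega kX cX basis b_cycle b_basis mu_haar hs hr.
  rewrite fourier_harmonicE; split.
  + have := pic0_exp_L2 (theta_ gamma) mu_haar 1; congr (L2 mu _).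
    by apply/funext => x; rewrite mul1r.
  + have [sm nz he] := exp_eigenfunction (theta_ gamma); split=> // P hP; rewrite he //.
    apply/funext => x; congr (_ * _); apply: character_ext hP.
    * exact: (exp_characterP (theta_ gamma)).
    * by case: hs.
    * by move=> v; rewrite hv (exp_character_vector (theta_ gamma)).
  + by move=> f hf; exists (f 0); exact: exp_eigenspace.
Qed.
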